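(* Let $N,M\ge1$, let $\Omega_N\subseteq\mathbb{C}^N$ and $\Omega_M\subseteq\mathbb{C}^M$ be connected open sets, and let $f=(f_1,\ldots,f_M):\Omega_N\to\Omega_M$ be a function. Then the following assertions are equivalent: (1) for every plurisubharmonic function $\varphi:\Omega_M\to\mathbb{R}\cup\{-\infty\}$, the function $\varphi\circ f:\Omega_N\to\mathbb{R}\cup\{-\infty\}$ is plurisubharmonic; (2) for every pluriharmonic function $h:\Omega_M\to\mathbb{R}$, the function $h\circ f:\Omega_N\to\mathbb{R}$ is pluriharmonic; (3) $f$ is holomorphic or $\bar f$ is holomorphic.
   Context: Here $\bar f=(\overline{f_1},\ldots,\overline{f_M})$ is the componentwise complex conjugate of $f$. No regularity of $f$ is assumed a priori. The function identically equal to $-\infty$ is counted as plurisubharmonic. *)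

(* Defs.v *)
From mathcomp Require Import all_boot all_order all_algebra.
From mathcomp Require Import all_classical all_reals all_analysis.
From mathcomp Require Export complex.

Set Implicit Arguments.
Unset Strict Implicit.
Unset Printing Implicit Defensive.

Import Order.TTheory GRing.Theory Num.Theory.
Import numFieldNormedType.Exports.

Local Open Scope classical_set_scope.
Local Open Scope ring_scope.
Local Open Scope complex_scope.

(* Functions on an open set U are represented by total functions on the ambient
   space.  Every notion below depends only on the restriction to U, provided U
   is open.

   Complex scalars are written R[i]^o, the field as a normed space over itself:
   R[i] alone carries no topology.  C^n is 'rV[R[i]^o]_n. *)

Section RealDifferentiability.
Context {R : realType} {V : normedModType R[i]}.
Implicit Types (U : set V) (u : V -> R) (z v : V).

(* A complex space V carries no canonical structure of normed space over R, so
   real directional derivatives are taken along t |-> z + t v, t in R. *)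
Definition along u z v : R -> R := fun t => u (z + t%:C *: v).

Definition real_derivable u z v : Prop := derivable (along u z v) 0 1.

Definition real_derive v u : V -> R := fun z => derive1 (along u z v) 0.

(* All iterated real directional derivatives of order <= k exist and are
   continuous on U. *)
Fixpoint Ck_on (k : nat) U u : Prop :=
  {in U, continuous u} /\
  match k with
  | 0 => True
  | k'.+1 => forall v, (forall z, U z -> real_derivable u z v) /\
                       Ck_on k' U (real_derive v u)
  end.

End RealDifferentiability.

Definition upper_semicontinuous_on {R : realType} {X : topologicalType}
    (U : set X) (u : X -> \bar R) : Prop :=
  forall x, U x -> forall a : R, (u x < a%:E)%E ->
    \forall y \near x, (u y < a%:E)%E.

Section OneVariable.
Context {R : realType}.
Implicit Types U : set R[i]^o.

Definition circle_point (c : R[i]) (r t : R) : R[i]^o :=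
  c + r%:C * (cos t +i* sin t).

(* The integral of an upper semicontinuous u < +oo over a circle is well defined
   in [-oo, +oo[, since u is bounded above on the circle. *)
Definition circle_mean (u : R[i]^o -> \bar R) (c : R[i]) (r : R) : \bar R :=
  (((2 * pi)^-1)%:E *
   \int[lebesgue_measure]_(t in `[0%R, (2 * pi)%R]) u (circle_point c r t))%E.

(* The submean inequality is required for every closed disc contained in U.  The
   constant -oo is allowed. *)
Definition subharmonic_on U (u : R[i]^o -> \bar R) : Prop :=
  [/\ forall c, U c -> (u c < +oo)%E,
      upper_semicontinuous_on U u
    & forall (c : R[i]) (r : R), 0 < r ->
        (forall w : R[i], `|w - c| <= r%:C -> U w) ->
        (u c <= circle_mean u c r)%E].

Definition laplacian (u : R[i]^o -> R) : R[i]^o -> R :=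
  fun z => real_derive (1 : R[i]^o) (real_derive (1 : R[i]^o) u) z
           + real_derive ('i : R[i]^o) (real_derive ('i : R[i]^o) u) z.

Definition harmonic_on U (u : R[i]^o -> R) : Prop :=
  Ck_on 2 U u /\ forall z, U z -> laplacian u z = 0.

End OneVariable.

Section SeveralVariables.
Context {R : realType} {n : nat}.
Implicit Types U : set 'rV[R[i]^o]_n.

Definition complex_line (a b : 'rV[R[i]^o]_n) : R[i]^o -> 'rV[R[i]^o]_n :=
  fun l => a + l *: b.

Definition plurisubharmonic_on U (phi : 'rV[R[i]^o]_n -> \bar R) : Prop :=
  [/\ forall z, U z -> (phi z < +oo)%E,
      upper_semicontinuous_on U phi
    & forall a b,
        subharmonic_on (complex_line a b @^-1` U) (phi \o complex_line a b)].

Definition pluriharmonic_on U (h : 'rV[R[i]^o]_n -> R) : Prop :=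
  Ck_on 2 U h /\
  forall a b, harmonic_on (complex_line a b @^-1` U) (h \o complex_line a b).

End SeveralVariables.

(* C^n and C^m are normed spaces over R[i], so this is complex (Frechet)
   differentiability. *)
Definition holomorphic_on {R : realType} {n m : nat}
    (U : set 'rV[R[i]^o]_n) (f : 'rV[R[i]^o]_n -> 'rV[R[i]^o]_m) : Prop :=
  forall z, U z -> differentiable f z.

Definition conj_fun {R : realType} {n m : nat}
    (f : 'rV[R[i]^o]_n -> 'rV[R[i]^o]_m) : 'rV[R[i]^o]_n -> 'rV[R[i]^o]_m :=
  fun z => map_mx (conjc : R[i]^o -> R[i]^o) (f z).

(* Main.v *)
(** Subharmonicity is handled in its viscosity form: no quadratic polynomial of
    negative Laplacian touches the function from above.  On a disc, continuous
    boundary values are approximated by real parts of polynomials (Fejer), and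
    comparison with these shows that the viscosity form is equivalent to the
    submean inequality, and that a continuous u with u and -u subharmonic is a
    uniform limit of real parts of polynomials, hence smooth.

    (1) => (2): if h is pluriharmonic, h o f and - h o f are plurisubharmonic.

    (2) => (3): test on the real and imaginary parts of z_j and z_j z_k.  If A_j
    and B_j are the d- and dbar-derivatives of f_j in a direction b, harmonicity
    of f_j, f_k and f_j f_k gives A_j B_k + A_k B_j = 0, so at each point all A_j
    or all B_j vanish, for every b.  Where some A_j is nonzero all B_k vanish
    nearby, hence everywhere, since harmonic functions have unique continuation
    on the connected set Omega_N.

    (3) => (1): a viscosity argument doubling the variables transfers a touching
    polynomial for phi o f along a line of C^N to one for phi along a line of
    C^M tangent to f.  Real parts of holomorphic functions are harmonic by
    Goursat's theorem, so nothing beyond complex differentiability is needed. *)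

Require Import Defs.
From HB Require Import structures.
From mathcomp Require Import all_boot all_order all_algebra.
From mathcomp Require Import all_classical all_reals all_analysis.
From mathcomp Require Import measurable_realfun finmap ring lra zify.

Set Implicit Arguments.
Unset Strict Implicit.
Unset Printing Implicit Defensive.

Import Order.TTheory GRing.Theory Num.Theory.
Import numFieldNormedType.Exports.

Local Open Scope classical_set_scope.
Local Open Scope ring_scope.
Local Open Scope complex_scope.

(** [f] has no regularity and a plurisubharmonic function is only upper semicontinuous, possibly -oo
    everywhere, so the composition admits no chain rule. The touching condition is made of
    inequalities at single points and does not need one. Harmonicity is carried by a property
    without derivatives: uniform approximation by real parts of polynomials on discs. It is stable
    under uniform limits, hence passes to derivatives through difference quotients, and the Taylor
    remainder at the centre of a disc depends only on the supremum there. These uniform constants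
    turn information on single complex lines into joint smoothness. Doubling the variables works
    thanks to a cancellation: for a holomorphic curve g with derivative D at h, the square of |x + D
    t - g(h + t)| is bounded to second order by its value at t = 0 plus Re(C t^2), with no multiple
    of |t|^2. The penalty, however large its factor, thus adds no Laplacian. This bound needs a
    second-order jet of g, which complex differentiability yields only after Re g has been compared
    with polynomials. *)

Local Notation normc := Normc.normc.
Local Notation Re := (@complex.Re _).
Local Notation Im := (@complex.Im _).

(** * Real and imaginary parts, and the modulus as a real number *)

Section ComplexModulus.
Context {R : realType}.
Implicit Types (z w : R[i]) (x y : R).

Lemma cReD z w : Re (z + w) = Re z + Re w. Proof. by case: z w => [a b] [c d]. Qed.
Lemma cReN z : Re (- z) = - Re z. Proof. by case: z. Qed.
Lemma cReB z w : Re (z - w) = Re z - Re w. Proof. by rewrite cReD cReN. Qed.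
Lemma cReM z w : Re (z * w) = Re z * Re w - Im z * Im w.
Proof. by case: z w => [a b] [c d]. Qed.
Lemma cImD z w : Im (z + w) = Im z + Im w. Proof. by case: z w => [a b] [c d]. Qed.
Lemma cImN z : Im (- z) = - Im z. Proof. by case: z. Qed.
Lemma cImB z w : Im (z - w) = Im z - Im w. Proof. by rewrite cImD cImN. Qed.
Lemma cImM z w : Im (z * w) = Re z * Im w + Im z * Re w.
Proof. by case: z w => [a b] [c d]. Qed.
Lemma cReZ x z : Re (x%:C * z) = x * Re z. Proof. by rewrite cReM /= mul0r subr0. Qed.
Lemma cImZ x z : Im (x%:C * z) = x * Im z. Proof. by rewrite cImM /= mul0r addr0. Qed.
Lemma cReJ z : Re (conjc z) = Re z. Proof. by case: z. Qed.
Lemma cImJ z : Im (conjc z) = - Im z. Proof. by case: z. Qed.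
Lemma Re_sum (I : Type) (r : seq I) (P : pred I) (F : I -> R[i]) :
  Re (\sum_(i <- r | P i) F i) = \sum_(i <- r | P i) Re (F i).
Proof. exact: (big_morph _ cReD (erefl : Re 0 = 0)). Qed.
Lemma complex_ext z w : Re z = Re w -> Im z = Im w -> z = w.
Proof. by case: z w => [a b] [c d] /= -> ->. Qed.

Lemma normcE z : `|z| = (normc z)%:C. Proof. by case: z. Qed.
Lemma normc_ge0 z : 0 <= normc z. Proof. by case: z => a b; exact: sqrtr_ge0. Qed.
Lemma normc_sq z : normc z ^+ 2 = Re z ^+ 2 + Im z ^+ 2.
Proof. by case: z => a b /=; rewrite sqr_sqrtr// addr_ge0// sqr_ge0. Qed.
Lemma normcD z w : normc (z + w) <= normc z + normc w.
Proof. exact: le_normcD. Qed.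
Lemma normcN z : normc (- z) = normc z. Proof. exact: (@complex.normcN R z). Qed.
Lemma normcB z w : normc (z - w) = normc (w - z).
Proof. by rewrite -normcN opprB. Qed.
Lemma normcBD z w : normc (z - w) <= normc z + normc w.
Proof. by rewrite -(normcN w); exact: normcD. Qed.
Lemma normcM z w : normc (z * w) = normc z * normc w.
Proof. exact: Normc.normcM. Qed.
Lemma normcR x : normc x%:C = `|x|.
Proof. by rewrite /= expr0n/= addr0 sqrtr_sqr. Qed.
Lemma normc0 : normc (0 : R[i]) = 0. Proof. exact: Normc.normc0. Qed.
Lemma normc1 : normc (1 : R[i]) = 1. Proof. exact: Normc.normc1. Qed.
Lemma normci : normc ('i : R[i]) = 1.
Proof. by rewrite /= expr0n/= add0r expr1n sqrtr1. Qed.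
Lemma normcJ z : normc (conjc z) = normc z.
Proof. by case: z => a b /=; rewrite sqrrN. Qed.
Lemma normcX z n : normc (z ^+ n) = normc z ^+ n.
Proof. by elim: n => [|n IH]; rewrite ?expr0 ?normc1// !exprS normcM IH. Qed.
Lemma normc_eq0 z : normc z = 0 -> z = 0. Proof. exact: Normc.eq0_normc. Qed.
Lemma normc_sum (I : Type) (r : seq I) (P : pred I) (F : I -> R[i]) :
  normc (\sum_(i <- r | P i) F i) <= \sum_(i <- r | P i) normc (F i).
Proof.
elim/big_rec2 : _ => [|i x z _ le_xz]; first by rewrite normc0.
by rewrite (le_trans (normcD _ _))// lerD2l.
Qed.
Lemma normc_Re z : `|Re z| <= normc z.
Proof.
by case: z => a b /=; rewrite -sqrtr_sqr ler_sqrt ?addr_ge0 ?sqr_ge0// lerDl sqr_ge0.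
Qed.
Lemma normc_Im z : `|Im z| <= normc z.
Proof.
by case: z => a b /=; rewrite -sqrtr_sqr ler_sqrt ?addr_ge0 ?sqr_ge0// lerDr sqr_ge0.
Qed.
Lemma normc_le_ReIm z : normc z <= `|Re z| + `|Im z|.
Proof.
rewrite -(ler_pXn2r (ltn0Sn 1)) ?nnegrE ?normc_ge0 ?addr_ge0//.
rewrite normc_sq sqrrD !real_normK ?num_real// lerD2r lerDl.
by rewrite mulrn_wge0// mulr_ge0.
Qed.
Lemma mulcJ z : z * conjc z = (normc z ^+ 2)%:C.
Proof.
rewrite normc_sq; case: z => a b; apply/complex_ext; rewrite !(cReM, cImM) /=; ring.
Qed.
Lemma mulcJ1 z : normc z = 1 -> z * conjc z = 1.
Proof. by move=> z1; rewrite mulcJ z1 expr1n. Qed.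
Lemma normc_dist z w : `|normc z - normc w| <= normc (z - w).
Proof.
have h1 := normcD (z - w) w; have h2 := normcD (w - z) z.
rewrite !subrK in h1 h2; rewrite normcB in h2.
rewrite ler_norml; lra.
Qed.
Lemma normc_triangle z w t : normc (z - t) <= normc (z - w) + normc (w - t).
Proof. by apply: le_trans (normcD _ _); rewrite addrA subrK. Qed.
Lemma conjcX z n : conjc (z ^+ n) = conjc z ^+ n.
Proof. exact: rmorphXn. Qed.
Lemma conjcM z w : conjc (z * w) = conjc z * conjc w. Proof. exact: rmorphM. Qed.
Lemma conjcD z w : conjc (z + w) = conjc z + conjc w. Proof. exact: rmorphD. Qed.
Lemma conjc_sum (I : Type) (r : seq I) (P : pred I) (F : I -> R[i]) :
  conjc (\sum_(i <- r | P i) F i) = \sum_(i <- r | P i) conjc (F i).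
Proof. exact: (big_morph _ conjcD (@conjc0 R)). Qed.
Lemma realcM x y : (x * y)%:C = x%:C * y%:C :> R[i]. Proof. exact: rmorphM. Qed.
Lemma realcD x y : (x + y)%:C = x%:C + y%:C :> R[i]. Proof. exact: rmorphD. Qed.

End ComplexModulus.

(** * Roots of unity and discrete orthogonality *)

Section RootsOfUnity.
Context {R : realType}.
Implicit Types (z w : R[i]) (s t : R).

Definition cis t : R[i] := cos t +i* sin t.

Lemma cisD s t : cis (s + t) = cis s * cis t.
Proof.
by apply/complex_ext; rewrite !(cReM, cImM) /= ?cosD ?sinD// addrC.
Qed.
Lemma cis0 : cis 0 = 1. Proof. by rewrite /cis cos0 sin0. Qed.
Lemma normc_cis t : normc (cis t) = 1.
Proof. by rewrite /= cos2Dsin2 sqrtr1. Qed.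
Lemma cisX t n : cis t ^+ n = cis (n%:R * t).
Proof.
elim: n => [|n IH]; first by rewrite mul0r cis0.
by rewrite exprS IH -cisD -natr1 mulrDl mul1r addrC.
Qed.
Lemma cis2pi : cis (2 * pi) = 1.
Proof. by rewrite /cis mulr_natl cos2pi sin2pi. Qed.

Lemma root_of_unity n : (0 < n)%N ->
  exists w, [/\ normc w = 1, w ^+ n = 1 &
    forall k, (0 < k < n)%N -> w ^+ k != 1].
Proof.
move=> n0; have n0' : n%:R != 0 :> R by rewrite pnatr_eq0 -lt0n.
exists (cis (2 * pi / n%:R)); split; first exact: normc_cis.
  by rewrite cisX mulrC divfK// cis2pi.
move=> k /andP[k0 kn]; rewrite cisX; apply/eqP => -[] /= cos1 _.
(* Half the argument of the k-th power: it lies strictly between 0 and pi, where the sine is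
   positive, whereas cos(2x) = 1 forces sin x = 0. *)
set x := pi * (k%:R / n%:R) : R.
have x2 : k%:R * (2 * pi / n%:R) = x *+ 2 by rewrite /x; field.
have kn01 : 0 < (k%:R / n%:R : R) < 1.
  by rewrite divr_gt0 ?ltr0n//= ltr_pdivrMr ?ltr0n// mul1r ltr_nat.
have sx : 0 < sin x.
  apply: sin_gt0_pi; have := pi_gt0 R => pi0; rewrite /x; case/andP: kn01 => h1 h2.
  by rewrite mulr_gt0//= gtr_pMr.
move: cos1; rewrite x2 cos_mulr2n => cos1.
have := cos2Dsin2 x; nra.
Qed.

Lemma geometric_unity w n : w ^+ n = 1 -> w != 1 -> \sum_(j < n) w ^+ j = 0.
Proof.
move=> wn w1; have := subrX1 w n; rewrite wn subrr => /esym/eqP.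
by rewrite mulf_eq0 subr_eq0 (negbTE w1)/= => /eqP.
Qed.

(** Discrete form of the orthogonality of the characters of the circle. Exponents below n do not
    alias, so finite means over the n-th roots replace integrals exactly. Conjugation exchanges a
    and b, which leaves the case b <= a, a geometric sum. *)
Lemma orthogonal_unity w n a b : normc w = 1 -> w ^+ n = 1 ->
  (forall k, (0 < k < n)%N -> w ^+ k != 1) -> (a < n)%N -> (b < n)%N ->
  \sum_(j < n) (w ^+ j) ^+ a * (conjc (w ^+ j)) ^+ b = if a == b then n%:R else 0.
Proof.
move=> w1 wn wk.
have wlogab : forall a b, (b <= a)%N -> (a < n)%N ->
    \sum_(j < n) (w ^+ j) ^+ a * (conjc (w ^+ j)) ^+ b = if a == b then n%:R else 0.
  move=> {}a {}b ba an.
  transitivity (\sum_(j < n) (w ^+ (a - b)) ^+ j).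
    apply: eq_bigr => j _; rewrite -{1}(subnK ba) exprD -mulrA -exprMn mulcJ1.
      by rewrite expr1n mulr1 -!exprM mulnC.
    by rewrite normcX w1 expr1n.
  case: eqP => [->|/eqP ab].
    rewrite subnn expr0; under eq_bigr do rewrite expr1n.
    by rewrite sumr_const card_ord.
  apply: geometric_unity; first by rewrite -exprM mulnC exprM wn expr1n.
  by apply: wk; lia.
move=> an bn; case: (leqP b a) => [|/ltnW] ab; first exact: wlogab.
rewrite eq_sym -[RHS]conjcK -[LHS]conjcK; congr (conjc _).
transitivity (if b == a then n%:R else 0 : R[i]).
  rewrite -wlogab// conjc_sum; apply: eq_bigr => j _.
  rewrite conjcM mulrC; congr (_ * _); last exact: conjcX.
  by rewrite [LHS]conjcX conjcK.
by case: ifP => _; rewrite ?conjc_nat ?conjc0.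
Qed.

End RootsOfUnity.

(** * Coefficient and tail bounds for polynomials *)

Section PolynomialBounds.
Context {R : realType}.
Implicit Types (p q : {poly R[i]}) (z w h : R[i]).

Lemma sum_norm_le (I : finType) (F : I -> R) m :
  (forall i, F i <= m) -> \sum_i F i <= #|I|%:R * m.
Proof.
move=> Fm; apply: le_trans (ler_sum _ (fun i _ => Fm i)) _.
by rewrite sumr_const mulr_natl.
Qed.

(** On the circle 2 Re p is p plus its conjugate. Averaged against the conjugate of z^k with k > 0,
    the conjugate half drops out and p_k remains. The sum [size p + k] bounds all exponents that
    occur, so n roots with n above it suffice. *)
Lemma coef_bound_Re p (m : R) k : (0 < k)%N ->
  (forall z, normc z = 1 -> `|Re p.[z]| <= m) -> normc p`_k <= 2 * m.
Proof.
move=> k0 pm; pose n := (size p + k).+1.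
have [|w [w1 wn wk]] := @root_of_unity R n; first by [].
have w1j j : normc (w ^+ j) = 1 by rewrite normcX w1 expr1n.
have pE j : (Re p.[w ^+ j])%:C *+ 2 =
    \sum_(i < size p) p`_i * (w ^+ j) ^+ i +
    \sum_(i < size p) conjc p`_i * (conjc (w ^+ j)) ^+ i.
  rewrite -mulr_natl -addcJ horner_coef; congr (_ + _).
  by rewrite conjc_sum; apply: eq_bigr => i _; rewrite conjcM [conjc (_ ^+ i)]conjcX.
have : \sum_(j < n) ((Re p.[w ^+ j])%:C *+ 2) * (conjc (w ^+ j)) ^+ k = n%:R * p`_k.
  under eq_bigr do rewrite pE mulrDl.
  rewrite big_split/=.
  under eq_bigr do rewrite mulr_suml.
  rewrite exchange_big/=.
  under [X in _ + X]eq_bigr do rewrite mulr_suml.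
  rewrite [X in _ + X]exchange_big/=.
  rewrite [X in _ + X]big1 ?addr0; last first.
    move=> i _.
    under eq_bigr do rewrite -mulrA -exprD.
    rewrite -mulr_sumr.
    have := @orthogonal_unity R w n 0 (i + k) w1 wn wk.
    under eq_bigr do rewrite expr0 mul1r.
    move=> ->//; first by case: eqP => [|_]; rewrite ?mulr0//; lia.
    by rewrite /n ltnS leq_add2r ltnW// ltn_ord.
  under eq_bigr do under eq_bigr do rewrite -mulrA.
  under eq_bigr => i _.
    rewrite -mulr_sumr (@orthogonal_unity R w n) //; first over.
    - by rewrite /n ltnS ltnW// ltn_addr.
    - by rewrite /n ltnS leq_addl.
  case: (ltnP k (size p)) => ks.
    rewrite (bigD1 (Ordinal ks))//= eqxx big1 ?addr0; last first.
      by move=> i /negPf; rewrite -val_eqE /= => ->; rewrite mulr0.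
    by rewrite mulrC.
  rewrite big1 ?nth_default ?mulr0// => i _; case: eqP => [ik|]; last by rewrite mulr0.
  by have := ltn_ord i; rewrite ik ltnNge ks.
move=> /(congr1 (@Normc.normc R)); rewrite normcM => E.
have n0 : 0 < n%:R :> R by rewrite ltr0n.
have nn : normc (n%:R : R[i]) = n%:R.
  by rewrite -(rmorph_nat (real_complex R)) normcR ger0_norm// ler0n.
rewrite nn in E; rewrite -(ler_pM2l n0) -E.
apply: le_trans (normc_sum _ _ _) _.
rewrite -[n in X in _ <= X]card_ord; apply: sum_norm_le => j.
rewrite normcM normcX normcJ w1j expr1n mulr1 -rmorphMn normcR /= normrMn.
by rewrite mulr_natl lerMn2r pm.
Qed.

Lemma geometric_half n : \sum_(i < n) (2^-1 : R) ^+ i <= 2.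
Proof.
have : (2^-1 : R) ^+ n - 1 = (2^-1 - 1) * \sum_(i < n) 2^-1 ^+ i by rewrite subrX1.
have : 0 <= (2^-1 : R) ^+ n by rewrite exprn_ge0// invr_ge0.
set s := \sum_(i < n) _; lra.
Qed.

(** The tail is h^L times a polynomial with coefficients bounded by K, summed against a geometric
    series of ratio 1/2. The constant is free of the degree, which matters because the degrees of
    approximating polynomials are not controlled. *)
Lemma poly_tail p L (K : R) h :
  (forall k, (L <= k)%N -> normc p`_k <= K) -> normc h <= 2^-1 ->
  normc (p.[h] - \sum_(k < L) p`_k * h ^+ k) <= 2 * K * normc h ^+ L.
Proof.
move=> pK h2.
have K0 : 0 <= K by apply: le_trans (pK L _); rewrite ?normc_ge0.
have -> : p.[h] - \sum_(k < L) p`_k * h ^+ k = (drop_poly L p).[h] * h ^+ L.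
  rewrite -{1}(poly_take_drop L p) hornerD hornerM hornerXn.
  rewrite (@horner_coef_wide _ L (take_poly L p)) ?size_take_poly//.
  under eq_bigr do rewrite coef_take_poly ltn_ord.
  by rewrite addrC addrA subrr add0r addrC subr0 || ring.
rewrite normcM normcX ler_wpM2r ?exprn_ge0 ?normc_ge0//.
rewrite horner_coef; apply: le_trans (normc_sum _ _ _) _.
apply: (@le_trans _ _ (\sum_(i < size (drop_poly L p)) K * 2^-1 ^+ i)).
  apply: ler_sum => i _; rewrite normcM normcX coef_drop_poly.
  apply: ler_pM; rewrite ?normc_ge0 ?exprn_ge0 ?normc_ge0 ?pK ?leq_addl//.
  by rewrite lerXn2r// ?nnegrE ?normc_ge0// invr_ge0.
by rewrite -mulr_sumr mulrC ler_wpM2r// geometric_half.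
Qed.

End PolynomialBounds.

(** * Fejer approximation on the unit circle *)

Section Fejer.
Context {R : realType}.
Implicit Types (u : R[i] -> R) (z w : R[i]).

(** The Fejer kernel as the real part of a polynomial: on the circle, z^a times the conjugate of z^b
    has the same real part as z^|a - b|, and the truncated differences [(a - b) + (b - a)] add up to
    |a - b|. *)
Let fejer_poly n : {poly R[i]} :=
  n%:R^-1 *: \sum_(a < n) \sum_(b < n) 'X^((a - b) + (b - a)).

Lemma fejer_kernel n z : normc z = 1 ->
  Re (fejer_poly n).[z] = n%:R^-1 * normc (\sum_(a < n) z ^+ a) ^+ 2.
Proof.
move=> z1; rewrite hornerZ.
have -> : (n%:R^-1 : R[i]) = (n%:R^-1)%:C by rewrite fmorphV rmorph_nat.
rewrite cReZ; congr (_ * _).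
have <- : Re ((\sum_(a < n) z ^+ a) * conjc (\sum_(a < n) z ^+ a)) =
          normc (\sum_(a < n) z ^+ a) ^+ 2 by rewrite mulcJ.
rewrite horner_sum conjc_sum big_distrlr/= !Re_sum; apply: eq_bigr => a _.
rewrite horner_sum !Re_sum; apply: eq_bigr => b _; rewrite hornerXn conjcX.
case: (leqP b a) => [|/ltnW] ab.
  have := ab; rewrite -subn_eq0 => /eqP ->; rewrite addn0.
  by rewrite -{2}(subnK ab) exprD -mulrA -exprMn mulcJ1// expr1n mulr1.
have := ab; rewrite -subn_eq0 => /eqP ->; rewrite add0n.
rewrite -{2}(subnK ab) exprD mulrA [_ * conjc z ^+ (_ - _)]mulrC -mulrA -exprMn mulcJ1//.
by rewrite expr1n mulr1 -conjcX cReJ.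
Qed.

(* Fejer summation, with the mean over the circle replaced by the mean over
   the n-th roots of unity: the kernel has degree n - 1, so its discrete means
   are exact. *)
Lemma trig_approximation u (m : R) :
  (forall z, normc z = 1 -> `|u z| <= m) ->
  (forall e : R, 0 < e -> exists2 d : R, 0 < d & forall z w,
     normc z = 1 -> normc w = 1 -> normc (z - w) < d -> `|u z - u w| <= e) ->
  forall e : R, 0 < e -> exists p : {poly R[i]}, forall z, normc z = 1 ->
    `|u z - Re p.[z]| <= e.
Proof.
move=> um uc e e0.
have e20 : 0 < e / 2 by rewrite divr_gt0.
have [d d0 ud] := uc _ e20.
have m0 : 0 <= m by apply: le_trans (um 1 _); rewrite ?normc1.
(* When z and w^j are at least d apart, the increment of u is at most 2m and K j is at most 4 / (n
   d^2); the product is at most e/2 once n >= 16 m / (e d^2). *)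
pose n := (Num.truncn (16 * m / (e * d ^+ 2))).+1.
have nbig : 16 * m / (e * d ^+ 2) < n%:R by rewrite truncnS_gt.
have n0 : 0 < n%:R :> R by rewrite ltr0n.
have [|w [w1 wn wk]] := @root_of_unity R n; first by [].
have w1j j : normc (w ^+ j) = 1 by rewrite normcX w1 expr1n.
pose p : {poly R[i]} := \sum_(j < n)
  (u (w ^+ j) / n%:R)%:C *: (fejer_poly n \Po (conjc (w ^+ j) *: 'X)).
exists p => z z1.
pose S j := \sum_(a < n) (z * conjc (w ^+ j)) ^+ a.
have zw1 j : normc (z * conjc (w ^+ j)) = 1 by rewrite normcM z1 normcJ w1j mulr1.
pose K j := n%:R^-1 * normc (S j) ^+ 2.
have K0 j : 0 <= K j by rewrite mulr_ge0 ?invr_ge0 ?exprn_ge0 ?normc_ge0// ltW.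
have pE : Re p.[z] = \sum_(j < n) u (w ^+ j) / n%:R * K j.
  rewrite horner_sum Re_sum; apply: eq_bigr => j _.
  rewrite hornerZ cReZ horner_comp (hornerZ _ 'X) hornerX [_ * z]mulrC.
  by rewrite fejer_kernel.
(* The weights K j / n have total mass one at every z of the circle, not only at the nodes: all
   exponents stay below n, so orthogonality evaluates the double sum exactly. *)
have KS : \sum_(j < n) K j = n%:R.
  rewrite -mulr_sumr.
  suff -> : \sum_(j < n) normc (S j) ^+ 2 = n%:R ^+ 2 by rewrite expr2 mulKf// gt_eqF.
  apply: complexI; rewrite rmorph_sum rmorphXn rmorph_nat/=.
  have SE (j : 'I_n) : (normc (S j) ^+ 2)%:C = \sum_(a < n) \sum_(b < n)
      (z * conjc (w ^+ j)) ^+ a * conjc ((z * conjc (w ^+ j)) ^+ b).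
    by rewrite -mulcJ /S conjc_sum big_distrlr.
  under eq_bigr => j _ do rewrite SE.
  rewrite exchange_big/=.
  under eq_bigr do rewrite exchange_big/=.
  transitivity (\sum_(a < n) \sum_(b < n)
      (if (b : nat) == a then n%:R else 0 : R[i])).
    apply: eq_bigr => a _; apply: eq_bigr => b _.
    have -> : (if (b : nat) == a then n%:R else 0 : R[i]) =
      z ^+ a * conjc (z ^+ b) * (if (b : nat) == a then n%:R else 0).
      case: eqP => [->|]; last by rewrite mulr0.
      by rewrite mulcJ1 ?mul1r// normcX z1 expr1n.
    rewrite -(@orthogonal_unity R w n b a)// mulr_sumr; apply: eq_bigr => j _.
    move: (w ^+ j) => W.
    rewrite [conjc (_ ^+ b)]conjcX conjcM conjcK [conjc (z ^+ b)]conjcX !exprMn; ring.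
  transitivity (\sum_(a < n) (n%:R : R[i])).
    apply: eq_bigr => a _; rewrite (bigD1 a)//= eqxx big1 ?addr0// => b.
    by rewrite -val_eqE => /negPf ->.
  by rewrite sumr_const card_ord expr2 mulr_natr.
have -> : u z - Re p.[z] = \sum_(j < n) (u z - u (w ^+ j)) / n%:R * K j.
  rewrite pE; under [RHS]eq_bigr do rewrite !mulrBl.
  rewrite sumrB; congr (_ - _); rewrite -mulr_sumr KS divfK// gt_eqF//.
apply: le_trans (ler_norm_sum _ _ _) _.
have Kbound j : `|(u z - u (w ^+ j)) / n%:R * K j| <=
    n%:R^-1 * (e / 2 * K j) + n%:R^-1 * (e / 2).
  rewrite normrM (ger0_norm (K0 j)) normrM normfV (ger0_norm (ltW n0)).
  rewrite -mulrA mulrCA -mulrDr ler_pM2l ?invr_gt0//.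
  have [lt|ge] := ltP (normc (z - w ^+ j)) d.
    apply: (@le_trans _ _ (e / 2 * K j)); last by rewrite lerDl ltW.
    by rewrite ler_wpM2r// ud.
  apply: (@le_trans _ _ (e / 2)); last by rewrite lerDr mulr_ge0// ltW.
  (* With zeta the product of z and the conjugate of w^j, the geometric sum gives S j (zeta - 1) =
     zeta^n - 1, of modulus at most 2, while |zeta - 1| = |z - w^j| >= d. *)
  have Sd : normc (S j) * d <= 2.
    apply: (@le_trans _ _ (normc (S j * (z * conjc (w ^+ j) - 1)))).
      rewrite normcM ler_wpM2l ?normc_ge0//.
      have -> : z * conjc (w ^+ j) - 1 = (z - w ^+ j) * conjc (w ^+ j).
        by rewrite mulrBl mulcJ1.
      by rewrite normcM normcJ w1j mulr1.
    rewrite mulrC -subrX1; apply: le_trans (normcBD _ _) _.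
    by rewrite normcX zw1 expr1n normc1.
  have S0 := normc_ge0 (S j).
  have Kd : K j <= 4 / (n%:R * d ^+ 2).
    rewrite /K invfM [4 * _]mulrCA ler_pM2l ?invr_gt0// ler_pdivlMr ?exprn_gt0// -exprMn.
    have -> : (4 : R) = 2 ^+ 2 by rewrite -natrX.
    by rewrite lerXn2r// ?nnegrE ?mulr_ge0// ltW.
  have u2 : `|u z - u (w ^+ j)| <= 2 * m.
    apply: le_trans (ler_normB _ _) _; have := um _ z1; have := um _ (w1j j); lra.
  apply: le_trans (ler_pM _ _ u2 Kd) _ => //.
  have nd0 : 0 < n%:R * d ^+ 2 by rewrite mulr_gt0// exprn_gt0.
  rewrite mulrA ler_pdivrMr//.
  move: nbig; rewrite ltr_pdivrMr ?mulr_gt0 ?exprn_gt0//.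
  have -> : n%:R * (e * d ^+ 2) = e * (n%:R * d ^+ 2) by rewrite mulrCA.
  set X := n%:R * d ^+ 2; lra.
apply: (@le_trans _ _ (\sum_(j < n) (n%:R^-1 * (e / 2 * K j) + n%:R^-1 * (e / 2)))).
  by apply: ler_sum => j _; exact: Kbound.
rewrite big_split/= -mulr_sumr -mulr_sumr KS sumr_const card_ord -mulr_natr.
by rewrite le_eqVlt; apply/orP; left; apply/eqP; field; rewrite gt_eqF.
Qed.

End Fejer.

(** * Real-valued norms on complex normed spaces *)

Section RealNorm.
Context {R : realType} {V : normedModType R[i]}.
Implicit Types (x y : V) (d : R).

(* The norm of V takes values in R[i]; nrm is the same number seen in R. *)
Definition nrm x : R := Re `|x|.

Lemma nrmE x : `|x| = (nrm x)%:C.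
Proof.
have := normr_ge0 x; rewrite /nrm; case: `|x| => a b.
by rewrite lecE /= => /andP[/eqP -> _].
Qed.
Lemma nrm_ge0 x : 0 <= nrm x.
Proof. by rewrite -ler0c -nrmE normr_ge0. Qed.
Lemma nrm0 : nrm 0 = 0. Proof. by rewrite /nrm normr0. Qed.
Lemma nrm_eq0 x : nrm x = 0 -> x = 0.
Proof. by move=> x0; apply/eqP; rewrite -normr_eq0 nrmE x0. Qed.
Lemma nrmD x y : nrm (x + y) <= nrm x + nrm y.
Proof. by rewrite -lecR rmorphD /= -!nrmE ler_normD. Qed.
Lemma nrmN x : nrm (- x) = nrm x. Proof. by rewrite /nrm normrN. Qed.
Lemma nrmB x y : nrm (x - y) = nrm (y - x). Proof. by rewrite -nrmN opprB. Qed.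
Lemma nrmZ (a : R[i]) x : nrm (a *: x) = normc a * nrm x.
Proof. by apply: complexI; rewrite rmorphM /= -!nrmE normrZ normcE. Qed.
Lemma nrm_triangle x y z : nrm (x - z) <= nrm (x - y) + nrm (y - z).
Proof. by apply: le_trans (nrmD _ _); rewrite addrA subrK. Qed.

(** Balls of V have radii in R[i]; a positive element of R[i] has zero imaginary part, so real radii
    generate the same neighbourhoods. *)
Lemma nbhs_nrmP x (P : set V) :
  nbhs x P <-> exists2 d : R, 0 < d & forall y, nrm (y - x) < d -> P y.
Proof.
split=> [/nbhs_ballP[e /= e0 eP]|[d d0 dP]].
  exists (Re e).
    by move: e0; rewrite ltcE => /andP[].
  move=> y xy; apply: eP; rewrite -ball_normE /= distrC nrmE ltcE /=.
  by move: e0; rewrite ltcE /= => /andP[/eqP -> _]; rewrite eqxx.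
apply/nbhs_ballP; exists d%:C; first by rewrite /= ltcR.
by move=> y; rewrite -ball_normE /= distrC nrmE ltcR; exact: dP.
Qed.

Lemma open_nrmP (U : set V) x : open U -> U x ->
  exists2 d : R, 0 < d & forall y, nrm (y - x) < d -> U y.
Proof. by move=> oU Ux; apply/nbhs_nrmP/open_nbhs_nbhs. Qed.

Lemma open_nrm (U : set V) :
  (forall x, U x -> exists2 d : R, 0 < d & forall y, nrm (y - x) < d -> U y) ->
  open U.
Proof. by move=> UP; rewrite openE => x Ux; apply/nbhs_nrmP/UP. Qed.

Lemma continuous_nrmP (u : V -> R) x :
  {for x, continuous u} <-> forall e : R, 0 < e -> exists2 d : R, 0 < d &
    forall y, nrm (y - x) < d -> `|u y - u x| < e.
Proof.
split=> [/cvgrPdist_lt ux e /ux /nbhs_nrmP[d d0 dP]|ux].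
  by exists d => // y /dP; rewrite distrC.
apply/cvgrPdist_lt => e /ux[d d0 dP]; apply/nbhs_nrmP; exists d => // y /dP.
by rewrite distrC.
Qed.

End RealNorm.

Lemma nrm_normc {R : realType} (z : R[i]^o) : nrm z = normc z.
Proof. by rewrite /nrm normcE. Qed.

Lemma continuous_cnrmP {R : realType} {V W : normedModType R[i]} (g : V -> W) x :
  {for x, continuous g} <-> forall e : R, 0 < e -> exists2 d : R, 0 < d &
    forall y, nrm (y - x) < d -> nrm (g y - g x) < e.
Proof.
split=> [gx e e0|gx P /nbhs_nrmP[e e0 eP]].
  have /gx/nbhs_nrmP[d d0 dP] : nbhs (g x) [set y | nrm (y - g x) < e].
    by apply/nbhs_nrmP; exists e.
  by exists d => // y /dP.
by apply/nbhs_nrmP; have [d d0 dP] := gx _ e0; exists d => // y /dP /eP.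
Qed.

(** * Upper semicontinuity at a point and maxima on compact sets *)

Section Semicontinuity.
Context {R : realType}.
Local Open Scope ereal_scope.

Definition usc_at {X : topologicalType} (v : X -> \bar R) (x : X) :=
  forall a : R, v x < a%:E -> \forall y \near x, v y < a%:E.

(** The superlevel sets of the values v y, y in K, are nested and generate a proper filter. At a
    cluster point x no value v y can exceed v x: otherwise v < v y near x, and that neighbourhood
    would miss the superlevel set of y. *)
Lemma usc_maximum {X : topologicalType} (K : set X) (v : X -> \bar R) :
  compact K -> K !=set0 -> (forall x, K x -> (v x < +oo)%E) ->
  (forall x, K x -> usc_at v x) ->
  exists2 x, K x & forall y, K y -> (v y <= v x)%E.
Proof.
move=> cK [k0 Kk0] voo vusc; pose B y := [set x | K x /\ (v y <= v x)%E].
have FF : ProperFilter (filter_from K B).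
  apply: filter_from_proper => [|y Ky]; last by exists y; split.
  apply: filter_from_filter; first by exists k0.
  move=> x y Kx Ky; have [xy|/ltW yx] := leP (v x) (v y).
    by exists y => // z [Kz yz]; do !split=> //; exact: le_trans xy yz.
  by exists x => // z [Kz xz]; do !split=> //; exact: le_trans yx xz.
have [|x [Kx clx]] := cK _ FF; first by exists k0 => // z [].
exists x => // y Ky; rewrite leNgt; apply/negP => xy.
have near_x : \forall z \near x, (v z < v y)%E.
  case vy : (v y) xy => [r||] xy; [exact: vusc|by have := voo _ Ky; rewrite vy|].
  by rewrite ltNge leNye in xy.
have [|z [[_ yz] zy]] := clx (B y) _ _ near_x; first by exists y.
by move: zy; rewrite /= ltNge yz.
Qed.

Lemma usc_add {X : topologicalType} (v : X -> \bar R) (g : X -> R) x :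
  usc_at v x -> {for x, continuous g} -> usc_at (fun y => v y + (g y)%:E) x.
Proof.
move=> vx gx a vga.
have [b [vb ba]] : exists b : R, v x < b%:E /\ (b < a - g x)%R.
  move: vga; case: (v x) => [r||]//= => [|_].
    rewrite -EFinD lte_fin => ra; exists ((r + (a - g x)) / 2)%R.
    by rewrite lte_fin; split; lra.
  by exists (a - g x - 1)%R; split; [exact: ltNyr|lra].
have e0 : (0 < a - g x - b)%R by lra.
near=> y.
have vy : v y < b%:E by near: y; exact: vx.
have gy : (`|g x - g y| < a - g x - b)%R.
  by near: y; move/cvgrPdist_lt : gx; exact.
have gyb : (g y < a - b)%R by move: gy; rewrite ltr_norml; lra.
have -> : a%:E = b%:E + (a - b)%:E by rewrite -EFinD addrC subrK.
by rewrite lte_leD// ?lee_fin ?ltW.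
Unshelve. all: by end_near. Qed.

Lemma usc_continuous {X : topologicalType} (g : X -> R) x :
  {for x, continuous g} -> usc_at (EFin \o g) x.
Proof.
move=> gx a /=; rewrite lte_fin => ga; near=> y; rewrite /= lte_fin.
have : (`|g x - g y| < a - g x)%R.
  by near: y; move/cvgrPdist_lt : gx; apply; rewrite subr_gt0.
by rewrite ltr_norml; lra.
Unshelve. all: by end_near. Qed.

Lemma usc_comp {X Y : topologicalType} (v : Y -> \bar R) (g : X -> Y) x :
  usc_at v (g x) -> {for x, continuous g} -> usc_at (v \o g) x.
Proof. by move=> vg gx a /vg /gx. Qed.

End Semicontinuity.

(** * Topology of closed discs *)

Section Discs.
Context {R : realType}.

Lemma continuous_normc (z : R[i]^o) : {for z, continuous (@Normc.normc R : R[i]^o -> R)}.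
Proof.
apply/continuous_nrmP => e e0; exists e => // y; rewrite nrm_normc => yz.
exact: le_lt_trans (normc_dist _ _) yz.
Qed.

Lemma continuous_complex_pair (f : R * R -> R[i]^o) :
  (forall p, f p = p.1 +i* p.2) -> continuous f.
Proof.
move=> fE [x y] P /nbhs_nrmP[d d0 dP].
have d20 : 0 < d / 2 by rewrite divr_gt0.
exists (ball x (d / 2), ball y (d / 2)) => /=; first by split; exact: nbhsx_ballx.
move=> [s t] /= [xs yt]; apply: dP; rewrite nrm_normc !fE.
apply: le_lt_trans (normc_le_ReIm _) _; rewrite cReB cImB /=.
move: xs yt; rewrite -ball_normE /= -!(distrC _ s) -!(distrC _ t); lra.
Qed.

Lemma compact_disc (r : R) : compact [set z : R[i]^o | normc z <= r].
Proof.
pose f (p : R * R) : R[i]^o := p.1 +i* p.2.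
apply: (@subclosed_compact _ _ (f @` (`[- r, r] `*` `[- r, r]))).
- rewrite -openC; apply: open_nrm => x /=; rewrite /setC /= => /negP.
  rewrite -ltNge => rx; exists (normc x - r); first by rewrite subr_gt0.
  move=> y; rewrite nrm_normc => yx; apply/negP; rewrite -ltNge.
  by have := normc_dist y x; rewrite ler_norml; lra.
- apply: continuous_compact; last by apply: compact_setX; exact: segment_compact.
  by apply: continuous_subspaceT; exact: continuous_complex_pair.
- move=> z /= zr; exists (Re z, Im z); last by case: z {zr}.
  have := normc_Re z; have := normc_Im z; rewrite !ler_norml => *.
  by split; rewrite /= in_itv /=; lra.
Qed.

Lemma disc_nonempty : [set z : R[i]^o | normc z <= 1] !=set0.
Proof. by exists (0 : R[i]); change (is_true (normc (0 : R[i]) <= 1)); rewrite normc0. Qed.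

Lemma continuous_RiP (u : R[i] -> R) (z : R[i]) :
  {for z, continuous (u : R[i]^o -> R)} <-> forall e : R, 0 < e ->
    exists2 d : R, 0 < d & forall y, normc (y - z) < d -> `|u y - u z| < e.
Proof.
split=> [/continuous_nrmP uz e /uz[d d0 dP]|uz].
  by exists d => // y yz; apply: dP; rewrite nrm_normc.
by apply/continuous_nrmP => e /uz[d d0 dP]; exists d => // y; rewrite nrm_normc; exact: dP.
Qed.

Lemma continuous_Re (z : R[i]^o) : {for z, continuous (@complex.Re R : R[i]^o -> R)}.
Proof.
apply/continuous_RiP => e e0; exists e => // y; apply: le_lt_trans.
by rewrite -cReB normc_Re.
Qed.

Lemma continuous_Re_poly (p : {poly R[i]}) (z : R[i]^o) :
  {for z, continuous (fun w : R[i]^o => Re p.[w])}.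
Proof.
suff pc : {for z, continuous (fun w : R[i]^o => p.[w] : R[i]^o)}.
  by apply: (continuous_comp pc); exact: continuous_Re.
elim/poly_ind: p => [|p c IH].
  rewrite (_ : (fun w : R[i]^o => _) = fun=> 0); first exact: cst_continuous.
  by apply/funext => w; rewrite horner0.
rewrite (_ : (fun w : R[i]^o => _) = fun w : R[i]^o => p.[w] * w + c : R[i]^o); last first.
  by apply/funext => w; rewrite hornerMXaddC.
apply: continuousD; last exact: cst_continuous.
by apply: (@continuousM R[i] R[i]^o) => //; exact: cvg_id.
Qed.

(** Heine's theorem, with the radius tending to 0+ as the filter in the near-covering form of
    compactness. Continuity of g is meant in the plane, so w may lie outside the disc. *)
Lemma uniform_continuity_disc (g : R[i]^o -> R) :
  (forall z, normc z <= 1 -> {for z, continuous g}) ->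
  forall e : R, 0 < e -> exists2 d : R, 0 < d & forall z w : R[i],
    normc z <= 1 -> normc (z - w) < d -> `|g z - g w| <= e.
Proof.
move=> gc e e0; have := @compact_disc 1; rewrite compact_near_coveringP => cK.
have e20 : 0 < e / 2 by rewrite divr_gt0.
have := cK R (0 : R)^'+ (fun d z => forall w : R[i], normc (z - w) < d ->
    `|g z - g w| <= e) _ _.
case=> [x /= x1|].
  have [d d0 dP] := (continuous_nrmP _ _).1 (gc _ x1) _ e20.
  exists ([set y : R[i]^o | normc (y - x) < d / 2], [set s | s < d / 2]) => /=.
    split; last by apply: nbhs_right_lt; rewrite divr_gt0.
    apply/nbhs_nrmP; exists (d / 2); first by rewrite divr_gt0.
    by move=> y; rewrite nrm_normc.
  case=> y s /= [yx sd] w yw.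
  have h1 : `|g y - g x| < e / 2 by apply: dP; rewrite nrm_normc; lra.
  have h2 : `|g w - g x| < e / 2.
    apply: dP; rewrite nrm_normc; have := normc_triangle w y x.
    rewrite (normcB w y); lra.
  by move: h1 h2; rewrite !ltr_norml ler_norml; lra.
move=> d0 /= dd0 dP.
exists (d0 / 2); first by rewrite divr_gt0.
move=> z w z1 zw; apply: (dP (d0 / 2)) => //=; last by rewrite divr_gt0.
by rewrite sub0r normrN gtr0_norm ?divr_gt0//; move: dd0 => /=; lra.
Qed.

End Discs.

(** * Touching by polynomials and comparison on the unit disc *)

Section Viscosity.
Context {R : realType}.
Implicit Types (v : R[i] -> \bar R) (g : R[i] -> R) (p : {poly R[i]}).

(* Viscosity form of subharmonicity: v cannot be touched from above at w by a
   quadratic polynomial of negative Laplacian. *)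
Definition visc_at v (w : R[i]) := forall (B C : R[i]) (e d : R),
  0 < e -> 0 < d -> v w \is a fin_num ->
  ~ (forall h : R[i], normc h < d ->
      (v (w + h)%R <= v w + (Re (B * h + C * h ^+ 2) - e * normc h ^+ 2)%:E)%E).

Lemma poly_taylor2 p (w : R[i]) : exists B C, exists2 K : R, 0 <= K &
  forall h : R[i], normc h <= 2^-1 ->
    normc (p.[w + h] - p.[w] - (B * h + C * h ^+ 2)) <= K * normc h ^+ 3.
Proof.
pose q := p \Po ('X + w%:P).
exists q`_1, q`_2, (2 * \sum_(i < size q) normc q`_i).
  by rewrite mulr_ge0// sumr_ge0// => i _; exact: normc_ge0.
move=> h h2.
have qE x : q.[x] = p.[w + x] by rewrite horner_comp hornerD hornerX hornerC addrC.
have := @poly_tail R q 3 (\sum_(i < size q) normc q`_i) h _ h2.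
rewrite qE big_ord_recl big_ord_recl big_ord1 /= expr0 mulr1 expr1.
have -> : q`_0 = p.[w] by rewrite -horner_coef0 qE addr0.
rewrite -[bump 0 0]/1%N -[bump 0 (bump 0 0)]/2%N opprD addrA; apply.
move=> k _; case: (ltnP k (size q)) => kq; last first.
  by rewrite nth_default// normc0 sumr_ge0// => i _; exact: normc_ge0.
by rewrite (bigD1 (Ordinal kq))//= lerDl sumr_ge0// => i _; exact: normc_ge0.
Qed.

(** If v exceeded Re p at z, then v - Re p + e |.|^2, with e half the excess, would attain its
    maximum over the disc at an interior point, being at most e on the circle. The second-order
    expansion of Re p - e |.|^2 there would touch v from above. *)
Lemma max_principle v p :
  (forall z : R[i]^o, normc z <= 1 -> usc_at (v : R[i]^o -> \bar R) z) ->
  (forall z, normc z <= 1 -> (v z < +oo)%E) ->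
  (forall z, normc z < 1 -> visc_at v z) ->
  (forall z, normc z = 1 -> (v z <= (Re p.[z])%:E)%E) ->
  forall z, normc z <= 1 -> (v z <= (Re p.[z])%:E)%E.
Proof.
move=> vusc vfin vvisc vp z z1; rewrite leNgt; apply/negP => pz.
have [r vz] : exists r, v z = r%:E.
  by move: (vfin z z1) pz; case: (v z) => // r _ _; exists r.
rewrite vz lte_fin in pz.
pose e := (r - Re p.[z]) / 2; have e0 : 0 < e by rewrite divr_gt0// subr_gt0.
pose g (z : R[i]^o) : R := e * normc z ^+ 2 - Re p.[z].
have gc x : {for x, continuous g}.
  apply: continuousB; last exact: continuous_Re_poly.
  apply: continuousM; first exact: cst_continuous.
  by apply: continuousM; exact: continuous_normc.
have [|z0 /= z01 z0max] := usc_maximum (@compact_disc R 1) (@disc_nonempty R)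
    (v := fun y : R[i]^o => (v y + (g y)%:E)%E) _ (fun x x1 => usc_add (vusc _ x1) (@gc x)).
  by move=> x x1; apply: lte_add_pinfty; [exact: vfin|exact: ltry].
have gz : e < r + g z.
  rewrite /g; have : 0 <= e * normc z ^+ 2 by rewrite mulr_ge0 ?exprn_ge0 ?normc_ge0// ltW.
  by move: e0; rewrite /e; lra.
have zz0 := z0max _ z1; rewrite vz -EFinD in zz0.
have [r0 vz0] : exists r0, v z0 = r0%:E.
  by move: (vfin z0 z01) zz0; case: (v z0) => // r0 _ _; exists r0.
rewrite vz0 -EFinD lee_fin in zz0.
have {}z01 : normc z0 < 1.
  rewrite lt_neqAle z01 andbT; apply/eqP => n1.
  have := vp _ n1; rewrite vz0 lee_fin => r0p.
  by move: zz0; rewrite {2}/g n1 expr1n; lra.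
have [B [C [K K0 T]]] := poly_taylor2 p z0.
(* The three bounds keep z0 + h in the disc, h in the range of the Taylor estimate, and the cubic
   remainder below (e/2) |h|^2, so that half of e survives. *)
pose d := Num.min (1 - normc z0) (Num.min 2^-1 (e / 2 / (K + 1))).
have K1 : 0 < K + 1 by lra.
have d0 : 0 < d.
  rewrite /d !lt_min subr_gt0 z01 invr_gt0 ltr0n /=.
  by apply: divr_gt0 => //; exact: divr_gt0.
(* The linear part of -e |z0 + h|^2 is -2 e Re(conj(z0) h), absorbed into B. *)
apply: (vvisc _ z01 (B - (2 * e)%:C * conjc z0) C (e / 2) d).
- exact: divr_gt0.
- exact: d0.
- by rewrite vz0.
move=> h; rewrite /d !lt_min => /and3P[hz h2 hK].
have zh1 : normc (z0 + h) <= 1 by have := normcD z0 h; lra.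
have := z0max _ zh1; rewrite vz0 -EFinD -leeBrDr// -EFinB => /le_trans; apply.
rewrite -EFinD lee_fin -addrA lerD2l.
have nh := normc_ge0 h.
have sq : normc (z0 + h) ^+ 2 = normc z0 ^+ 2 + 2 * Re (conjc z0 * h) + normc h ^+ 2.
  by rewrite !normc_sq cReD cImD cReM cReJ cImJ; ring.
have rem : - (e / 2 * normc h ^+ 2) <= Re (p.[z0 + h] - p.[z0] - (B * h + C * h ^+ 2)) <= e / 2 * normc h ^+ 2.
  rewrite -ler_norml; apply: le_trans (normc_Re _) _; apply: le_trans (T _ (ltW h2)) _.
  rewrite exprS mulrA ler_wpM2r ?exprn_ge0//.
  move: hK; rewrite ltr_pdivlMr// mulrDr mulr1 mulrC; lra.
rewrite /g sq cReD.
move: rem; rewrite !cReB cReD => /andP[_ rem].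
have -> : Re ((B - (2 * e)%:C * conjc z0) * h) = Re (B * h) - 2 * e * Re (conjc z0 * h).
  by rewrite mulrBl cReB -[_%:C * _ * h]mulrA cReZ.
lra.
Qed.

Lemma visc_continuous_poly g p :
  (forall z : R[i]^o, normc z <= 1 -> {for z, continuous (g : R[i]^o -> R)}) ->
  (forall z, normc z < 1 -> visc_at (fun w => (g w)%:E) z) ->
  (forall z, normc z = 1 -> g z <= Re p.[z]) ->
  forall z, normc z <= 1 -> g z <= Re p.[z].
Proof.
move=> gc gv gp z z1; rewrite -lee_fin.
apply: (@max_principle (fun w => (g w)%:E)) => //; last first.
- by move=> w _; rewrite ltry.
- by move=> w w1; apply: usc_continuous; exact: gc.
Qed.

Definition close_to g p (e : R) := forall h, normc h <= 1 -> `|g h - Re p.[h]| <= e.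

(** Stands for harmonicity in the open unit disc with continuous values up to the circle, without
    mention of derivatives. *)
Definition approximable g := forall e : R, 0 < e -> exists p, close_to g p e.

(** A polynomial that approximates g on the circle gives, after adding e, a barrier above g, and
    likewise one above -g; comparison carries the approximation into the disc. *)
Lemma visc_approximable g :
  (forall z : R[i]^o, normc z <= 1 -> {for z, continuous (g : R[i]^o -> R)}) ->
  (forall z, normc z < 1 -> visc_at (fun w => (g w)%:E) z) ->
  (forall z, normc z < 1 -> visc_at (fun w => (- g w)%:E) z) ->
  approximable g.
Proof.
move=> gc gv gv' e e0.
have gB : exists m, forall z, normc z = 1 -> `|g z| <= m.
  have [|||x x1 xm] := @usc_maximum R R[i]^o _ (fun z => `|g z|%:E) (@compact_disc R 1).
  - exact: disc_nonempty.
  - by move=> x _; rewrite ltry.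
  - move=> x x1; apply: (@usc_continuous _ _ (fun z : R[i]^o => `|g z|)).
    by apply: continuous_comp; [exact: gc|exact: norm_continuous].
  by exists `|g x| => z z1; rewrite -lee_fin; apply: xm; rewrite /= z1.
have [m gm] := gB.
have [|p pe] := @trig_approximation R g m gm _ e e0.
  move=> s s0; have [d d0 dP] := uniform_continuity_disc gc s0.
  by exists d => // z w z1 w1 zw; apply: dP => //; rewrite z1.
exists p => h h1; rewrite ler_norml; apply/andP; split.
  have := @visc_continuous_poly (fun z => - g z) (e%:C%:P - p) _ gv' _ h h1.
  rewrite hornerD hornerN hornerC cReB /= => H.
  have : - g h <= e - Re p.[h]; last by lra.
  apply: H => z z1; first by move: (gc z z1) => gz; exact: continuousN.
  by have := pe z z1; rewrite hornerD hornerN hornerC cReB /= ler_norml; lra.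
have := @visc_continuous_poly g (e%:C%:P + p) gc gv _ h h1.
rewrite hornerD hornerC cReD /= => H.
have : g h <= e + Re p.[h]; last by lra.
apply: H => z z1.
by have := pe z z1; rewrite hornerD hornerC cReD /= ler_norml; lra.
Qed.

End Viscosity.

(** * Power series coefficients and Taylor remainders of harmonic functions *)

Section Jets.
Context {R : realType}.
Implicit Types (g : R[i] -> R) (p q : {poly R[i]}).

Lemma close_coef g p q (e e' : R) k : close_to g p e -> close_to g q e' ->
  (0 < k)%N -> normc (p`_k - q`_k) <= 2 * (e + e').
Proof.
move=> pe qe k0; rewrite -coefB; apply: coef_bound_Re => // z z1.
have z1' : normc z <= 1 by rewrite z1.
have := pe z z1'; have := qe z z1'.
by rewrite hornerD hornerN cReB !ler_norml; lra.
Qed.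

(** The limit is the supremum of the lower bounds x n - c / (n + 1), each of which lies below every
    upper bound x m + c / (m + 1); the rate comes with the construction. *)
Lemma limit_of_cauchy (x : nat -> R) (c : R) :
  (forall n m, `|x n - x m| <= c / n.+1%:R + c / m.+1%:R) ->
  exists l, forall n, `|x n - l| <= c / n.+1%:R.
Proof.
move=> xc; pose A := range (fun n => x n - c / n.+1%:R).
have ubA n : ubound A (x n + c / n.+1%:R).
  by move=> _ [m _ <-] /=; have := xc n m; move: (c / _) (c / _) => u w; rewrite ler_norml; lra.
have hA : has_sup A.
  by split; [exists (x 0%N - c / 1%:R), 0%N|exists (x 0%N + c / 1%:R); exact: ubA].
exists (sup A) => n; rewrite ler_norml; apply/andP; split.
  have := ge_sup hA.1 (ubA n); move: (c / _) => u; lra.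
have := sup_upper_bound hA (imageT (fun n => x n - c / n.+1%:R) n) => /=; move: (c / _) => u; lra.
Qed.

Lemma invn_small (e : R) : 0 < e -> exists n : nat, n.+1%:R^-1 < e.
Proof.
move=> e0; exists (Num.truncn e^-1); rewrite invf_plt ?posrE ?ltr0n//.
exact: truncnS_gt.
Qed.

Lemma harm_coef_exists g k : approximable g -> (0 < k)%N ->
  exists a : R[i], forall p e, close_to g p e -> normc (p`_k - a) <= 2 * e.
Proof.
move=> ga k0.
have n0 n : 0 < (n.+1%:R : R)^-1 by rewrite invr_gt0.
have /choice[P PP] (n : nat) : exists p, close_to g p n.+1%:R^-1 by exact: ga.
have PC n m : normc ((P n)`_k - (P m)`_k) <= 2 / n.+1%:R + 2 / m.+1%:R.
  by rewrite -mulrDr; exact: close_coef.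
have [|a aP] := @limit_of_cauchy (fun n => Re (P n)`_k) 2.
  by move=> n m; rewrite -cReB; exact: le_trans (normc_Re _) (PC n m).
have [|b bP] := @limit_of_cauchy (fun n => Im (P n)`_k) 2.
  by move=> n m; rewrite -cImB; exact: le_trans (normc_Im _) (PC n m).
exists (a +i* b) => p e pe; apply/ler_addgt0Pr => s s0.
(* Writing u for 1 / (n + 1), comparing the two polynomials costs 2u beyond 2e, and passing to the
   limit in both coordinates costs 4u. *)
have [n ns] := invn_small (divr_gt0 s0 (ltr0n R 6)).
have h1 := close_coef pe (PP n) k0.
have h2 : normc ((P n)`_k - (a +i* b)) <= 4 / n.+1%:R.
  apply: le_trans (normc_le_ReIm _) _; rewrite cReB cImB /=.
  have := aP n; have := bP n; move: (n.+1%:R^-1) => u; lra.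
have := normc_triangle p`_k (P n)`_k (a +i* b).
move: (n.+1%:R^-1) ns h1 h2 => u; lra.
Qed.

(* The k-th coefficient, for k > 0, of the power series whose real part is g
   on the unit disc. *)
Definition harm_coef g k : R[i] :=
  xget 0 [set a | forall p e, close_to g p e -> normc (p`_k - a) <= 2 * e].

Lemma harm_coefP g k p (e : R) : approximable g -> (0 < k)%N ->
  close_to g p e -> normc (p`_k - harm_coef g k) <= 2 * e.
Proof.
move=> ga k0; have [a aP] := harm_coef_exists ga k0.
by have := @xgetPex _ (0 : R[i]) [set a | forall p e, close_to g p e ->
  normc (p`_k - a) <= 2 * e] (ex_intro _ a aP) p e.
Qed.

Lemma harm_coef_bound g (m : R) k : approximable g -> (0 < k)%N ->
  (forall h, normc h <= 1 -> `|g h| <= m) -> normc (harm_coef g k) <= 2 * m.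
Proof.
move=> ga k0 gm; apply/ler_addgt0Pr => s s0.
have [p pe] := ga _ (divr_gt0 s0 (ltr0n R 4)).
have h1 := harm_coefP ga k0 pe; rewrite normcB in h1.
have h2 : normc p`_k <= 2 * (m + s / 4).
  apply: coef_bound_Re => // z z1.
  have z1' : normc z <= 1 by rewrite z1.
  have := gm z z1'; have := pe z z1'; rewrite !ler_norml; lra.
have := normcD (harm_coef g k - p`_k) p`_k; rewrite subrK; lra.
Qed.

(** Taylor formula at the centre with a remainder that depends on g only through its supremum. It is
    the tail estimate for an approximating polynomial, whose coefficients lie near those of g and
    are bounded by 2 (m + e). *)
Lemma harm_jet g (m : R) L h : approximable g -> (0 < L)%N ->
  (forall h, normc h <= 1 -> `|g h| <= m) -> normc h <= 2^-1 ->
  `|g h - g 0 - Re (\sum_(1 <= k < L) harm_coef g k * h ^+ k)|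
    <= 4 * m * normc h ^+ L.
Proof.
move=> ga L0 gm h2; apply/ler_addgt0Pr => s s0.
have L0' : 0 < (6 + 2 * L%:R : R) by rewrite ltr_wpDr// mulr_ge0.
(* Replacing g by Re p at h and at 0 costs 2e, the tail of p costs at most 4e beyond the stated
   bound, and the coefficients cost 2 L e. *)
set e := s / (6 + 2 * L%:R); have e0 : 0 < e by rewrite divr_gt0.
have [p pe] := ga _ e0.
have nh := normc_ge0 h.
have h1 : normc h <= 1 by lra.
have h0 : normc (0 : R[i]) <= 1 by rewrite normc0.
have T : normc (p.[h] - \sum_(k < L) p`_k * h ^+ k) <= 2 * (2 * (m + e)) * normc h ^+ L.
  apply: poly_tail => // k Lk; apply: coef_bound_Re; first by lia.
  move=> z z1; have z1' : normc z <= 1 by rewrite z1.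
  have := gm z z1'; have := pe z z1'; rewrite !ler_norml; lra.
have hL : normc h ^+ L <= 1 by rewrite exprn_ile1.
have hL0 : 0 <= normc h ^+ L by rewrite exprn_ge0.
have sumE : \sum_(k < L) p`_k * h ^+ k =
    p.[0] + \sum_(1 <= k < L) p`_k * h ^+ k.
  by rewrite -(big_mkord xpredT (fun k => p`_k * h ^+ k)) big_ltn// expr0 mulr1 -horner_coef0.
have D : normc (\sum_(1 <= k < L) p`_k * h ^+ k - \sum_(1 <= k < L) harm_coef g k * h ^+ k)
    <= L%:R * (2 * e).
  rewrite -sumrB; apply: le_trans (normc_sum _ _ _) _.
  apply: (@le_trans _ _ (\sum_(1 <= k < L) (2 * e))); last first.
    rewrite sumr_const_nat -[_ *+ (L - 1)]mulr_natl ler_wpM2r//; first by rewrite mulr_ge0// ltW.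
    by rewrite ler_nat leq_subr.
  rewrite !big_nat; apply: ler_sum => k /andP[k0 _].
  rewrite -mulrBl normcM normcX -[leRHS]mulr1.
  by apply: ler_pM; rewrite ?normc_ge0 ?exprn_ge0 ?exprn_ile1 ?harm_coefP.
rewrite sumE opprD addrA in T.
have T' := le_trans (normc_Re _) T; have D' := le_trans (normc_Re _) D.
have E1 := pe h h1; have E0 := pe 0 h0.
have eh : e * normc h ^+ L <= e by rewrite ler_piMr// ltW.
have se : e * (6 + 2 * L%:R) = s by rewrite /e divfK// gt_eqF.
rewrite !cReB in T' D'.
have es : L%:R * (2 * e) + 6 * e = s by rewrite -se; ring.
have T2 : 2 * (2 * (m + e)) * normc h ^+ L = 4 * m * normc h ^+ L + 4 * (e * normc h ^+ L).
  by ring.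
rewrite T2 in T'.
move: T' D' E1 E0; rewrite !ler_norml.
move: es eh; clear -e0; move: (4 * m * _) (e * _) (L%:R * _) => X Y Z.
lra.
Qed.

Lemma harm_jet2 g (m : R) h : approximable g ->
  (forall h, normc h <= 1 -> `|g h| <= m) -> normc h <= 2^-1 ->
  `|g h - g 0 - Re (harm_coef g 1 * h)| <= 4 * m * normc h ^+ 2.
Proof.
move=> ga gm h2; have := @harm_jet g m 2 h ga isT gm h2.
by rewrite big_nat1 expr1.
Qed.

Lemma harm_jet3 g (m : R) h : approximable g ->
  (forall h, normc h <= 1 -> `|g h| <= m) -> normc h <= 2^-1 ->
  `|g h - g 0 - Re (harm_coef g 1 * h + harm_coef g 2 * h ^+ 2)|
    <= 4 * m * normc h ^+ 3.
Proof.
move=> ga gm h2; have := @harm_jet g m 3 h ga isT gm h2.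
by rewrite big_nat_recr//= big_nat1 expr1.
Qed.

Lemma approximable_limit g :
  (forall e : R, 0 < e -> exists2 g', approximable g' &
    forall h, normc h <= 1 -> `|g h - g' h| <= e) -> approximable g.
Proof.
move=> H e e0; have e20 : 0 < e / 2 by rewrite divr_gt0.
have [g' /(_ _ e20)[p pe] gg'] := H _ e20.
exists p => h h1; have := gg' h h1; have := pe h h1; rewrite !ler_norml; lra.
Qed.

Lemma approximable_lin g g' (a b : R) : approximable g -> approximable g' ->
  approximable (fun h => a * g h + b * g' h).
Proof.
move=> ga g'a e e0.
have c0 : 0 < `|a| + `|b| + 1 by rewrite ltr_wpDl ?addr_ge0.
have t0 := divr_gt0 e0 c0; have [p pe] := ga _ t0; have [q qe] := g'a _ t0.
exists (a%:C *: p + b%:C *: q) => h h1.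
rewrite hornerD !hornerZ cReD !cReZ.
have -> : a * g h + b * g' h - (a * Re p.[h] + b * Re q.[h]) =
  a * (g h - Re p.[h]) + b * (g' h - Re q.[h]) by ring.
apply: le_trans (ler_normD _ _) _; rewrite !normrM.
apply: le_trans (lerD (ler_wpM2l (normr_ge0 a) (pe h h1)) (ler_wpM2l (normr_ge0 b) (qe h h1))) _.
have ts : e / (`|a| + `|b| + 1) * (`|a| + `|b| + 1) = e by rewrite divfK// gt_eqF.
move: (e / _) ts t0 => t; lra.
Qed.

Lemma approximable_poly p : approximable (fun h => Re p.[h]).
Proof. by move=> e e0; exists p => h _; rewrite subrr normr0 ltW. Qed.

Lemma approximable_ext g g' : (forall h, normc h <= 1 -> g h = g' h) ->
  approximable g -> approximable g'.
Proof. by move=> E ga e /ga[p pe]; exists p => h h1; rewrite -E//; exact: pe. Qed.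

End Jets.

(** * Equivalence of the submean inequality with the touching condition *)

Section CircleMeans.
Context {R : realType}.
Implicit Types (p : {poly R[i]}) (f : R -> R) (u v : R[i] -> \bar R).

Local Notation mu := (@lebesgue_measure R).
Local Notation I := (`[0%R, (2 * pi)%R]%classic : set R).

Lemma two_pi_gt0 : 0 < 2 * pi :> R.
Proof. by rewrite mulr_gt0// pi_gt0. Qed.

Lemma continuous_cis : continuous (cis : R -> R[i]^o).
Proof.
have -> : cis = (fun p : R * R => p.1 +i* p.2 : R[i]^o) \o (fun t => (cos t, sin t)).
  by apply/funext.
move=> t; apply: continuous_comp; last exact: continuous_complex_pair.
exact: (cvg_pair (@continuous_cos R t) (@continuous_sin R t)).
Qed.

Lemma circle_integrable f : continuous f -> mu.-integrable I (EFin \o f).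
Proof.
move=> cf; apply: continuous_compact_integrable; first exact: segment_compact.
exact: continuous_subspaceT.
Qed.

Lemma measure_circle : mu I = (2 * pi)%:E.
Proof. by rewrite lebesgue_measure_itv/= lte_fin two_pi_gt0 oppr0 adde0. Qed.

Lemma is_derive_linear (k t : R) : is_derive t 1 (fun s : R => k * s) k.
Proof.
have := is_deriveZ k (is_derive_id t (1 : R)).
by rewrite /GRing.scale /= mulr1.
Qed.

(** The primitive is assembled from monomials. Those of positive degree have 2 pi-periodic
    primitives, so only the constant coefficient contributes to the increment. *)
Lemma poly_primitive p : exists F : R -> R,
  (forall t : R, is_derive t 1 F (Re p.[cis t])) /\ F (2 * pi) - F 0 = 2 * pi * Re p`_0.
Proof.
pose Q (q : {poly R[i]}) := exists F : R -> R,
  (forall t : R, is_derive t 1 F (Re q.[cis t])) /\ F (2 * pi) - F 0 = 2 * pi * Re q`_0.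
suff : Q (\poly_(i < size p) p`_i) by rewrite coefK.
suff mono : forall (a : R[i]) i, Q (a *: 'X^i).
  rewrite poly_def; elim/big_rec : _ => [|i x _ [F [dF F0]]].
    exists (cst 0); split; last by rewrite coef0 /= subrr mulr0.
    by move=> t; rewrite horner0 /=; exact: is_derive_cst.
  have [G [dG G0]] := mono p`_i i.
  exists (G \+ F); split=> [t|/=]; first by rewrite hornerD cReD; exact: is_deriveD.
  by rewrite coefD cReD; move: F0 G0; set X := Re _; set Y := Re _; lra.
move=> a [|i].
  exists ( *%R (Re a)); split=> [t|]; last first.
    by rewrite expr0 alg_polyC coefC /= mulr0 subr0 mulrC.
  rewrite expr0 alg_polyC hornerC.
  exact: is_derive_linear.
pose k : R := i.+1%:R; have k0 : k != 0 by rewrite pnatr_eq0.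
exists (fun t => Re a / k * sin (k * t) + Im a / k * cos (k * t)); split=> [t|].
  rewrite hornerZ hornerXn cisX -/k cReM /=.
  have dk := is_derive_linear k t.
  have ds : is_derive t 1 (sin \o (fun t : R => k * t)) (k * cos (k * t)).
    have := @is_derive1_comp _ sin (fun t : R => k * t) t _ _ (is_derive_sin _) dk.
    by rewrite mulrC.
  have dc : is_derive t 1 (cos \o (fun t : R => k * t)) (k * - sin (k * t)).
    have := @is_derive1_comp _ cos (fun t : R => k * t) t _ _ (is_derive_cos _) dk.
    by rewrite mulrC.
  have := is_deriveD (is_deriveZ (Re a / k) ds) (is_deriveZ (Im a / k) dc).
  rewrite /GRing.scale /= !mulrA !divfK// mulrN.
  by apply.
rewrite mulr0 sin0 cos0 coefZ coefXn /= mulr0.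
have := cisX (2 * pi : R) i.+1; rewrite cis2pi expr1n -/k => /esym E.
have := congr1 (@complex.Re R) E; have := congr1 (@complex.Im R) E; rewrite /= => -> ->.
by rewrite [a * 0]mulr0 /=; ring.
Qed.

Lemma continuous_Re_poly_cis p : continuous (fun t : R => Re p.[cis t]).
Proof.
move=> t; apply: (@continuous_comp _ _ _ (cis : R -> R[i]^o) (fun z : R[i]^o => Re p.[z])).
  exact: continuous_cis.
exact: continuous_Re_poly.
Qed.

Lemma circle_mean_poly p :
  (\int[mu]_(t in I) (Re p.[cis t])%:E)%E = (2 * pi * Re p.[0])%:E.
Proof.
have [F [dF F0]] := poly_primitive p.
have cF : continuous F.
  by move=> t; apply: differentiable_continuous; apply/derivable1_diffP; case: (dF t).
rewrite (@continuous_FTC2 R _ F _ _ two_pi_gt0).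
- by rewrite -EFinB F0 horner_coef0.
- by apply: continuous_subspaceT; exact: continuous_Re_poly_cis.
- split=> [t _||]; first by case: (dF t).
  + by apply: cvg_at_right_filter; exact: cF.
  + by apply: cvg_at_left_filter; exact: cF.
- by move=> t _; rewrite derive1E; exact: derive_val.
Qed.

Lemma usc_measurable (f : R -> \bar R) : (forall t, usc_at f t) -> measurable_fun setT f.
Proof.
move=> fusc.
have -> : f = (fun t => - (- f t))%E by apply/funext => t; rewrite oppeK.
apply: measurableT_comp => //; apply: measurable_realfun.lower_semicontinuous_measurable.
move=> t a; rewrite lteNr -EFinN => ft.
by exists [set s | (f s < (- a)%:E)%E]; [exact: fusc|move=> s /=; rewrite EFinN lteNr].
Qed.

(** f may take the value -oo and have a negative part of infinite integral, so positive and negative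
    parts are compared separately. *)
Lemma le_integral_real (f : R -> \bar R) (g : R -> R) :
  measurable_fun setT f -> continuous g -> (forall t, I t -> (f t <= (g t)%:E)%E) ->
  (\int[mu]_(t in I) f t <= \int[mu]_(t in I) (g t)%:E)%E.
Proof.
move=> mf cg fg.
have mg : measurable_fun setT (EFin \o g).
  by apply/measurable_EFinP; exact: continuous_measurable_fun.
have mI : measurable I by exact: measurable_itv.
rewrite integralE [leRHS]integralE; apply: leeB.
- apply: ge0_le_integral => //.
  + by apply: measurable_funTS; exact: measurable_funepos.
  + by apply: measurable_funTS; exact: measurable_funepos.
  + by move=> t It; rewrite !funeposE le_max2// fg.
- apply: ge0_le_integral => //.
  + by apply: measurable_funTS; exact: measurable_funeneg.
  + by apply: measurable_funTS; exact: measurable_funeneg.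
  + by move=> t It; rewrite !funenegE le_max2// leeN2 fg.
Qed.

(** On the circle of radius r the touching function is Re p for a polynomial p, the term e |h|^2
    being the constant e r^2. Its mean is u w - e r^2, in conflict with the submean inequality. *)
Lemma subharmonic_visc (U : set R[i]^o) u (w : R[i]) :
  open U -> subharmonic_on U u -> U w -> visc_at u w.
Proof.
move=> oU [ufin uusc usub] Uw B C e d e0 d0; rewrite fin_numE => /andP[uw1 uw2] H.
have [s us] : exists s, u w = s%:E by case: (u w) uw1 uw2 => // s _ _; exists s.
have [d' d'0 d'U] := open_nrmP oU Uw.
pose r := (Num.min d d' / 2)%R.
have m0 : (0 < Num.min d d')%R by rewrite lt_min d0.
have r0 : (0 < r)%R by rewrite divr_gt0.
have rd : (r < d)%R.
  by rewrite /r; apply: (@lt_le_trans _ _ (Num.min d d')); [lra|rewrite ge_min lexx].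
have rd' : (r < d')%R.
  by rewrite /r; apply: (@lt_le_trans _ _ (Num.min d d')); [lra|rewrite ge_min lexx orbT].
have UD (z : R[i]) : (normc (z - w) <= r)%R -> U z.
  by move=> zr; apply: d'U; rewrite nrm_normc; exact: le_lt_trans zr rd'.
have : (u w <= circle_mean u w r)%E.
  by apply: usub => // z; rewrite normcE lecR => zr; exact: UD.
apply/negP; rewrite -ltNge us.
pose p : {poly R[i]} := ((s - e * r ^+ 2)%:C)%:P + (B * r%:C) *: 'X + (C * r%:C ^+ 2) *: 'X^2.
have circ t : circle_point w r t = w + r%:C * cis t by [].
have nr t : normc (r%:C * cis t) = r.
  by rewrite normcM normcR normc_cis mulr1 gtr0_norm.
have le1 : (\int[mu]_(t in I) u (circle_point w r t) <=
    \int[mu]_(t in I) (Re p.[cis t])%:E)%E.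
  apply: le_integral_real.
  - apply: usc_measurable => t a /=; rewrite circ => ua.
    have Uc : U (w + r%:C * cis t).
      by apply: UD; rewrite addrAC subrr add0r nr.
    have cc : {for t, continuous (fun t => w + r%:C * cis t : R[i]^o)}.
      apply: continuousD; first exact: cst_continuous.
      by apply: continuousM; [exact: cst_continuous|exact: continuous_cis].
    exact: (cc _ (uusc _ Uc _ ua)).
  - exact: continuous_Re_poly_cis.
  - move=> t _; rewrite circ; have := H (r%:C * cis t); rewrite nr => /(_ rd).
    move=> /le_trans; apply; rewrite us -EFinD lee_fin.
    rewrite !(hornerD, hornerZ, hornerC, hornerX, hornerXn) !cReD /= exprMn.
    by rewrite !mulrA lerD2r || (rewrite !mulrA; lra).
rewrite /circle_mean; apply: (@le_lt_trans _ _
    (((2 * pi)^-1)%:E * \int[mu]_(t in I) (Re p.[cis t])%:E)%E).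
  by apply: lee_wpmul2l => //; rewrite lee_fin invr_ge0 ltW// two_pi_gt0.
rewrite circle_mean_poly -EFinM mulKf ?gt_eqF ?two_pi_gt0// lte_fin.
rewrite !(hornerD, hornerZ, hornerC, hornerX, hornerXn) expr0n/= !mulr0 !addr0 /=.
by rewrite gtrBl mulr_gt0// exprn_gt0.
Qed.

Lemma usc_bounded_above v : (forall z : R[i]^o, normc z <= 1 -> usc_at (v : R[i]^o -> \bar R) z) ->
  (forall z, normc z <= 1 -> (v z < +oo)%E) ->
  exists b : R, forall z, normc z <= 1 -> (v z <= b%:E)%E.
Proof.
move=> vusc vfin.
have [x x1 xmax] := usc_maximum (@compact_disc R 1) (@disc_nonempty R)
  (v := (v : R[i]^o -> \bar R)) vfin vusc.
case vx : (v x) => [s||].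
- by exists s => z z1; rewrite -vx; exact: xmax.
- by have := vfin _ x1; rewrite vx.
- by exists 0 => z z1; apply: le_trans (xmax _ z1) _; rewrite vx leNye.
Qed.

(* The data on the circle is approximated from above by its Lipschitz
   sup-convolutions U n, and these in turn by real parts of polynomials. *)
Lemma visc_submean_unit v :
  (forall z : R[i]^o, normc z <= 1 -> usc_at (v : R[i]^o -> \bar R) z) ->
  (forall z, normc z <= 1 -> (v z < +oo)%E) ->
  (forall z, normc z < 1 -> visc_at v z) ->
  (v 0%R <= ((2 * pi)^-1)%:E * \int[mu]_(t in I) v (cis t))%E.
Proof.
move=> vusc vfin vvisc.
have [b0 vb0] := usc_bounded_above vusc vfin.
pose b := `|b0|; have b_ge0 : 0 <= b by exact: normr_ge0.
have vb z : normc z <= 1 -> (v z <= b%:E)%E.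
  by move=> z1; apply: le_trans (vb0 _ z1) _; rewrite lee_fin ler_norm.
have v01 : normc (0 : R[i]) <= 1 by rewrite normc0.
have [->|v0] := eqVneq (v 0) -oo%E; first by rewrite leNye.
have [s vs] : exists s, v 0 = s%:E.
  by move: (vfin _ v01) v0; case: (v 0) => // s _ _; exists s.
(* Truncation at -n makes the data real; [fine] loses nothing on the disc, where v < +oo. *)
pose w n z := fine (maxe (v z) (- n%:R)%:E).
have wE n z : normc z <= 1 -> (w n z)%:E = maxe (v z) (- n%:R)%:E.
  move=> z1; rewrite /w fineK// fin_numE; apply/andP; split.
    by rewrite gt_eqF// lt_max ltNyr orbT.
  by rewrite lt_eqF// gt_max vfin//= ltry.
have wb n z : normc z <= 1 -> w n z <= b.
  by move=> z1; rewrite -lee_fin wE// ge_max vb//= lee_fin (le_trans _ b_ge0)// oppr_le0.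
have vw n z : normc z <= 1 -> (v z <= (w n z)%:E)%E.
  by move=> z1; rewrite wE// le_max lexx.
have wS n z : normc z <= 1 -> w n.+1 z <= w n z.
  by move=> z1; rewrite -lee_fin !wE// le_max2// lee_fin lerN2 ler_nat.
pose D := [set z : R[i] | normc z <= 1].
(* The supremum of this set is the sup-convolution: n-Lipschitz in z, above w n on the disc, and
   decreasing in n because both the truncation and the penalty tighten. *)
pose S n z := [set w n y - n%:R * normc (z - y) | y in D].
have S_ub n z : ubound (S n z) b.
  move=> _ [y y1 <-]; have := wb n y y1.
  have : 0 <= n%:R * normc (z - y) by rewrite mulr_ge0// normc_ge0.
  lra.
have Ssup n z : has_sup (S n z).
  by split; [exists (w n 0 - n%:R * normc (z - 0)), 0|exists b].
pose U n z := sup (S n z).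
have U_ge n z y : normc y <= 1 -> w n y - n%:R * normc (z - y) <= U n z.
  by move=> y1; apply: (sup_upper_bound (Ssup n z)); exists y.
have U_le n z a : (forall y, normc y <= 1 -> w n y - n%:R * normc (z - y) <= a) -> U n z <= a.
  by move=> H; apply: ge_sup; [exact: (Ssup n z).1|move=> _ [y y1 <-]; exact: H].
have Ub n z : U n z <= b by apply: U_le => y y1; apply: S_ub; exists y.
have wU n z : normc z <= 1 -> w n z <= U n z.
  by move=> z1; have := U_ge n z z z1; rewrite subrr normc0 mulr0 subr0.
have ULip n z z' : U n z <= U n z' + n%:R * normc (z - z').
  apply: U_le => y y1; have := U_ge n z' y y1.
  have : n%:R * normc (z' - y) <= n%:R * normc (z - z') + n%:R * normc (z - y).
    rewrite -mulrDr ler_wpM2l//; have := normc_triangle z' z y.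
    by rewrite (normcB z' z).
  lra.
have ULip' n z z' : `|U n z - U n z'| <= n%:R * normc (z - z').
  have := ULip n z z'; have := ULip n z' z; rewrite (normcB z' z) ler_norml; lra.
have US n z : U n.+1 z <= U n z.
  apply: U_le => y y1; apply: le_trans (U_ge n z y y1).
  have := wS n y y1; have := normc_ge0 (z - y); rewrite -natr1; nra.
(* Within distance d of z, semicontinuity bounds v by a and n >= |a| puts the truncation level -n
   below a; farther away the penalty is at least n d >= b + |a|. *)
have Ulim z a : normc z <= 1 -> (v z < a%:E)%E -> exists n, U n z <= a.
  move=> z1 /(vusc _ z1)/nbhs_nrmP[d d0 dP].
  have X0 : 0 <= (b + `|a|) / d by rewrite divr_ge0 ?addr_ge0// ltW.
  pose n := (Num.truncn ((b + `|a|) / d + `|a|)).+1.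
  have nX : (b + `|a|) / d + `|a| < n%:R by exact: truncnS_gt.
  have n1 : (b + `|a|) / d <= n%:R by apply: le_trans (ltW nX); rewrite lerDl.
  have n2 : `|a| <= n%:R by apply: le_trans (ltW nX); rewrite lerDr.
  clear nX X0.
  exists n; apply: U_le => y y1.
  have ny := normc_ge0 (z - y); have n0 : 0 <= n%:R :> R by [].
  have na : - `|a| <= a by rewrite lerNl -normrN ler_norm.
  have [yz|yz] := ltP (normc (z - y)) d.
    have : w n y <= a.
      rewrite -lee_fin wE// ge_max; apply/andP; split.
        by apply/ltW/dP; rewrite nrm_normc normcB.
      by rewrite lee_fin; lra.
    have : 0 <= n%:R * normc (z - y) by rewrite mulr_ge0.
    lra.
  have : n%:R * d <= n%:R * normc (z - y) by rewrite ler_wpM2l.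
  rewrite ler_pdivrMr// in n1; have := wb n y y1; lra.
have cU n : continuous (fun t : R => b - U n (cis t)).
  move=> t; apply: cvgB; first exact: cvg_cst.
  apply: (@continuous_comp _ _ _ (cis : R -> R[i]^o) (U n : R[i]^o -> R)).
    exact: continuous_cis.
  apply/continuous_RiP => e e0; exists (e / n.+1%:R); first by rewrite divr_gt0.
  move=> y; rewrite ltr_pdivlMr// => ye; apply: le_lt_trans (ULip' _ _ _) _.
  apply: le_lt_trans ye; rewrite mulrC ler_wpM2l ?normc_ge0// ler_nat; lia.
pose G n t : \bar R := (b - U n (cis t))%:E.
have mI : measurable I by exact: measurable_itv.
have cisle t : normc (cis t : R[i]) <= 1 by rewrite normc_cis.
have mG n : measurable_fun setT (G n).
  by apply/measurable_EFinP; apply: continuous_measurable_fun; exact: cU.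
have G0 n t : (0 <= G n t)%E by rewrite lee_fin subr_ge0.
have GS t : {homo G^~ t : n m / (n <= m)%N >-> (n <= m)%E}.
  by apply/nondecreasing_seqP => n; rewrite lee_fin lerB.
have intG n : (\int[mu]_(t in I) G n t <= (2 * pi * (b - s))%:E)%E.
  apply/lee_addgt0Pr => e e0.
  (* This error is paid twice with weight 2 pi: once when v at 0 is compared with Re p, and once
     when U n is replaced by Re p on the circle. *)
  have e1 : 0 < e / (4 * pi) by rewrite divr_gt0// mulr_gt0// pi_gt0.
  have [||p pe] := @trig_approximation R (U n) (b + n%:R) _ _ _ e1.
  - move=> z z1; have z1' : normc z <= 1 by rewrite z1.
    have : - n%:R <= w n z by rewrite -lee_fin wE// le_max lexx orbT.
    have := wU n z z1'; have := Ub n z; have : 0 <= n%:R :> R by [].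
    rewrite ler_norml; move: n%:R => N; lra.
  - move=> e2 e20; exists (e2 / n.+1%:R); first by rewrite divr_gt0.
    move=> z y _ _; rewrite ltr_pdivlMr// => ye; apply: le_trans (ULip' _ _ _) _.
    apply: le_trans (ltW ye); rewrite mulrC ler_wpM2l ?normc_ge0// ler_nat; lia.
  set e' := e / (4 * pi) in e1 pe.
  have s_le : s <= e' + Re p.[0].
    have := @max_principle R v (e'%:C%:P + p) vusc vfin vvisc _ 0 v01.
    rewrite vs lee_fin hornerD hornerC cReD /=; apply => z z1.
    rewrite hornerD hornerC cReD /=.
    have z1' : normc z <= 1 by rewrite z1.
    apply: le_trans (vw n z z1') _; rewrite lee_fin.
    by have := wU n z z1'; have := pe z z1; rewrite ler_norml; lra.
  apply: (@le_trans _ _ (\int[mu]_(t in I) (Re ((b + e')%:C%:P - p).[cis t])%:E)%E).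
    apply: le_integral_real => //; first exact: continuous_Re_poly_cis.
    move=> t _; rewrite lee_fin hornerD hornerN hornerC cReB /=.
    by have := pe (cis t) (normc_cis t); rewrite ler_norml; lra.
  rewrite circle_mean_poly -EFinD lee_fin hornerD hornerN hornerC cReB /=.
  have e'e : 4 * pi * e' = e by rewrite /e' mulrC divfK// gt_eqF// mulr_gt0// pi_gt0.
  rewrite -e'e; have := pi_gt0 R; move: s_le; nra.
have mv : measurable_fun setT (fun t => v (cis t)).
  apply: usc_measurable => t.
  apply: (@usc_comp R _ _ (v : R[i]^o -> \bar R) (cis : R -> R[i]^o)).
    exact: vusc.
  exact: continuous_cis.
(* Subtracting from the upper bound b makes everything nonnegative: the functions G n increase to a
   limit above F, and monotone convergence applies. The resulting finite bound also makes F
   integrable, hence the subtraction of integrals legitimate. *)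
pose F t := (b%:E - v (cis t))%E.
have mF : measurable_fun setT F.
  by apply: emeasurable_funB => //; exact: measurable_cst.
have F0 t : (0 <= F t)%E.
  have := vb _ (cisle t); rewrite /F; case: (v _) => [r||]//=; last by rewrite leey.
  by rewrite -EFinB !lee_fin subr_ge0.
have FG t : (F t <= limn (G^~ t))%E.
  have cG := ereal_nondecreasing_cvgn (GS t).
  rewrite (cvg_lim _ cG)//; set L := ereal_sup _.
  have GL n : (G n t <= L)%E by apply: ereal_sup_ubound; exists n.
  have : (0 <= L)%E by exact: le_trans (G0 0%N t) (GL 0%N).
  move: GL; case: L => [l||]//= GL _; last by rewrite leey.
  suff : ((b - l)%:E <= v (cis t))%E.
    rewrite /F; case: (v (cis t)) (vfin _ (cisle t)) => [r||]//=.
    by rewrite -EFinB !lee_fin; lra.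
  rewrite leNgt; apply/negP => vl.
  have [a va al] : exists2 a : R, (v (cis t) < a%:E)%E & (a < b - l)%R.
    move: vl; case: (v (cis t)) => [r||]//=; rewrite ?lte_fin => H'.
      by exists ((r + (b - l)) / 2); rewrite ?lte_fin; lra.
    by exists (b - l - 1); [exact: ltNyr|lra].
  have [n Una] := Ulim _ _ (cisle t) va.
  by have := GL n; rewrite lee_fin; lra.
have intF : (\int[mu]_(t in I) F t <= (2 * pi * (b - s))%:E)%E.
  apply: (@le_trans _ _ (\int[mu]_(t in I) limn (G^~ t))%E).
    apply: ge0_le_integral => //.
    - exact: measurable_funTS.
    - apply: measurable_funTS; apply: (emeasurable_fun_cvg G) => //.
      by move=> t _; exact: ereal_nondecreasing_is_cvgn (GS t).
  have mGI n : measurable_fun I (G n) by exact: measurable_funTS.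
  rewrite (monotone_convergence mu mI mGI (fun n t _ => G0 n t) (fun t _ => GS t)).
  apply: lime_le; last by apply: nearW => n; exact: intG.
  apply: ereal_nondecreasing_is_cvgn => n m nm.
  apply: ge0_le_integral.
  - exact: mI.
  - by move=> t _; exact: G0.
  - exact: mGI.
  - exact: mGI.
  - by move=> t _; exact: GS.
have iF : mu.-integrable I F.
  apply/integrableP; split; first exact: measurable_funTS.
  under eq_integral do rewrite gee0_abs//.
  exact: le_lt_trans intF (ltry _).
have ib : mu.-integrable I (EFin \o cst b).
  by apply: circle_integrable; exact: cst_continuous.
have -> : (\int[mu]_(t in I) v (cis t) = \int[mu]_(t in I) ((EFin \o cst b) t - F t))%E.
  apply: eq_integral => t _; rewrite /F /=.
  case: (v (cis t)) (vfin _ (cisle t)) => [r||]//= _.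
  by rewrite -!EFinB opprB addrC subrK.
have Ib : (\int[mu]_(t in I) (EFin \o cst b) t = (b * (2 * pi))%:E)%E.
  rewrite -[LHS]/(\int[mu]_(t in I) cst b%:E t)%E integral_cst//.
  by rewrite [X in (_ * X)%E]measure_circle EFinM.
rewrite integralB// Ib.
rewrite vs -(@lee_pmul2l _ (2 * pi)%:E) ?lte_fin ?two_pi_gt0//.
rewrite muleA -[X in (_ <= X * _)%E]EFinM mulfV ?gt_eqF ?two_pi_gt0// mul1e.
have Ffin : (\int[mu]_(t in I) F t)%E \is a fin_num by exact: integrable_fin_num.
rewrite leeBrDr// -EFinM.
apply: le_trans (leeD (lexx _) intF) _.
by rewrite -EFinD lee_fin; lra.
Qed.

Lemma visc_subharmonic (U : set R[i]^o) v :
  (forall z, U z -> (v z < +oo)%E) -> upper_semicontinuous_on U v ->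
  (forall z, U z -> visc_at v z) -> subharmonic_on U v.
Proof.
move=> vfin vusc vvisc; split=> // c r r0 cU.
have r0' : r%:C != 0 :> R[i] by rewrite eq_complex /= gt_eqF.
have inU z : normc z <= 1 -> U (c + r%:C * z).
  move=> z1; apply: cU; rewrite addrAC subrr add0r normcE lecR normcM normcR.
  by rewrite gtr0_norm// ler_piMr// ltW.
have := @visc_submean_unit (fun z => v (c + r%:C * z)); rewrite mulr0 addr0.
apply => [z z1|z z1|z z1 B C e d e0 d0 vz H].
- apply: (@usc_comp R R[i]^o R[i]^o v (fun z => c + r%:C * z)).
    by move=> a va; apply: vusc => //; exact: inU.
  apply: continuousD; first exact: cst_continuous.
  by apply: (@continuousM R[i] R[i]^o); [exact: cst_continuous|move=> ?; exact: cvg_id].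
- by apply: vfin; exact: inU.
- apply: (vvisc _ (inU _ (ltW z1)) (B / r%:C) (C / r%:C ^+ 2) (e / r ^+ 2) (r * d)) => //.
  + by rewrite divr_gt0// exprn_gt0.
  + exact: mulr_gt0.
  + move=> k kd; have := H (k / r%:C).
    have nk : normc (k / r%:C) = normc k / r.
      by rewrite normcM Normc.normcV normcR gtr0_norm.
    rewrite nk ltr_pdivrMr// [d * r]mulrC => /(_ kd).
    rewrite mulrDr addrA [r%:C * (k / _)]mulrC divfK//.
    have -> : B * (k / r%:C) + C * (k / r%:C) ^+ 2 = B / r%:C * k + C / r%:C ^+ 2 * k ^+ 2.
      by field.
    by have -> : e * (normc k / r) ^+ 2 = e / r ^+ 2 * normc k ^+ 2 by field; rewrite gt_eqF.
Qed.

End CircleMeans.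

(** * One-variable expansions and derivatives *)

Section RealDerivatives.
Context {R : realType}.
Implicit Types (f : R -> R) (t s a K d : R).

Lemma is_derive_quadratic f a K d : 0 < d ->
  (forall t, `|t| <= d -> `|f t - f 0 - t * a| <= K * t ^+ 2) -> is_derive (0 : R) 1 f a.
Proof.
move=> d0 H; have K0 : 0 <= K.
  have := le_trans (normr_ge0 _) (H d _); rewrite gtr0_norm// lexx => /(_ isT).
  by rewrite pmulr_lge0// exprn_gt0.
have lim : h^-1 *: (f (h *: 1 + 0) - f 0) @[h --> (0:R)^'] --> a.
  apply/cvgrPdist_le => e e0; near=> h.
  have h0 : h != 0 by near: h; exact: nbhs_dnbhs_neq.
  rewrite addr0 /GRing.scale /= mulr1.
  have -> : a - h^-1 * (f h - f 0) = - (h^-1 * (f h - f 0 - h * a)) by field.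
  rewrite normrN normrM normfV ler_pdivrMl ?normr_gt0//.
  have hd : `|h| <= d.
    by near: h; apply: dnbhs0_le.
  apply: le_trans (H _ hd) _; rewrite -[h ^+ 2]real_normK ?num_real//.
  rewrite expr2 mulrCA ler_wpM2l//.
  have : `|h| <= e / (K + 1) by near: h; apply: dnbhs0_le; rewrite divr_gt0// ltr_wpDl.
  rewrite ler_pdivlMr ?ltr_wpDl//; have := normr_ge0 h; nra.
have df : derivable f 0 1 by apply/cvg_ex; exists a; exact: lim.
by split => //; apply/cvg_lim.
Unshelve. all: by end_near. Qed.

Lemma is_derive_small f (a : R) : is_derive (0 : R) 1 f a ->
  forall e : R, 0 < e -> exists2 d : R, 0 < d &
    forall t, `|t| < d -> `|f t - f 0 - t * a| <= e * `|t|.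
Proof.
move=> [df fa] e e0.
have lim : h^-1 *: (f (h *: 1 + 0) - f 0) @[h --> (0:R)^'] --> a.
  by rewrite -fa; exact: df.
move/cvgrPdist_le : lim => /(_ e e0).
rewrite near_withinE => /nbhs_ballP[d /= d0 dP]; exists d => // t td.
have [->|t0] := eqVneq t 0; first by rewrite subrr mul0r subrr normr0 mulr0.
have /(_ _ t0) := dP t; rewrite -ball_normE /= sub0r normrN => /(_ td).
rewrite addr0 /GRing.scale /= mulr1.
have -> : f t - f 0 - t * a = - (t * (a - t^-1 * (f t - f 0))) by field.
by move=> H; rewrite normrN normrM mulrC ler_wpM2r.
Qed.

Lemma derivable_shift f t : derivable (fun s => f (t + s)) 0 1 -> derivable f t 1 /\
  derive1 f t = derive1 (fun s => f (t + s)) 0.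
Proof.
have E : (fun h : R => h^-1 *: (f (h *: 1 + t) - f t)) =
    (fun h : R => h^-1 *: (((fun s => f (t + s)) \o shift 0) (h *: 1) - f (t + 0))).
  by apply/funext => h; rewrite /= !addr0 [h *: 1 + t]addrC.
by rewrite /derivable !derive1E /derive /= E => ?; split.
Qed.

(** f' is differentiable at 0 alone, so Taylor's formula with a second derivative is replaced by the
    mean value theorem for the error g, whose derivative at s is at most e |s| in absolute value. *)
Lemma taylor_peano f (f' : R -> R) (b d : R) : 0 < d ->
  (forall t, `|t| < d -> is_derive t 1 f (f' t)) -> is_derive (0 : R) 1 f' b ->
  forall e : R, 0 < e -> exists2 r : R, 0 < r &
    forall t, `|t| < r -> `|f t - f 0 - (t * f' 0 + b / 2 * t ^+ 2)| <= e * t ^+ 2.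
Proof.
move=> d0 df df' e e0; have [r r0 rP] := is_derive_small df' e0.
exists (Num.min d r); first by rewrite lt_min d0.
move=> t; rewrite lt_min => /andP[td tr].
pose g s := f s - (s * f' 0 + b / 2 * s ^+ 2).
have dg s : `|s| < d -> is_derive s 1 g (f' s - (f' 0 + s * b)).
  move=> sd; have h1 := df s sd.
  have h2 : is_derive s (1 : R) (fun s : R => s * f' 0 + b / 2 * s ^+ 2) (f' 0 + s * b).
    have := is_deriveD (is_deriveZ (f' 0) (is_derive_id s (1 : R)))
      (is_deriveZ (b / 2) (is_deriveM (is_derive_id s (1 : R)) (is_derive_id s (1 : R)))).
    rewrite /GRing.scale /= !mulr1.
    have -> : f' 0 + b / 2 * (s + s) = f' 0 + s * b by field.
    set F := (X in is_derive _ _ X _ -> _) => dF.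
    suff -> : (fun s => s * f' 0 + b / 2 * s ^+ 2) = F by [].
    apply/funext => x; change (x * f' 0 + b / 2 * x ^+ 2 = f' 0 * x + b / 2 * (x * x)); ring.
  exact: is_deriveB.
have key s1 s2 : s1 < s2 -> `|s1| <= `|t| -> `|s2| <= `|t| ->
    `|g s2 - g s1| <= e * `|t| * (s2 - s1).
  move=> s12 s1t s2t.
  have inI s : s1 <= s <= s2 -> `|s| <= `|t|.
    by move: s1t s2t; rewrite !ler_norml; lra.
  have [||c c12 ->] := @MVT R g (fun s => f' s - (f' 0 + s * b)) s1 s2 s12.
  - move=> s; rewrite in_itv /= => /andP[a1 a2]; apply: dg.
    by apply: le_lt_trans td; apply: inI; rewrite !ltW.
  - apply: derivable_within_continuous => s; rewrite in_itv /= => a12.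
    have [] // := dg s; apply: le_lt_trans td; exact: inI.
  have h21 : 0 <= s2 - s1 by rewrite subr_ge0 ltW.
  rewrite normrM (ger0_norm h21) ler_wpM2r//.
  move: c12; rewrite in_itv /= => /andP[a1 a2].
  have ct : `|c| <= `|t| by apply: inI; rewrite !ltW.
  rewrite opprD addrA; apply: le_trans (rP c (le_lt_trans ct tr)) _.
  by rewrite ler_wpM2l// ltW.
have -> : f t - f 0 - (t * f' 0 + b / 2 * t ^+ 2) = g t - g 0 by rewrite /g; ring.
have [t0|t0|->] := ltgtP t 0.
- have := key t 0 t0 (lexx _); rewrite normr0 normr_ge0 => /(_ isT).
  move=> H; rewrite distrC; apply: le_trans H _; rewrite ltr0_norm//.
  by rewrite le_eqVlt; apply/orP; left; apply/eqP; ring.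
- have := key 0 t t0 _ (lexx _); rewrite normr0 normr_ge0 => /(_ isT).
  move=> H; apply: le_trans H _; rewrite gtr0_norm//.
  by rewrite le_eqVlt; apply/orP; left; apply/eqP; ring.
- by rewrite subrr normr0 expr0n /= mulr0.
Qed.

End RealDerivatives.

(** * Locally harmonic functions: derivatives, smoothness, vanishing Laplacian *)

Section HarmonicClass.
Context {R : realType} {V : normedModType R[i]}.
Implicit Types (u : V -> R) (z y b c v : V) (U : set V).

(* The pluriharmonic functions in the form in which they are used: locally
   bounded, and uniform limits of real parts of polynomials on the complex
   discs contained in small balls. *)
Definition harmonic_ball z (r m : R) u :=
  (forall y, nrm (y - z) < r -> `|u y| <= m) /\
  forall y b, (forall h : R[i], normc h <= 1 -> nrm (y + h *: b - z) < r) ->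
    approximable (fun h => u (y + h *: b)).

Definition locally_harmonic U u := forall z, U z ->
  exists r m : R, [/\ 0 < r, (forall y, nrm (y - z) < r -> U y) & harmonic_ball z r m u].

Lemma disc_in_ball z y b (r1 r2 : R) (h : R[i]) : nrm (y - z) < r1 -> nrm b <= r2 ->
  normc h <= 1 -> nrm (y + h *: b - z) < r1 + r2.
Proof.
move=> yz br h1; rewrite addrAC; apply: le_lt_trans (nrmD _ _) _.
apply: ltr_leD => //; rewrite nrmZ; apply: le_trans br.
by rewrite ler_piMl// nrm_ge0.
Qed.

(** The summand 1 in the denominator avoids a case distinction on b = 0. *)
Lemma half_radius (b : V) (r : R) : 0 < r -> let s := r / 2 / (nrm b + 1) in
  0 < s /\ nrm (s%:C *: b) <= r / 2.
Proof.
move=> r0 /=; have b0 := nrm_ge0 b.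
have b1 : 0 < nrm b + 1 by rewrite ltr_wpDl.
have s0 : 0 < r / 2 / (nrm b + 1) by rewrite !divr_gt0.
split => //; rewrite nrmZ normcR gtr0_norm//.
have : r / 2 / (nrm b + 1) * (nrm b + 1) = r / 2 by rewrite divfK// gt_eqF.
move: s0; set s := _ / (nrm b + 1); nra.
Qed.

(* The disc of radius s around y in the direction b stays in the ball. *)
Lemma harmonic_ball_jet z (r m : R) u y b : 0 < r -> harmonic_ball z r m u ->
  nrm (y - z) < r / 2 ->
  let s := r / 2 / (nrm b + 1) in
  exists A C : R[i], normc A <= 2 * m / s /\
  forall h : R[i], normc h <= s / 2 ->
    `|u (y + h *: b) - u y - Re (A * h)| <= 4 * m / s ^+ 2 * normc h ^+ 2 /\
    `|u (y + h *: b) - u y - Re (A * h + C * h ^+ 2)| <= 4 * m / s ^+ 3 * normc h ^+ 3.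
Proof.
move=> r0 [um ua] yz s; have [s0 sb] := half_radius b r0; rewrite -/s in s0 sb.
pose g (h : R[i]) := u (y + h *: (s%:C *: b)).
have inB (h : R[i]) : normc h <= 1 -> nrm (y + h *: (s%:C *: b) - z) < r.
  by move=> h1; rewrite [r]splitr; exact: disc_in_ball.
have ga : approximable g by apply: ua.
have gm (h : R[i]) : normc h <= 1 -> `|g h| <= m by move=> h1; exact/um/inB.
have sC : s%:C != 0 :> R[i] by rewrite eq_complex /= gt_eqF.
exists (harm_coef g 1 / s%:C), (harm_coef g 2 / s%:C ^+ 2); split.
  rewrite normcM Normc.normcV normcR gtr0_norm// ler_pM2r ?invr_gt0//.
  exact: harm_coef_bound.
move=> h hs; pose k := h / s%:C.
have nk : normc k = normc h / s by rewrite normcM Normc.normcV normcR gtr0_norm.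
have k2 : normc k <= 2^-1 by rewrite nk ler_pdivrMr// mulrC.
have gk : g k = u (y + h *: b) by rewrite /g scalerA divfK.
have g0 : g 0 = u y by rewrite /g scale0r addr0.
have E1 : harm_coef g 1 / s%:C * h = harm_coef g 1 * k by rewrite /k; field.
have E2 : harm_coef g 2 / s%:C ^+ 2 * h ^+ 2 = harm_coef g 2 * k ^+ 2 by rewrite /k; field.
rewrite E1 E2 -gk -g0; split.
  have -> : 4 * m / s ^+ 2 * normc h ^+ 2 = 4 * m * normc k ^+ 2.
    by rewrite nk; field; rewrite gt_eqF.
  exact: harm_jet2.
have -> : 4 * m / s ^+ 3 * normc h ^+ 3 = 4 * m * normc k ^+ 3.
  by rewrite nk; field; rewrite gt_eqF.
exact: harm_jet3.
Qed.

Lemma harmonic_ball_derive z (r m : R) u y b : 0 < r -> harmonic_ball z r m u ->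
  nrm (y - z) < r / 2 ->
  let s := r / 2 / (nrm b + 1) in
  [/\ real_derivable u y b, `|real_derive b u y| <= 2 * m / s &
  forall t : R, `|t| <= s / 2 ->
    `|u (y + t%:C *: b) - u y - t * real_derive b u y| <= 4 * m / s ^+ 2 * t ^+ 2].
Proof.
move=> r0 ub yz s; have [s0 _] := half_radius b r0; rewrite -/s in s0.
have [A [C [Am AP]]] := harmonic_ball_jet b r0 ub yz; rewrite -/s in Am AP.
have E (t : R) : `|t| <= s / 2 ->
    `|along u y b t - along u y b 0 - t * Re A| <= 4 * m / s ^+ 2 * t ^+ 2.
  move=> ts; have [|+ _] := AP t%:C; first by rewrite normcR.
  by rewrite normcR real_normK ?num_real// /along scale0r addr0 mulrC cReZ.
have s20 : 0 < s / 2 by rewrite divr_gt0.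
have [du dE] := is_derive_quadratic s20 E.
have DE : real_derive b u y = Re A by rewrite /real_derive derive1E dE.
split; first exact: du.
- by rewrite DE; apply: le_trans Am; exact: normc_Re.
- by move=> t ts; rewrite DE; have := E t ts; rewrite /along scale0r addr0.
Qed.

(** Difference quotients in the direction b are approximable on discs in any direction c, as
    combinations of two translates of u. Their quadratic remainder has a constant uniform over the
    smaller ball, so they converge uniformly and the limit is approximable too. *)
Lemma harmonic_ball_real_derive z (r m : R) u b : 0 < r -> harmonic_ball z r m u ->
  harmonic_ball z (r / 2) (2 * m / (r / 2 / (nrm b + 1))) (real_derive b u).
Proof.
move=> r0 ub; set s := r / 2 / (nrm b + 1).
have [s0 sb] := half_radius b r0; rewrite -/s in s0 sb.
have m0 : 0 <= m.
  by apply: le_trans (normr_ge0 (u z)) _; apply: ub.1; rewrite subrr nrm0.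
split=> [y yz|y c yc]; first by have [] := harmonic_ball_derive b r0 ub yz.
apply: approximable_limit => e e0.
have K0 : 0 < 4 * m / s ^+ 2 + 1.
  by rewrite ltr_wpDl//; apply: divr_ge0; [exact: mulr_ge0|exact/exprn_ge0/ltW].
pose t := Num.min (s / 2) (e / (4 * m / s ^+ 2 + 1)).
have t0 : 0 < t by rewrite lt_min; apply/andP; split; exact: divr_gt0.
have ts : `|t| <= s / 2 by rewrite gtr0_norm// ge_min lexx.
have te : 4 * m / s ^+ 2 * t <= e.
  have : t <= e / (4 * m / s ^+ 2 + 1) by rewrite ge_min lexx orbT.
  rewrite ler_pdivlMr//; move: t0; move: (4 * m / _) => K; lra.
have tb : nrm (t%:C *: b) <= r / 2.
  apply: le_trans sb; rewrite !nrmZ ler_wpM2r ?nrm_ge0// !normcR (gtr0_norm s0).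
  by apply: le_trans ts _; lra.
exists (fun h : R[i] => t^-1 * u ((y + t%:C *: b) + h *: c) + (- t^-1) * u (y + h *: c)).
  apply: approximable_lin; apply: ub.2 => h h1.
    have -> : y + t%:C *: b + h *: c - z = (y + h *: c - z) + t%:C *: b.
      by rewrite [y + _ + _]addrAC [LHS]addrAC.
    apply: le_lt_trans (nrmD _ _) _; rewrite [ltRHS]splitr.
    by apply: ltr_leD => //; exact: yc.
  by apply: lt_trans (yc h h1) _; lra.
move=> h h1; have [_ _ H] := harmonic_ball_derive b r0 ub (yc h h1).
have := H t ts; rewrite -/s [y + h *: c + _]addrAC => {}H.
have -> : real_derive b u (y + h *: c) -
    (t^-1 * u (y + t%:C *: b + h *: c) + - t^-1 * u (y + h *: c)) =
    - (t^-1 * (u (y + t%:C *: b + h *: c) - u (y + h *: c) - t * real_derive b u (y + h *: c))).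
  by field; rewrite gt_eqF.
rewrite normrN normrM gtr0_norm ?invr_gt0// ler_pdivrMl//.
by apply: le_trans H _; rewrite expr2 mulrA mulrC ler_wpM2l// ltW.
Qed.

Lemma locally_harmonic_real_derive U u b :
  locally_harmonic U u -> locally_harmonic U (real_derive b u).
Proof.
move=> uH z Uz; have [r [m [r0 rU ub]]] := uH z Uz.
exists (r / 2), (2 * m / (r / 2 / (nrm b + 1))); split.
- by rewrite divr_gt0.
- by move=> y yz; apply: rU; lra.
- exact: harmonic_ball_real_derive.
Qed.

(** The disc in the direction b is rescaled to radius r/2 whatever the length of b. The constant
    therefore depends on r and m only, and estimates along lines give joint continuity. *)
Lemma harmonic_ball_lipschitz z (r m : R) u y b : 0 < r -> harmonic_ball z r m u ->
  nrm (y - z) < r / 2 -> nrm b <= r / 4 -> `|u (y + b) - u y| <= 8 * m / r * nrm b.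
Proof.
move=> r0 [um ua] yz br.
have m0 : 0 <= m.
  by apply: le_trans (normr_ge0 (u z)) _; apply: um; rewrite subrr nrm0.
have [b0|b0] := eqVneq (nrm b) 0.
  by rewrite (nrm_eq0 b0) addr0 subrr normr0 nrm0 mulr0.
have {}b0 : 0 < nrm b by rewrite lt_neqAle eq_sym b0 nrm_ge0.
pose l := r / 2 / nrm b; have l0 : 0 < l by rewrite !divr_gt0.
have lC : l%:C != 0 :> R[i] by rewrite eq_complex /= gt_eqF.
have lb : nrm (l%:C *: b) <= r / 2.
  by rewrite nrmZ normcR gtr0_norm// /l divfK// gt_eqF.
pose g (h : R[i]) := u (y + h *: (l%:C *: b)).
have inB (h : R[i]) : normc h <= 1 -> nrm (y + h *: (l%:C *: b) - z) < r.
  by move=> h1; rewrite [r]splitr; exact: disc_in_ball.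
have ga : approximable g by apply: ua.
have gm (h : R[i]) : normc h <= 1 -> `|g h| <= m by move=> h1; exact/um/inB.
pose k : R[i] := l^-1%:C.
have nk : normc k = 2 / r * nrm b.
  by rewrite normcR gtr0_norm ?invr_gt0// /l; field; rewrite !gt_eqF.
have k2 : normc k <= 2^-1.
  rewrite nk mulrAC ler_pdivrMr//; lra.
have gk : g k = u (y + b) by rewrite /g scalerA -realcM mulVf ?gt_eqF// scale1r.
have g0 : g 0 = u y by rewrite /g scale0r addr0.
have := harm_jet2 ga gm k2; rewrite gk g0 => J.
have A1 := harm_coef_bound ga (isT : (0 < 1)%N) gm.
have A2 : `|Re (harm_coef g 1 * k)| <= 2 * m * normc k.
  by apply: le_trans (normc_Re _) _; rewrite normcM ler_wpM2r ?normc_ge0.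
have -> : 8 * m / r * nrm b = 4 * m * normc k by rewrite nk; field; rewrite gt_eqF.
have k0 := normc_ge0 k.
have k22 : 4 * m * normc k ^+ 2 <= 2 * m * normc k.
  have : m * normc k * normc k <= m * normc k * 2^-1 by rewrite ler_wpM2l// mulr_ge0.
  rewrite expr2; lra.
move: J A2; rewrite !ler_norml; move: (4 * m * _) k22 => X; lra.
Qed.

Lemma locally_harmonic_continuous U u z : locally_harmonic U u -> U z ->
  {for z, continuous u}.
Proof.
move=> uH Uz; have [r [m [r0 _ ub]]] := uH z Uz.
have m0 : 0 <= m.
  by apply: le_trans (normr_ge0 (u z)) _; apply: ub.1; rewrite subrr nrm0.
apply/continuous_nrmP => e e0.
have K0 : 0 < 8 * m / r + 1 by rewrite ltr_wpDl// divr_ge0 ?mulr_ge0// ltW.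
exists (Num.min (r / 4) (e / (8 * m / r + 1))); first by rewrite lt_min !divr_gt0.
move=> y; rewrite lt_min => /andP[yr ye].
have zz : nrm (z - z) < r / 2 by rewrite subrr nrm0 divr_gt0.
have := harmonic_ball_lipschitz r0 ub zz (ltW yr); rewrite [z + _]addrC subrK.
move=> /le_lt_trans; apply; move: ye; rewrite ltr_pdivlMr//.
have := nrm_ge0 (y - z); move: (8 * m / r) => K; lra.
Qed.

Lemma locally_harmonic_Ck U u k : locally_harmonic U u -> Ck_on k U u.
Proof.
elim: k u => [|k IH] u uH; split=> //; try by move=> z /set_mem; exact: locally_harmonic_continuous.
move=> v; split; last exact/IH/locally_harmonic_real_derive.
move=> z Uz; have [r [m [r0 _ ub]]] := uH z Uz.
have zz : nrm (z - z) < r / 2 by rewrite subrr nrm0 divr_gt0.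
by have [] := harmonic_ball_derive v r0 ub zz.
Qed.

Lemma second_derivative_peano U u z v (d : R) : 0 < d ->
  (forall y, nrm (y - z) < d -> U y) -> Ck_on 2 U u ->
  forall e : R, 0 < e -> exists2 r : R, 0 < r & forall t : R, `|t| < r ->
    `|u (z + t%:C *: v) - u z -
      (t * real_derive v u z + real_derive v (real_derive v u) z / 2 * t ^+ 2)| <= e * t ^+ 2.
Proof.
move=> d0 dU [_ C2] e e0; have [du [_ /(_ v) [ddu _]]] := C2 v.
have v1 : 0 < nrm v + 1 by rewrite ltr_wpDl// nrm_ge0.
have inU (t : R) : `|t| < d / (nrm v + 1) -> U (z + t%:C *: v).
  rewrite ltr_pdivlMr// => tv; apply: dU; rewrite addrAC subrr add0r nrmZ normcR.
  by apply: le_lt_trans tv; rewrite ler_wpM2l// lerDl.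
have alongS t : along u (z + t%:C *: v) v = (fun s => along u z v (t + s)).
  by apply/funext => s; rewrite /along -addrA -scalerDl -realcD.
have df (t : R) : `|t| < d / (nrm v + 1) ->
    is_derive t (1 : R) (along u z v) (along (real_derive v u) z v t).
  move=> /inU /du; rewrite /real_derivable alongS => H.
  have [d1 d2] := derivable_shift H.
  split=> //; rewrite -derive1E d2 {2}/along /real_derive alongS //.
have Uz : U z by apply: dU; rewrite subrr nrm0.
have ddf : is_derive (0 : R) 1 (along (real_derive v u) z v)
    (real_derive v (real_derive v u) z).
  by split; [exact: ddu|rewrite /real_derive derive1E].
have [|r r0 rP] := taylor_peano _ df ddf e0; first by rewrite divr_gt0.
exists r => // t /rP; rewrite /along scale0r addr0.
by [].
Qed.

(** Adding an expansion at t and at -t cancels its linear term and isolates the quadratic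
    coefficient. *)
Lemma second_derivative_unique (f : R -> R) (a1 c1 a2 c2 : R) :
  (forall e : R, 0 < e -> exists2 r : R, 0 < r & forall t : R, `|t| < r ->
    `|f t - f 0 - (t * a1 + c1 * t ^+ 2)| <= e * t ^+ 2) ->
  (forall e : R, 0 < e -> exists2 r : R, 0 < r & forall t : R, `|t| < r ->
    `|f t - f 0 - (t * a2 + c2 * t ^+ 2)| <= e * t ^+ 2) -> c1 = c2.
Proof.
move=> H1 H2; apply/eqP; rewrite -subr_eq0 -normr_eq0 eq_le normr_ge0 andbT.
apply/ler_addgt0Pr => e e0; rewrite add0r.
have e20 : 0 < e / 2 by rewrite divr_gt0.
have [r1 r10 R1] := H1 _ e20; have [r2 r20 R2] := H2 _ e20.
pose t := Num.min r1 r2 / 2.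
have m0 : 0 < Num.min r1 r2 by rewrite lt_min r10.
have t0 : 0 < t by rewrite divr_gt0.
have tm : t < Num.min r1 r2 by rewrite /t gtr_pMr// invf_lt1// ltr1n.
have [tr1 tr2] : t < r1 /\ t < r2 by move: tm; rewrite lt_min => /andP.
have P1 := R1 t; have P2 := R2 t; have Q1 := R1 (- t); have Q2 := R2 (- t).
rewrite ?normrN (gtr0_norm t0) in P1 P2 Q1 Q2.
move: (P1 tr1) (P2 tr2) (Q1 tr1) (Q2 tr2); rewrite !sqrrN.
have t2 : 0 < t ^+ 2 by rewrite exprn_gt0.
move=> {P1 P2 Q1 Q2} P1 P2 Q1 Q2.
have : `|c1 - c2| * t ^+ 2 <= e * t ^+ 2.
  rewrite -[t ^+ 2](gtr0_norm t2) -normrM (gtr0_norm t2) mulrBl.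
  move: P1 P2 Q1 Q2; rewrite !ler_norml !mulNr.
  move: (c1 * _) (c2 * _) (t * a1) (t * a2) => X Y Z W.
  have -> : e / 2 * t ^+ 2 = e * t ^+ 2 / 2 by ring.
  move: (e * t ^+ 2) => T; lra.
by rewrite ler_pM2r.
Qed.

(** In the direction w v with |w| = 1, half the second derivative is Re(C w^2), with C the quadratic
    coefficient along the complex line; the squares of 1 and 'i are opposite. *)
Lemma locally_harmonic_second U u z v : open U -> locally_harmonic U u -> U z ->
  real_derive v (real_derive v u) z +
  real_derive ('i *: v) (real_derive ('i *: v) u) z = 0.
Proof.
move=> oU uH Uz; have [r [m [r0 rU ub]]] := uH z Uz.
have zz : nrm (z - z) < r / 2 by rewrite subrr nrm0 divr_gt0.
have [A [C [_ AP]]] := harmonic_ball_jet v r0 ub zz.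
set s := r / 2 / (nrm v + 1) in AP.
have [s0 _] := half_radius v r0; rewrite -/s in s0.
have m0 : 0 <= m.
  by apply: le_trans (normr_ge0 (u z)) _; apply: ub.1; rewrite subrr nrm0.
have K0 : 0 <= 4 * m / s ^+ 3 by apply: divr_ge0; [exact: mulr_ge0|exact/exprn_ge0/ltW].
have C2 := locally_harmonic_Ck 2 uH.
have jet (w : R[i]) : normc w = 1 -> forall e : R, 0 < e -> exists2 r : R, 0 < r & forall t : R, `|t| < r ->
    `|u (z + t%:C *: (w *: v)) - u (z + (0 : R)%:C *: (w *: v)) -
      (t * Re (A * w) + Re (C * w ^+ 2) * t ^+ 2)| <= e * t ^+ 2.
  move=> w1 e e0; have K1 : 0 < 4 * m / s ^+ 3 + 1 by lra.
  exists (Num.min (s / 2) (e / (4 * m / s ^+ 3 + 1))).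
    by rewrite lt_min; apply/andP; split; exact: divr_gt0.
  move=> t; rewrite lt_min => /andP[ts te].
  have nt : normc (t%:C * w) = `|t| by rewrite normcM w1 mulr1 normcR.
  have [|_] := AP (t%:C * w); first by rewrite nt ltW.
  rewrite nt !scalerA mul0r scale0r addr0 exprMn.
  have -> : Re (A * (t%:C * w) + C * (t%:C ^+ 2 * w ^+ 2)) =
      t * Re (A * w) + Re (C * w ^+ 2) * t ^+ 2.
    by rewrite cReD mulrCA cReZ mulrCA -rmorphXn cReZ [t ^+ 2 * _]mulrC.
  move=> /le_trans; apply; rewrite -[X in _ <= e * X]real_normK ?num_real//.
  rewrite [X in _ * X <= _]exprS mulrA ler_wpM2r ?exprn_ge0//.
  move: te; rewrite ltr_pdivlMr//; have := normr_ge0 t; move: (4 * m / _) K0 => K; nra.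
have E (w : R[i]) : normc w = 1 ->
    real_derive (w *: v) (real_derive (w *: v) u) z = 2 * Re (C * w ^+ 2).
  move=> w1.
  have P := second_derivative_peano (w *: v) r0 rU C2.
  have : real_derive (w *: v) (real_derive (w *: v) u) z / 2 = Re (C * w ^+ 2).
    apply: (@second_derivative_unique (along u z (w *: v))).
      move=> e /P [r' r'0 rP]; exists r' => // t /rP.
      by rewrite /along scale0r addr0; apply.
    exact: jet.
  lra.
have := E 1 (normc1); have := E 'i (normci); rewrite scale1r => -> ->.
by rewrite sqr_i expr1n mulrN1 cReN mulr1; ring.
Qed.

(** Summed over the increments t, -t, it, -it, the touching polynomial keeps only -4 e t^2, while
    the expansions of u leave the Laplacian, which is zero, up to e t^2. The factor [sg] serves u
    and -u at once. *)
Lemma harmonic_no_touch U u z v (sg : R) (d : R) : 0 < d ->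
  (forall y, nrm (y - z) < d -> U y) -> Ck_on 2 U u ->
  real_derive v (real_derive v u) z +
  real_derive ('i *: v) (real_derive ('i *: v) u) z = 0 ->
  visc_at (fun h => (sg * u (z + h *: v))%:E) 0.
Proof.
move=> d0 dU C2 lap B C e r e0 r0 _ H.
have e40 : 0 < e / 4 / (`|sg| + 1) by rewrite !divr_gt0// ltr_wpDl.
have [r1 r10 P1] := second_derivative_peano v d0 dU C2 e40.
have [r2 r20 P2] := second_derivative_peano ('i *: v) d0 dU C2 e40.
move: (real_derive ('i *: v) (real_derive ('i *: v) u) z)
  (real_derive v (real_derive v u) z) lap P1 P2 => D2 D1 lap P1 P2.
move: (real_derive ('i *: v) u z) (real_derive v u z) P1 P2 => E2 E1 P1 P2.
pose t := Num.min r (Num.min r1 r2) / 2.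
have m0 : 0 < Num.min r (Num.min r1 r2) by rewrite !lt_min r0 r10.
have t0 : 0 < t by rewrite divr_gt0.
have tm : t < Num.min r (Num.min r1 r2) by rewrite /t gtr_pMr// invf_lt1// ltr1n.
have [tr tr1 tr2] : [/\ t < r, t < r1 & t < r2] by move: tm; rewrite !lt_min => /and3P.
have t2 : 0 < t ^+ 2 by rewrite exprn_gt0.
have K w (F1 F2 : R) : normc w = 1 -> (forall x : R, `|x| = t ->
      `|u (z + x%:C *: (w *: v)) - u z - (x * F1 + F2 / 2 * x ^+ 2)| <= e / 4 / (`|sg| + 1) * x ^+ 2) ->
    sg * F2 * t ^+ 2 <= (2 * Re (C * w ^+ 2) - 2 * e + e / 2) * t ^+ 2.
  move=> w1 P.
  have Q (x : R) : `|x| = t -> sg * (x * F1 + F2 / 2 * t ^+ 2) <=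
      x * Re (B * w) + Re (C * w ^+ 2) * t ^+ 2 - e * t ^+ 2 + e / 4 * t ^+ 2.
    move=> xt; have x2 : x ^+ 2 = t ^+ 2 by rewrite -xt real_normK// num_real.
    have nx : normc (x%:C * w) = t by rewrite normcM w1 mulr1 normcR.
    have := H (x%:C * w); rewrite nx tr => /(_ isT); rewrite add0r scale0r addr0.
    rewrite -EFinD lee_fin -scalerA exprMn.
    have -> : Re (B * (x%:C * w) + C * (x%:C ^+ 2 * w ^+ 2)) =
        x * Re (B * w) + Re (C * w ^+ 2) * t ^+ 2.
      by rewrite cReD mulrCA cReZ mulrCA -rmorphXn cReZ [x ^+ 2 * _]mulrC x2.
    have := P x xt; rewrite x2 => {}P.
    have : `|sg * (u (z + x%:C *: (w *: v)) - u z - (x * F1 + F2 / 2 * t ^+ 2))| <= e / 4 * t ^+ 2.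
      rewrite normrM; apply: le_trans (ler_wpM2l (normr_ge0 _) P) _.
      have qe : e / 4 / (`|sg| + 1) * (`|sg| + 1) = e / 4 by rewrite divfK// gt_eqF// ltr_wpDl.
      have := mulr_ge0 (ltW e40) (ltW t2); set q := e / 4 / _ in qe *; rewrite -qe.
      clear; lra.
    rewrite mulrBr mulrBr ler_norml; move: (sg * _) (sg * _) (sg * _) => X Y Z; clear; lra.
  have := Q t (gtr0_norm t0); have := Q (- t); rewrite normrN => /(_ (gtr0_norm t0)).
  rewrite !mulrDr !mulNr !mulrN; move: (sg * (t * F1)) (t * Re _) => X Y; clear; lra.
have K1 : sg * D1 * t ^+ 2 <= (2 * Re (C * 1 ^+ 2) - 2 * e + e / 2) * t ^+ 2.
  apply: (K 1 E1) => [|x xt]; first exact: normc1.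
  by rewrite scale1r; apply: P1; rewrite xt.
have K2 : sg * D2 * t ^+ 2 <= (2 * Re (C * 'i ^+ 2) - 2 * e + e / 2) * t ^+ 2.
  apply: (K 'i E2) => [|x xt]; first exact: normci.
  by apply: P2; rewrite xt.
rewrite sqr_i expr1n mulrN1 cReN mulr1 in K1 K2.
rewrite (ler_pM2r t2) in K1; rewrite (ler_pM2r t2) in K2.
have lap' : sg * D1 + sg * D2 = 0 by rewrite -mulrDr lap mulr0.
move: K1 K2 e0 lap'; clear; move: (sg * D1) (sg * D2) (Re C) => X Y c; lra.
Qed.

End HarmonicClass.

(** * Restriction to complex lines *)

Section Lines.
Context {R : realType} {V : normedModType R[i]}.
Implicit Types (u : V -> R) (a b : V) (U : set V).

(** [complex_line] in an arbitrary normed space; on row vectors the two are convertible. *)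
Definition line a b : R[i]^o -> V := fun l => a + l *: b.

Lemma line_shift a b (k h : R[i]) : line a b (k + h) = line a b k + h *: b.
Proof. by rewrite /line scalerDl addrA. Qed.

Lemma nrm_line a b (k l : R[i]) : nrm (line a b k - line a b l) = normc (k - l) * nrm b.
Proof. by rewrite /line opprD addrACA subrr add0r -scalerBl nrmZ. Qed.

Lemma line_ball a b (k : R[i]) (d : R) : 0 < d -> exists2 r : R, 0 < r &
  forall l, normc (l - k) < r -> nrm (line a b l - line a b k) < d.
Proof.
move=> d0; have b1 : 0 < nrm b + 1 by rewrite ltr_wpDl// nrm_ge0.
exists (d / (nrm b + 1)); first exact: divr_gt0.
move=> l; rewrite ltr_pdivlMr// nrm_line; apply: le_lt_trans.
by rewrite ler_wpM2l ?normc_ge0// lerDl.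
Qed.

Lemma continuous_line a b : continuous (line a b).
Proof.
move=> k; apply/continuous_cnrmP => e e0; have [r r0 rP] := line_ball a b k e0.
by exists r => // y; rewrite nrm_normc; exact: rP.
Qed.

Lemma open_line_preimage U a b : open U -> open (line a b @^-1` U).
Proof. by move=> oU; apply: open_comp => // x _; exact: continuous_line. Qed.

Lemma locally_harmonic_line U u a b : locally_harmonic U u ->
  locally_harmonic (line a b @^-1` U) (u \o line a b).
Proof.
move=> uH k Uk; have [r [m [r0 rU [um ua]]]] := uH _ Uk.
have [d d0 dP] := line_ball a b k r0.
exists d, m; split=> //.
  by move=> l; rewrite nrm_normc => /dP; exact: rU.
split=> [l|l c lc]; first by rewrite nrm_normc => /dP; exact: um.
have E (h : R[i]) : line a b (l + h *: c) = line a b l + h *: (c *: b).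
  by rewrite line_shift scalerA.
apply: (@approximable_ext _ (fun h => u (line a b l + h *: (c *: b)))).
  by move=> h _; rewrite /= E.
apply: ua => h h1; rewrite -E; apply: dP; have := lc h h1.
by rewrite nrm_normc.
Qed.

End Lines.

(** * From local harmonicity to pluriharmonicity *)

Section Pluriharmonic.
Context {R : realType} {n : nat}.
Implicit Types (U : set 'rV[R[i]^o]_n) (u : 'rV[R[i]^o]_n -> R).

Lemma locally_harmonic_pluriharmonic U u : open U -> locally_harmonic U u ->
  pluriharmonic_on U u.
Proof.
move=> oU uH; split=> [|a b]; first exact: locally_harmonic_Ck.
have lH : locally_harmonic (line a b @^-1` U) (u \o line a b).
  exact: locally_harmonic_line.
split=> [|z Uz]; first exact: locally_harmonic_Ck.
have := locally_harmonic_second (1 : R[i]^o) (@open_line_preimage _ _ _ a b oU) lH Uz.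
rewrite /laplacian.
have -> : 'i *: (1 : R[i]^o) = 'i by rewrite /GRing.scale /= mulr1.
by [].
Qed.

Lemma harmonic_visc (U : set R[i]^o) (g : R[i]^o -> R) (k : R[i]) (sg : R) :
  open U -> harmonic_on U g -> U k -> visc_at (fun w => (sg * g w)%:E) k.
Proof.
move=> oU [C2 lap] Uk; have [d d0 dU] := open_nrmP oU Uk.
have := @harmonic_no_touch R R[i]^o U g k 1 sg d d0 dU C2.
have -> : 'i *: (1 : R[i]^o) = 'i by rewrite /GRing.scale /= mulr1.
move=> /(_ (lap k Uk)) H B C e r e0 r0 _ T.
apply: (H B C e r e0 r0) => // h hr; have := T h hr.
rewrite add0r scale0r addr0.
by have -> : h *: (1 : R[i]^o) = h by rewrite /GRing.scale /= mulr1.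
Qed.

End Pluriharmonic.

(** * Integrals of continuous functions over intervals *)

Section IntervalIntegrals.
Context {R : realType}.
Implicit Types (f g : R -> R) (a b m C : R).

Local Notation mu := (@lebesgue_measure R).

Definition itv_integral a b f : R := \int[mu]_(t in `[a, b]%classic) f t.

Definition continuous_on a b f := forall t, a <= t <= b -> {for t, continuous f}.

Lemma continuous_on_integrable a b f : continuous_on a b f ->
  mu.-integrable `[a, b] (EFin \o f).
Proof.
move=> cf; apply: continuous_compact_integrable; first exact: segment_compact.
apply: continuous_in_subspaceT => t /set_mem /=; rewrite in_itv /=; exact: cf.
Qed.

Lemma continuous_onS a b a' b' f : a <= a' -> b' <= b -> continuous_on a b f ->
  continuous_on a' b' f.
Proof. by move=> aa bb cf t /andP[a't tb']; apply: cf; lra. Qed.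

Lemma continuous_onB a b f g : continuous_on a b f -> continuous_on a b g ->
  continuous_on a b (fun t => f t - g t).
Proof. by move=> cf cg t tab; apply: cvgB; [exact: cf|exact: cg]. Qed.

Lemma itv_integral_split a m b f : a <= m -> m <= b -> continuous_on a b f ->
  itv_integral a b f = itv_integral a m f + itv_integral m b f.
Proof.
move=> am mb cf; have If := continuous_on_integrable cf.
have := Rintegral_itvB If (_ : (BLeft a <= BRight m)%O) (_ : (BRight m <= BRight b)%O).
rewrite !bnd_simp => /(_ am mb).
rewrite Rintegral_itv_obnd_cbnd => [E|].
  by rewrite /itv_integral -E addrC subrK.
apply: integrableS (continuous_on_integrable (continuous_onS am (lexx b) cf)) => //.
exact: subset_itv_oc_cc.
Qed.

Lemma itv_integralB a b f g : continuous_on a b f -> continuous_on a b g ->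
  itv_integral a b (fun t => f t - g t) = itv_integral a b f - itv_integral a b g.
Proof.
move=> /continuous_on_integrable cf /continuous_on_integrable cg.
exact: RintegralB.
Qed.

Lemma itv_integral_cst a b C : a <= b -> itv_integral a b (fun=> C) = C * (b - a).
Proof.
move=> ab; transitivity (C * fine (mu `[a, b]%classic)).
  by rewrite /itv_integral Rintegral_cst.
rewrite lebesgue_measure_itv /= lte_fin.
case: ltP => [//|ba]; have -> : b = a by apply/eqP; rewrite eq_le ab ba.
by rewrite subrr.
Qed.

Lemma itv_integral_le a b f g : continuous_on a b f -> continuous_on a b g ->
  (forall t, a <= t <= b -> f t <= g t) -> itv_integral a b f <= itv_integral a b g.
Proof.
move=> /continuous_on_integrable cf /continuous_on_integrable cg fg.
by apply: le_Rintegral => // t /=; rewrite in_itv /=; exact: fg.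
Qed.

Lemma itv_integral_near_cst a b f (A C : R) : a <= b -> continuous_on a b f ->
  (forall t, a <= t <= b -> `|f t - A| <= C) ->
  `|itv_integral a b f - A * (b - a)| <= C * (b - a).
Proof.
move=> ab cf fC.
have cc D : continuous_on a b (fun=> D : R) by move=> t _; exact: cst_continuous.
have h1 := itv_integral_le cf (cc (A + C)) _; have h2 := itv_integral_le (cc (A - C)) cf _.
rewrite !itv_integral_cst// in h1 h2.
have {}h1 : itv_integral a b f <= (A + C) * (b - a).
  by apply: h1 => t /fC; rewrite ler_norml; lra.
have {}h2 : (A - C) * (b - a) <= itv_integral a b f.
  by apply: h2 => t /fC; rewrite ler_norml; lra.
rewrite ler_norml; lra.
Qed.

End IntervalIntegrals.

(** * Goursat's theorem on rectangles *)

Section Goursat.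
Context {R : realType}.

(* Real form of complex differentiability of u + i v at the point s + i t. *)
Definition cauchy_riemann_at (u v : R -> R -> R) (s t : R) := exists A B : R,
  forall e : R, 0 < e -> exists2 d : R, 0 < d & forall x y : R, `|x| < d -> `|y| < d ->
    `|u (s + x) (t + y) - u s t - (A * x - B * y)| <= e * (`|x| + `|y|) /\
    `|v (s + x) (t + y) - v s t - (B * x + A * y)| <= e * (`|x| + `|y|).

Lemma continuous_of_linear_bound (f : R -> R) (t : R) (A : R) :
  (exists2 d : R, 0 < d & forall x : R, `|x| < d -> `|f (t + x) - f t - A * x| <= `|x|) ->
  {for t, continuous f}.
Proof.
case=> d d0 H; apply/cvgrPdist_lt => e e0.
have A1 : 0 < `|A| + 1 by rewrite ltr_wpDl.
have nearD x : 0 < x -> \forall s \near t, `|t - s| < x.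
  by move=> x0; have := nbhsx_ballx t x x0; rewrite -ball_normE.
near=> s.
have sd : `|s - t| < d by rewrite distrC; near: s; exact: nearD.
have se : `|s - t| < e / (`|A| + 1).
  by rewrite distrC; near: s; apply: nearD; rewrite divr_gt0.
rewrite ltr_pdivlMr// in se.
have := H _ sd; rewrite [t + _]addrC subrK => Hs; rewrite distrC.
have As : `|A * (s - t)| <= `|A| * `|s - t| by rewrite normrM.
move: Hs As se; rewrite !ler_norml ltr_norml => /andP[h1 h2] /andP[h3 h4] h5.
by apply/andP; split; lra.
Unshelve. all: by end_near. Qed.

Lemma cauchy_riemann_slices u v s t : cauchy_riemann_at u v s t ->
  [/\ {for s, continuous (u^~ t)}, {for t, continuous (u s)},
      {for s, continuous (v^~ t)} & {for t, continuous (v s)}].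
Proof.
case=> A [B /(_ 1 ltr01)[d d0 H]].
have z0 : `|0 : R| < d by rewrite normr0.
split.
- apply: (@continuous_of_linear_bound _ s A); exists d => // x xd.
  have [+ _] := H x 0 xd z0; by rewrite addr0 mulr0 subr0 normr0 addr0 mul1r.
- apply: (@continuous_of_linear_bound _ t (- B)); exists d => // x xd.
  have [+ _] := H 0 x z0 xd; by rewrite addr0 mulr0 sub0r normr0 add0r mul1r mulNr.
- apply: (@continuous_of_linear_bound _ s B); exists d => // x xd.
  have [_ +] := H x 0 xd z0; by rewrite addr0 mulr0 addr0 normr0 addr0 mul1r.
- apply: (@continuous_of_linear_bound _ t A); exists d => // x xd.
  have [_ +] := H 0 x z0 xd; by rewrite addr0 mulr0 add0r normr0 add0r mul1r.
Qed.

Implicit Types (u v : R -> R -> R) (a b c d s t : R).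

Definition cauchy_riemann_on u v a b c d :=
  forall s t, a <= s <= b -> c <= t <= d -> cauchy_riemann_at u v s t.

(* The imaginary part of the integral of u + i v along the boundary. *)
Definition flux u v a b c d : R :=
  itv_integral c d (fun t => u b t - u a t) - itv_integral a b (fun s => v s d - v s c).

Lemma cauchy_riemann_onS u v a b c d a' b' c' d' : a <= a' -> b' <= b -> c <= c' -> d' <= d ->
  cauchy_riemann_on u v a b c d -> cauchy_riemann_on u v a' b' c' d'.
Proof.
move=> aa bb cc dd CR s t /andP[s1 s2] /andP[t1 t2]; apply: CR; apply/andP; split.
- exact: le_trans aa s1.
- exact: le_trans s2 bb.
- exact: le_trans cc t1.
- exact: le_trans t2 dd.
Qed.

Lemma cauchy_riemann_cont_u u v a b c d s : cauchy_riemann_on u v a b c d ->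
  a <= s <= b -> continuous_on c d (u s).
Proof. by move=> CR sab t tcd; have [] := cauchy_riemann_slices (CR s t sab tcd). Qed.

Lemma cauchy_riemann_cont_v u v a b c d t : cauchy_riemann_on u v a b c d ->
  c <= t <= d -> continuous_on a b (v^~ t).
Proof. by move=> CR tcd s sab; have [] := cauchy_riemann_slices (CR s t sab tcd). Qed.

Lemma fluxE u v a b c d : cauchy_riemann_on u v a b c d -> a <= b -> c <= d ->
  flux u v a b c d = itv_integral c d (u b) - itv_integral c d (u a) -
    (itv_integral a b (v^~ d) - itv_integral a b (v^~ c)).
Proof.
move=> CR ab cd; have aI : a <= a <= b by rewrite lexx.
have bI : a <= b <= b by rewrite lexx ab.
have cI : c <= c <= d by rewrite lexx.
have dI : c <= d <= d by rewrite lexx cd.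
rewrite /flux; congr (_ - _); apply: itv_integralB.
- exact: cauchy_riemann_cont_u CR bI.
- exact: cauchy_riemann_cont_u CR aI.
- exact: cauchy_riemann_cont_v CR dI.
- exact: cauchy_riemann_cont_v CR cI.
Qed.

Lemma flux_split_s u v a m b c d : cauchy_riemann_on u v a b c d -> a <= m -> m <= b ->
  c <= d -> flux u v a b c d = flux u v a m c d + flux u v m b c d.
Proof.
move=> CR am mb cd.
have cI : c <= c <= d by rewrite lexx.
have dI : c <= d <= d by rewrite lexx cd.
rewrite !fluxE ?(le_trans am mb)//.
- rewrite (itv_integral_split am mb (cauchy_riemann_cont_v CR cI)).
  by rewrite (itv_integral_split am mb (cauchy_riemann_cont_v CR dI)); ring.
- exact: cauchy_riemann_onS am (lexx _) (lexx _) (lexx _) CR.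
- exact: cauchy_riemann_onS (lexx _) mb (lexx _) (lexx _) CR.
Qed.

Lemma flux_split_t u v a b c m d : cauchy_riemann_on u v a b c d -> a <= b ->
  c <= m -> m <= d -> flux u v a b c d = flux u v a b c m + flux u v a b m d.
Proof.
move=> CR ab cm md.
have aI : a <= a <= b by rewrite lexx.
have bI : a <= b <= b by rewrite lexx ab.
rewrite !fluxE ?(le_trans cm md)//.
- rewrite (itv_integral_split cm md (cauchy_riemann_cont_u CR aI)).
  by rewrite (itv_integral_split cm md (cauchy_riemann_cont_u CR bI)); ring.
- exact: cauchy_riemann_onS (lexx _) (lexx _) cm (lexx _) CR.
- exact: cauchy_riemann_onS (lexx _) (lexx _) (lexx _) md CR.
Qed.

(** The flux is additive over the four quarters, so one of them carries at least a quarter of it in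
    absolute value. *)
Lemma flux_quarter u v a c w h : cauchy_riemann_on u v a (a + w + w) c (c + h + h) ->
  0 <= w -> 0 <= h -> exists a' c', [/\ a <= a' <= a + w, c <= c' <= c + h &
    `|flux u v a (a + w + w) c (c + h + h)| <= 4 * `|flux u v a' (a' + w) c' (c' + h)|].
Proof.
move=> CR w0 h0; have aw : a <= a + w by rewrite lerDl.
have aww : a + w <= a + w + w by rewrite lerDl.
have ch : c <= c + h by rewrite lerDl.
have chh : c + h <= c + h + h by rewrite lerDl.
have aw2 := le_trans aw aww; have ch2 := le_trans ch chh.
have S : flux u v a (a + w + w) c (c + h + h) =
    flux u v a (a + w) c (c + h) + flux u v a (a + w) (c + h) (c + h + h) +
    (flux u v (a + w) (a + w + w) c (c + h) + flux u v (a + w) (a + w + w) (c + h) (c + h + h)).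
  rewrite (flux_split_s CR aw aww ch2); congr (_ + _); apply: flux_split_t => //.
    exact: cauchy_riemann_onS CR.
  exact: cauchy_riemann_onS CR.
apply: contrapT => H.
have N a' c' : a <= a' <= a + w -> c <= c' <= c + h ->
    4 * `|flux u v a' (a' + w) c' (c' + h)| < `|flux u v a (a + w + w) c (c + h + h)|.
  by move=> p1 p2; rewrite ltNge; apply/negP => p6; apply: H; exists a', c'.
have N1 : 4 * `|flux u v a (a + w) c (c + h)| < `|flux u v a (a + w + w) c (c + h + h)|.
  by apply: N; rewrite lexx.
have N2 : 4 * `|flux u v a (a + w) (c + h) (c + h + h)| < `|flux u v a (a + w + w) c (c + h + h)|.
  by apply: N; rewrite lexx ?andbT.
have N3 : 4 * `|flux u v (a + w) (a + w + w) c (c + h)| < `|flux u v a (a + w + w) c (c + h + h)|.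
  by apply: N; rewrite lexx ?andbT.
have N4 : 4 * `|flux u v (a + w) (a + w + w) (c + h) (c + h + h)| < `|flux u v a (a + w + w) c (c + h + h)|.
  by apply: N; rewrite lexx ?andbT.
move: S N1 N2 N3 N4; move: (flux u v a (a + w + w) _ _) (flux u v a (a + w) c _)
  (flux u v a (a + w) (c + h) _) (flux u v (a + w) _ c _) (flux u v (a + w) _ (c + h) _).
clear => f f1 f2 f3 f4 ->.
have := ler_normD (f1 + f2) (f3 + f4); have := ler_normD f1 f2; have := ler_normD f3 f4; lra.
Qed.

(** The affine parts of u and v contribute A (b - a)(d - c) to both integrals and cancel; the shared
    coefficient A is the Cauchy-Riemann relation. Each integrand is a difference of two values,
    whence the factor 2. *)
Lemma flux_small u v a b c d s t (A B e : R) : cauchy_riemann_on u v a b c d ->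
  a <= s <= b -> c <= t <= d ->
  (forall s' t', a <= s' <= b -> c <= t' <= d ->
    `|u s' t' - u s t - (A * (s' - s) - B * (t' - t))| <= e /\
    `|v s' t' - v s t - (B * (s' - s) + A * (t' - t))| <= e) ->
  `|flux u v a b c d| <= 2 * e * ((b - a) + (d - c)).
Proof.
move=> CR sab tcd H.
have ab : a <= b by case/andP: sab; exact: le_trans.
have cd : c <= d by case/andP: tcd; exact: le_trans.
have [aI bI] : a <= a <= b /\ a <= b <= b by rewrite !lexx ab.
have [cI dI] : c <= c <= d /\ c <= d <= d by rewrite !lexx cd.
have U : `|itv_integral c d (fun t => u b t - u a t) - A * (b - a) * (d - c)| <= 2 * e * (d - c).
  apply: itv_integral_near_cst => //.
    by apply: continuous_onB; [exact: cauchy_riemann_cont_u CR bI|exact: cauchy_riemann_cont_u CR aI].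
  move=> t' t'cd; have [+ _] := H b t' bI t'cd; have [+ _] := H a t' aI t'cd.
  rewrite !ler_norml; clear; lra.
have W : `|itv_integral a b (fun s => v s d - v s c) - A * (d - c) * (b - a)| <= 2 * e * (b - a).
  apply: itv_integral_near_cst => //.
    by apply: continuous_onB; [exact: cauchy_riemann_cont_v CR dI|exact: cauchy_riemann_cont_v CR cI].
  move=> s' s'ab; have [_ +] := H s' d s'ab dI; have [_ +] := H s' c s'ab cI.
  rewrite !ler_norml; clear; lra.
move: U W; rewrite /flux; move: (itv_integral _ _ _) (itv_integral _ _ _) => X Y.
rewrite !ler_norml; clear; lra.
Qed.

(** After n quarterings the flux has lost at most the factor 4^n. With L the sum of the side
    lengths, differentiability at the common point of the nested rectangles bounds the n-th flux by
    2 e' (L / 2^n)^2, so the original flux is at most 2 e' L^2 for every e' > 0. *)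
Lemma goursat_rectangle u v a0 b0 c0 d0 : a0 <= b0 -> c0 <= d0 ->
  cauchy_riemann_on u v a0 b0 c0 d0 ->
  itv_integral c0 d0 (fun t => u b0 t - u a0 t) = itv_integral a0 b0 (fun s => v s d0 - v s c0).
Proof.
move=> ab0 cd0 CR.
apply/eqP; rewrite -subr_eq0 -/(flux u v a0 b0 c0 d0) -normr_eq0 eq_le normr_ge0 andbT.
pose w n := (b0 - a0) / 2 ^+ n; pose h n := (d0 - c0) / 2 ^+ n.
have w0 n : 0 <= w n by rewrite divr_ge0 ?exprn_ge0// subr_ge0.
have h0 n : 0 <= h n by rewrite divr_ge0 ?exprn_ge0// subr_ge0.
have wS n : w n = w n.+1 + w n.+1 by rewrite /w exprSr invfM; field; rewrite expf_neq0.
have hS n : h n = h n.+1 + h n.+1 by rewrite /h exprSr invfM; field; rewrite expf_neq0.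
pose T n (p : R * R) := cauchy_riemann_on u v p.1 (p.1 + w n) p.2 (p.2 + h n).
(* The hypothesis T stands under the existential so that choice yields a total function of the
   corner; where T fails the value is irrelevant. *)
have step n (p : R * R) : exists q : R * R, T n p ->
    [/\ p.1 <= q.1 /\ q.1 + w n.+1 <= p.1 + w n, p.2 <= q.2 /\ q.2 + h n.+1 <= p.2 + h n, T n.+1 q
     & `|flux u v p.1 (p.1 + w n) p.2 (p.2 + h n)| <=
       4 * `|flux u v q.1 (q.1 + w n.+1) q.2 (q.2 + h n.+1)|].
  have [Tp|] := pselect (T n p); last by exists p.
  move: (Tp); rewrite /T wS hS !addrA => CRp.
  have [a' [c' [/andP[a1 a2] /andP[c1 c2] F]]] := flux_quarter CRp (w0 n.+1) (h0 n.+1).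
  have a3 : a' + w n.+1 <= p.1 + w n.+1 + w n.+1 by rewrite lerD2r.
  have c3 : c' + h n.+1 <= p.2 + h n.+1 + h n.+1 by rewrite lerD2r.
  by exists (a', c') => _; split => //=; apply: cauchy_riemann_onS CRp.
have /choice[F FP] n : exists f : R * R -> R * R, forall p, T n p ->
    [/\ p.1 <= (f p).1 /\ (f p).1 + w n.+1 <= p.1 + w n,
        p.2 <= (f p).2 /\ (f p).2 + h n.+1 <= p.2 + h n, T n.+1 (f p)
     & `|flux u v p.1 (p.1 + w n) p.2 (p.2 + h n)| <=
       4 * `|flux u v (f p).1 ((f p).1 + w n.+1) (f p).2 ((f p).2 + h n.+1)|].
  by have /choice[f fP] := step n; exists f.
pose q := fix q n := if n is n'.+1 then F n' (q n') else (a0, c0).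
have wh0 : a0 + w 0%N = b0 /\ c0 + h 0%N = d0.
  by rewrite /w /h expr0 !divr1 [a0 + _]addrC [c0 + _]addrC !subrK.
have T0 : T 0%N (q 0%N) by rewrite /T /= wh0.1 wh0.2.
have Tq n : T n (q n) by elim: n => // n IH; have [] := FP n _ IH.
have flux4 n : `|flux u v a0 b0 c0 d0| <= 4 ^+ n *
    `|flux u v (q n).1 ((q n).1 + w n) (q n).2 ((q n).2 + h n)|.
  elim: n => [|n IH]; first by rewrite /= wh0.1 wh0.2 expr0 mul1r.
  apply: le_trans IH _; rewrite exprSr -mulrA ler_wpM2l ?exprn_ge0//.
  by have [] := FP n _ (Tq n).
have mono n m : (n <= m)%N -> [/\ (q n).1 <= (q m).1, (q n).2 <= (q m).2,
    (q m).1 + w m <= (q n).1 + w n & (q m).2 + h m <= (q n).2 + h n].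
  elim: m => [|m IH]; first by rewrite leqn0 => /eqP ->.
  rewrite leq_eqVlt => /orP[/eqP -> //|]; rewrite ltnS => /IH[i1 i2 i3 i4].
  by have [[j1 j3] [j2 j4] _ _] := FP m _ (Tq m); split; [exact: le_trans i1 j1|
    exact: le_trans i2 j2|exact: le_trans j3 i3|exact: le_trans j4 i4].
have lim (x : nat -> R) (y : nat -> R) : (forall n, 0 <= y n) ->
    (forall n m, (n <= m)%N -> x n <= x m /\ x m + y m <= x n + y n) ->
    exists l, forall n, x n <= l <= x n + y n.
  move=> y0 xy.
  have ub n : ubound (range x) (x n + y n).
    move=> _ [m _ <-]; have y0m := y0 m; have y0n := y0 n.
    case: (leqP n m) => [|/ltnW] /xy[]; lra.
  have hs : has_sup (range x) by split; [exists (x 0%N), 0%N|exists (x 0%N + y 0%N); exact: ub].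
  exists (sup (range x)) => n; apply/andP; split.
    exact: (sup_upper_bound hs (imageT x n)).
  exact: (ge_sup hs.1 (ub n)).
have [|s sP] := lim (fun n => (q n).1) w w0; first by move=> n m /mono[].
have [|t tP] := lim (fun n => (q n).2) h h0; first by move=> n m /mono[].
have s0 : a0 <= s <= b0.
  by have := sP 0%N; rewrite /= wh0.1.
have t0 : c0 <= t <= d0.
  by have := tP 0%N; rewrite /= wh0.2.
have [A [B AB]] := CR s t s0 t0.
pose L := (b0 - a0) + (d0 - c0); have L0 : 0 <= L by rewrite addr_ge0 ?subr_ge0.
apply/ler_addgt0Pr => e e0; rewrite add0r.
have K0 : 0 < 2 * L ^+ 2 + 1 by rewrite ltr_wpDl// mulr_ge0// exprn_ge0.
have [d dd0 H] := AB _ (divr_gt0 e0 K0).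
set e' := e / _ in H; have e'0 : 0 < e' by exact: divr_gt0.
have [n nd] : exists n, L / 2 ^+ n < d.
  exists (Num.truncn (L / d)).+1; rewrite ltr_pdivrMr ?exprn_gt0// mulrC -ltr_pdivrMr//.
  apply: lt_trans (truncnS_gt _) _.
  by rewrite -natrX ltr_nat; exact: ltn_expl.
have wh : w n + h n = L / 2 ^+ n by rewrite /w /h /L; ring.
have := @flux_small u v (q n).1 ((q n).1 + w n) (q n).2 ((q n).2 + h n) s t A B
  (e' * (w n + h n)) (Tq n) (sP n) (tP n) _.
rewrite [(q n).1 + _]addrC [(q n).2 + _]addrC !addrK ![w n + (q n).1]addrC ![h n + (q n).2]addrC.
move=> FS.
have {FS}HF : `|flux u v (q n).1 ((q n).1 + w n) (q n).2 ((q n).2 + h n)| <=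
    2 * (e' * (w n + h n)) * (w n + h n).
  apply: FS => s' t' s'I t'I.
  have sI := sP n; have tI := tP n.
  have xs : `|s' - s| <= w n by rewrite ler_norml; lra.
  have yt : `|t' - t| <= h n by rewrite ler_norml; lra.
  have w0n := w0 n; have h0n := h0 n.
  have wd : w n < d by apply: le_lt_trans nd; rewrite -wh lerDl.
  have hd : h n < d by apply: le_lt_trans nd; rewrite -wh lerDr.
  have [||] := H (s' - s) (t' - t); [exact: le_lt_trans xs wd|exact: le_lt_trans yt hd|].
  rewrite [s + _]addrC [t + _]addrC !subrK => H1 H2.
  by split; [apply: le_trans H1 _|apply: le_trans H2 _]; rewrite ler_wpM2l ?(ltW e'0)// lerD.
have P4 : (4 : R) ^+ n * (L / 2 ^+ n) ^+ 2 = L ^+ 2.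
  have -> : (4 : R) = 2 ^+ 2 by rewrite -natrX.
  by rewrite -exprM mulnC exprM -exprMn mulrC divfK// expf_neq0.
apply: le_trans (flux4 n) _.
apply: (@le_trans _ _ (4 ^+ n * (2 * e' * (L / 2 ^+ n) ^+ 2))).
  rewrite ler_wpM2l ?exprn_ge0//; apply: le_trans HF _.
  by rewrite wh expr2 !mulrA.
have -> : 4 ^+ n * (2 * e' * (L / 2 ^+ n) ^+ 2) = e' * (2 * L ^+ 2).
  by rewrite -P4; ring.
have e'e : e' * (2 * L ^+ 2 + 1) = e by rewrite /e' divfK// gt_eqF.
by rewrite -e'e ler_wpM2l ?(ltW e'0)// lerDl.
Qed.

End Goursat.

(** * Real parts of complex differentiable functions cannot be touched *)

Section ComplexDifferentiable.
Context {R : realType}.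
Implicit Types (g : R[i] -> R[i]) (z h : R[i]).

Definition has_cderive g z (D : R[i]) := forall e : R, 0 < e -> exists2 d : R, 0 < d &
  forall h, normc h < d -> normc (g (z + h) - g z - D * h) <= e * normc h.

Definition cdiff_at g z := exists D, has_cderive g z D.

Lemma has_cderive_scale (G : R[i] -> R[i]) z (D a : R[i]) : has_cderive G z D ->
  has_cderive (fun w => a * G w) z (a * D).
Proof.
move=> HD e e0; have a1 : 0 < normc a + 1 by rewrite ltr_wpDl// normc_ge0.
have [d d0 Hd] := HD _ (divr_gt0 e0 a1).
exists d => // k kd; rewrite -mulrA -!mulrBr normcM.
apply: le_trans (ler_wpM2l (normc_ge0 _) (Hd k kd)) _.
rewrite mulrA ler_wpM2r ?normc_ge0// mulrA ler_pdivrMr// mulrC ler_wpM2l ?lerDl//.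
exact: ltW.
Qed.

Lemma cdiff_scale (a : R[i]) (G : R[i] -> R[i]) z : cdiff_at G z -> cdiff_at (fun w => a * G w) z.
Proof. by move=> [D HD]; exists (a * D); exact: has_cderive_scale HD. Qed.

Lemma cdiff_shift (G : R[i] -> R[i]) k h : cdiff_at G (k + h) -> cdiff_at (fun w => G (k + w)) h.
Proof. by move=> [D HD]; exists D => e /HD[d d0 H]; exists d => // t; rewrite addrA; exact: H. Qed.

(** First-order expansion of exp(x + iy) at 0, the derivative of the log-polar coordinates that turn
    an annulus into a rectangle. *)
Lemma exponential_expansion (e : R) : 0 < e -> exists2 d : R, 0 < d & forall x y : R,
  `|x| < d -> `|y| < d -> normc ((expR x)%:C * cis y - 1 - (x +i* y)) <= e * (`|x| + `|y|).
Proof.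
(* The errors add up to e1 |x| + 8 e1 |y|: three from the cosine, three from the sine and two from
   the product (x + p) y. *)
move=> e0; pose e1 := Num.min 1 (e / 8).
have e10 : 0 < e1 by rewrite lt_min ltr01 divr_gt0.
have e11 : e1 <= 1 by rewrite ge_min lexx.
have e1e : 8 * e1 <= e.
  have : e1 <= e / 8 by rewrite ge_min lexx orbT.
  clear; lra.
clearbody e1.
have [d1 d10 H1] := is_derive_small (is_derive_expR (0 : R)) e10.
have [d2 d20 H2] := is_derive_small (is_derive_cos (0 : R)) e10.
have [d3 d30 H3] := is_derive_small (is_derive_sin (0 : R)) e10.
exists (Num.min e1 (Num.min d1 (Num.min d2 d3))); first by rewrite !lt_min e10 d10 d20.
move=> x y; rewrite !lt_min => /and4P[xe x1 _ _] /and4P[ye _ y2 y3].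
have S1 := H1 x x1; have S2 := H2 y y2; have S3 := H3 y y3.
rewrite expR0 mulr1 in S1; rewrite cos0 sin0 oppr0 mulr0 subr0 in S2.
rewrite sin0 cos0 mulr1 subr0 in S3.
apply: le_trans (normc_le_ReIm _) _; rewrite !(cReB, cImB, cReM, cImM) /=.
set p := expR x - 1 - x in S1; set q := cos y - 1 in S2; set w := sin y - y in S3.
have -> : expR x * cos y - 0 * sin y - 1 - x = p + q * (1 + x + p) by rewrite /p /q; ring.
have -> : expR x * sin y + 0 * cos y - 0 - y = (x + p) * y + w * (1 + x + p).
  by rewrite /p /w; ring.
have nx := normr_ge0 x; have ny := normr_ge0 y.
have px : `|p| <= `|x| by apply: le_trans S1 _; rewrite ler_piMl.
have xp : `|x + p| <= 2 * e1.
  by apply: le_trans (ler_normD _ _) _; move: xe px; clear; lra.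
have xp1 : `|1 + x + p| <= 3.
  rewrite -addrA; apply: le_trans (ler_normD _ _) _; rewrite normr1; move: xp e11; clear; lra.
have T1 : `|q * (1 + x + p)| <= 3 * (e1 * `|y|).
  by rewrite normrM [leRHS]mulrC; apply: ler_pM.
have T2 : `|w * (1 + x + p)| <= 3 * (e1 * `|y|).
  by rewrite normrM [leRHS]mulrC; apply: ler_pM.
have T3 : `|(x + p) * y| <= 2 * e1 * `|y| by rewrite normrM ler_wpM2r.
have := ler_normD p (q * (1 + x + p)); have := ler_normD ((x + p) * y) (w * (1 + x + p)).
have : 8 * e1 * (`|x| + `|y|) <= e * (`|x| + `|y|) by rewrite ler_wpM2r// addr_ge0.
move: S1 T1 T2 T3; rewrite !mulrDr -mulrA.
have := mulr_ge0 (ltW e10) nx; rewrite -!mulrA.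
move: (e1 * `|x|) (e1 * `|y|) (e * `|x|) (e * `|y|) => X Y X' Y'; clear; lra.
Qed.

(** Subtracting the touching jet leaves G with G 0 = 0 and Re G <= -e |z|^2 near 0. In log-polar
    coordinates the sides t = 0 and t = 2 pi carry equal values, so Goursat's theorem equates the
    integrals of Re G over two concentric circles. On the outer one the integrand is at most -e r^2,
    on a small inner one it exceeds half of that. *)
Lemma cdiff_visc g (r0 : R) : 0 < r0 -> (forall z, normc z < r0 -> cdiff_at g z) ->
  visc_at (fun w => (Re (g w))%:E) 0.
Proof.
move=> r00 gd B C e d e0 d0 _ H.
pose G z := g z - g 0 - (B * z + C * z ^+ 2).
have G0 : G 0 = 0 by rewrite /G expr0n /= !mulr0 addr0 subrr subr0.
pose r := Num.min d r0 / 2.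
have m0 : 0 < Num.min d r0 by rewrite lt_min d0.
have rr0 : 0 < r by exact: divr_gt0.
have rm : r < Num.min d r0 by rewrite /r gtr_pMr// invf_lt1// ltr1n.
have [rd rr] : r < d /\ r < r0 by move: rm; rewrite lt_min => /andP.
have Gneg z : normc z <= r -> Re (G z) <= - (e * normc z ^+ 2).
  move=> zr; have := H z (le_lt_trans zr rd).
  rewrite add0r -EFinD lee_fin /G !cReB; clear; lra.
have Gd z : normc z <= r -> cdiff_at G z.
  move=> zr; have [D HD] := gd z (le_lt_trans zr rr).
  exists (D - B - C * z *+ 2) => s s0.
  have [d1 d10 D1] := HD _ (divr_gt0 s0 (ltr0n R 2)).
  have C1 : 0 < normc C + 1 by rewrite ltr_wpDl// normc_ge0.
  exists (Num.min d1 (s / 2 / (normc C + 1))); first by rewrite lt_min d10 !divr_gt0.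
  move=> h; rewrite lt_min => /andP[hd hC].
  have -> : G (z + h) - G z - (D - B - C * z *+ 2) * h = (g (z + h) - g z - D * h) - C * h ^+ 2.
    by rewrite /G; ring.
  apply: le_trans (normcBD _ _) _; rewrite normcM normcX.
  rewrite ltr_pdivlMr// in hC; have := D1 h hd; have := normc_ge0 h; have := normc_ge0 C.
  have := ler_wpM2l (normc_ge0 h) (ltW hC).
  move: (normc h) (normc C) (normc _) => x c y; clear; rewrite expr2; nra.
(* The exponential exp(s + it). Only its addition law and its expansion at 0 are used to derive the
   Cauchy-Riemann condition for G composed with E. *)
pose E (s t : R) : R[i] := (expR s)%:C * cis t.
have nE s t : normc (E s t) = expR s.
  by rewrite normcM normc_cis mulr1 normcR gtr0_norm// expR_gt0.
have ED s t x y : E (s + x) (t + y) = E s t * E x y.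
  by rewrite /E expRD cisD realcM; ring.
have lnr (q : R) : 0 < q -> expR (ln q) = q by move=> q0; rewrite lnK// posrE.
pose u (s t : R) := Re (G (E s t)); pose v (s t : R) := Im (G (E s t)).
pose b := ln r; have eb : expR b = r by exact: lnr.
have CR a : cauchy_riemann_on u v a b 0 (2 * pi).
  move=> s t /andP[_ sb] _; set z := E s t.
  have zr : normc z <= r by rewrite nE -eb ler_expR.
  have [D HD] := Gd z zr.
  exists (Re (D * z)), (Im (D * z)) => q q0.
  have nz := normc_ge0 z; have nDz := normc_ge0 (D * z).
  have q20 : 0 < Num.min 1 (q / 2 / (normc (D * z) + 1)).
    by rewrite lt_min ltr01 !divr_gt0// ltr_wpDl.
  have [d2 d20 H2] := exponential_expansion q20.
  set q2 := Num.min 1 _ in q20 H2.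
  have q21 : q2 <= 1 by rewrite ge_min lexx.
  have q2q : q2 * (normc (D * z) + 1) <= q / 2.
    by rewrite -ler_pdivlMr ?ltr_wpDl// ge_min lexx orbT.
  have z1 : 0 < 4 * (normc z + 1) by rewrite mulr_gt0// ltr_wpDl.
  have q10 : 0 < q / (4 * (normc z + 1)) by exact: divr_gt0.
  have [d1 d10 H1] := HD _ q10.
  set q1 := q / _ in q10 H1.
  have q1q : q1 * (4 * (normc z + 1)) = q by rewrite /q1 divfK// gt_eqF.
  exists (Num.min d2 (d1 / (4 * (normc z + 1)))); first by rewrite lt_min d20 divr_gt0.
  move=> x y; rewrite !lt_min => /andP[x2 x1] /andP[y2 y1].
  rewrite ltr_pdivlMr// in x1; rewrite ltr_pdivlMr// in y1.
  set k := z * (E x y - 1).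
  have Ek : E (s + x) (t + y) = z + k by rewrite ED -/z /k mulrBr mulr1 addrC subrK.
  have X2 := H2 x y x2 y2; rewrite -/(E x y) in X2.
  set ro := E x y - 1 - (x +i* y) in X2.
  have kE : k = z * (x +i* y) + z * ro by rewrite /k /ro; ring.
  have nxy : normc (x +i* y) <= `|x| + `|y| by exact: normc_le_ReIm.
  have nx := normr_ge0 x; have ny := normr_ge0 y.
  have xy0 : 0 <= `|x| + `|y| by rewrite addr_ge0.
  have nk : normc k <= 2 * normc z * (`|x| + `|y|).
    rewrite kE; apply: le_trans (normcD _ _) _; rewrite !(normcM z).
    have : q2 * (`|x| + `|y|) <= 1 * (`|x| + `|y|) by rewrite ler_wpM2r.
    have := ler_wpM2l nz nxy; have := ler_wpM2l nz X2.
    move: (normc (x +i* y)) (normc ro) => U W.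
    move=> h1 h2 h3; have := ler_wpM2l nz h3; move: h1 h2; clear; lra.
  have kd : normc k < d1.
    apply: le_lt_trans nk _; move: x1 y1 nz nx ny; clear; nra.
  have N : normc (G (z + k) - G z - D * z * (x +i* y)) <= q * (`|x| + `|y|).
    have -> : G (z + k) - G z - D * z * (x +i* y) = (G (z + k) - G z - D * k) + D * z * ro.
      by rewrite kE; ring.
    apply: le_trans (normcD _ _) _; rewrite (normcM (D * z)).
    have h1 := le_trans (H1 k kd) (ler_wpM2l (ltW q10) nk).
    have h2 := ler_wpM2l nDz X2.
    have h3 := ler_wpM2r xy0 q2q.
    have h4 : 0 <= q2 * (`|x| + `|y|) by rewrite mulr_ge0// ltW.
    have h5 : q1 * (2 * normc z * (`|x| + `|y|)) <= q / 2 * (`|x| + `|y|).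
      rewrite -q1q; have : 0 <= q1 * (`|x| + `|y|) by rewrite mulr_ge0// ltW.
      clear; lra.
    move: h1 h2 h3 h4 h5; clear; lra.
  rewrite /u /v Ek -!cReB -!cImB; split.
    have := le_trans (normc_Re _) N.
    by rewrite (cReB _ (D * z * _)) (cReM (D * z)).
  have := le_trans (normc_Im _) N.
  by rewrite (cImB _ (D * z * _)) (cImM (D * z)) [Re (D * z) * _ + _]addrC.
pose kp := e * r ^+ 2; have kp0 : 0 < kp by rewrite mulr_gt0// exprn_gt0.
have [D0 /(_ 1 ltr01)[d1 d10 H1]] : cdiff_at G 0 by apply: Gd; rewrite normc0 ltW.
have D01 : 0 < normc D0 + 1 by rewrite ltr_wpDl// normc_ge0.
(* Inner radius on which |G| <= kp / 2, from G 0 = 0 and differentiability at 0 with error factor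
   1. *)
pose ro := Num.min (d1 / 2) (kp / 2 / (normc D0 + 1)).
have ro0 : 0 < ro by rewrite lt_min !divr_gt0.
have Gsmall h : normc h <= ro -> normc (G h) <= kp / 2.
  rewrite le_min => /andP[h1 h2].
  have hd : normc h < d1 by apply: le_lt_trans h1 _; rewrite gtr_pMr// invf_lt1// ltr1n.
  have := H1 h hd; rewrite add0r G0 subr0 mul1r => h3.
  rewrite ler_pdivlMr// in h2; apply: le_trans _ h2.
  rewrite -(subrK (D0 * h) (G h)); apply: le_trans (normcD _ _) _.
  by rewrite normcM mulrDr mulr1 addrC lerD// mulrC.
pose a := Num.min b (ln ro).
have ab : a <= b by rewrite ge_min lexx.
have ar : expR a <= ro by rewrite -(lnr _ ro0) ler_expR ge_min lexx orbT.
have tp0 : 0 < 2 * pi :> R by exact: two_pi_gt0.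
have := goursat_rectangle ab (ltW tp0) (CR a).
have -> : (fun s => v s (2 * pi) - v s 0) = (fun=> 0).
  by apply/funext => s; rewrite /v /E cis2pi cis0 subrr.
rewrite (itv_integral_cst 0 ab) mul0r => J0.
have bI : a <= b <= b by rewrite ab lexx.
have aI : a <= a <= b by rewrite lexx ab.
have cu : continuous_on 0 (2 * pi) (fun t => u b t - u a t).
  by apply: continuous_onB; [exact: cauchy_riemann_cont_u (CR a) bI|exact: cauchy_riemann_cont_u (CR a) aI].
have cc : continuous_on 0 (2 * pi) (fun=> - (kp / 2)).
  by move=> t _; exact: cst_continuous.
have := itv_integral_le cu cc _; rewrite J0 (itv_integral_cst _ (ltW tp0)) subr0.
have neg : - (kp / 2) * (2 * pi) < 0 by rewrite mulNr oppr_lt0 mulr_gt0// divr_gt0.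
rewrite leNgt neg => K; suff : false by [].
apply: K => t _.
have h1 : u b t <= - kp.
  have := Gneg (E b t); rewrite nE eb lexx => /(_ isT).
  by [].
have h2 : - (kp / 2) <= u a t.
  have : normc (G (E a t)) <= kp / 2 by apply: Gsmall; rewrite nE.
  move=> /(le_trans (normc_Re _)); rewrite ler_norml => /andP[]; by [].
move: h1 h2; clear; lra.
Qed.

Lemma cdiff_visc_at g z (r : R) : 0 < r -> (forall h, normc h < r -> cdiff_at g (z + h)) ->
  visc_at (fun w => (Re (g w))%:E) z /\ visc_at (fun w => (- Re (g w))%:E) z.
Proof.
move=> r0 gd.
have key (sg : R[i]) : visc_at (fun w => (Re (sg * g w))%:E) z.
  have gd' h : normc h < r -> cdiff_at (fun w => sg * g (z + w)) h.
    by move=> /gd gh; apply: cdiff_scale; exact: cdiff_shift.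
  move=> B C e d e0 d0 _ H; apply: (cdiff_visc r0 gd' (B := B) (C := C) e0 d0) => // h hd.
  by have := H h hd; rewrite add0r addr0.
split; first by have := key 1; congr (visc_at _ z); apply/funext => w; rewrite mul1r.
by have := key (-1); congr (visc_at _ z); apply/funext => w; rewrite mulN1r cReN.
Qed.

End ComplexDifferentiable.

(** * Second-order jets of complex differentiable functions *)

Section HolomorphicJets.
Context {R : realType}.
Implicit Types (G : R[i] -> R[i]) (h t z D : R[i]).

Lemma has_cderive_continuous G z D : has_cderive G z D ->
  {for z, continuous (G : R[i]^o -> R[i]^o)}.
Proof.
move=> HD; apply/continuous_cnrmP => e e0.
have [d d0 Hd] := HD 1 ltr01.
have D2 : 0 < normc D + 2 by rewrite ltr_wpDl// normc_ge0.
exists (Num.min d (e / (normc D + 2))); first by rewrite lt_min d0 divr_gt0.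
move=> y; rewrite !nrm_normc lt_min ltr_pdivlMr// => /andP[/Hd].
rewrite [z + _]addrC subrK mul1r => H1; apply: le_lt_trans.
rewrite -(subrK (D * (y - z)) (G y - G z)).
apply: le_trans (normcD _ _) _; rewrite normcM.
move: H1 (normc_ge0 (y - z)); move: (normc _) (normc D) (normc _) => a b c; clear; lra.
Qed.

(** Tested on a small positive multiple of the conjugate of A, where Re(A h) = |A| |h|, with e = |A|
    / 2. *)
Lemma linear_form_eq0 (A : R[i]) : (forall e : R, 0 < e -> exists2 d : R, 0 < d &
  forall h, normc h < d -> `|Re (A * h)| <= e * normc h) -> A = 0.
Proof.
move=> H; apply: contrapT => /eqP A0.
have nA : 0 < normc A.
  by rewrite lt_neqAle normc_ge0 andbT eq_sym; apply: contra A0 => /eqP/normc_eq0 ->.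
have [d d0 Hd] := H _ (divr_gt0 nA (ltr0n R 2)).
pose s := d / 2 / normc A; have s0 : 0 < s by rewrite !divr_gt0.
have nh : normc (s%:C * conjc A) = d / 2.
  by rewrite normcM normcJ normcR gtr0_norm// /s divfK// gt_eqF.
have := Hd (s%:C * conjc A); rewrite nh ltr_pdivrMr// ltr_pMr// ltr1n => /(_ isT).
have -> : A * (s%:C * conjc A) = (s * normc A ^+ 2)%:C.
  by rewrite mulrCA mulcJ -realcM.
rewrite /= ger0_norm; last by rewrite mulr_ge0 ?sqr_ge0// ltW.
have -> : s * normc A ^+ 2 = d / 2 * normc A.
  by rewrite /s expr2 mulrA divfK// gt_eqF.
by rewrite mulrC ler_pM2r ?divr_gt0// ler_pdivlMr// ger_pMr// lern1.
Qed.

Lemma approximable_bounded (g : R[i] -> R) : approximable g ->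
  exists m : R, forall h, normc h <= 1 -> `|g h| <= m.
Proof.
move=> /(_ 1 ltr01)[p Hp]; exists (1 + \sum_(k < size p) normc p`_k) => h h1.
rewrite -[g h](subrK (Re p.[h])); apply: le_trans (ler_normD _ _) _.
apply: lerD (Hp h h1) _; apply: le_trans (normc_Re _) _; rewrite horner_coef.
apply: le_trans (normc_sum _ _ _) _; apply: ler_sum => k _.
by rewrite normcM normcX ler_piMr ?normc_ge0// exprn_ile1 ?normc_ge0.
Qed.

(** On a rescaled disc neither Re G nor -Re G can be touched, so Re G is approximable and has a jet
    with cubic remainder. Its linear coefficient agrees with D because both describe Re G to first
    order. *)
Lemma cdiff_jet G D (r : R) : 0 < r -> (forall h, normc h < r -> cdiff_at G h) ->
  has_cderive G 0 D -> exists C, exists K : R, exists2 d : R, 0 <= K /\ 0 < d &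
    forall t, normc t < d -> `|Re (G t - G 0 - D * t - C * t ^+ 2)| <= K * normc t ^+ 3.
Proof.
move=> r0 Gd GD; pose s := r / 2.
have s0 : 0 < s by exact: divr_gt0.
have sr (h : R[i]) : normc h <= 1 -> normc (s%:C * h) < r.
  move=> h1; rewrite normcM normcR gtr0_norm//.
  apply: (@le_lt_trans _ _ s); first by rewrite ger_pMr.
  by rewrite /s ltr_pdivrMr// ltr_pMr// ltr1n.
have sne : s%:C != 0 :> R[i] by rewrite -(rmorph0 (real_complex R)) (inj_eq (@complexI R)) gt_eqF.
pose Gs (h : R[i]) := G (s%:C * h).
have Gsd h : normc h <= 1 -> cdiff_at Gs h.
  move=> /sr/Gd[E HE]; exists (E * s%:C) => e e0.
  have [d d0 Hd] := HE _ (divr_gt0 e0 s0).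
  exists (d / s) => [|k]; first exact: divr_gt0.
  rewrite ltr_pdivlMr// => ks.
  have := Hd (s%:C * k); rewrite normcM normcR gtr0_norm// mulrC ks => /(_ isT).
  have -> : e / s * (normc k * s) = e * normc k.
    by rewrite [normc k * s]mulrC [LHS]mulrA divfK ?gt_eqF.
  by rewrite /Gs mulrDr -mulrA.
have gA : approximable (fun h => Re (Gs h)).
  have vz z : normc z < 1 -> visc_at (fun w => (Re (Gs w))%:E) z /\
      visc_at (fun w => (- Re (Gs w))%:E) z.
    move=> z1; apply: (@cdiff_visc_at R Gs z (1 - normc z)); rewrite ?subr_gt0// => h hz.
    apply: Gsd; apply: le_trans (normcD _ _) _; move: hz; clear; lra.
  apply: visc_approximable => z z1; [|exact: (vz z z1).1|exact: (vz z z1).2].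
  have [E HE] := Gsd z z1; apply: (continuous_comp (has_cderive_continuous HE)).
  exact: continuous_Re.
have [m gm] := approximable_bounded gA.
have m0 : 0 <= m by apply: le_trans (gm 0 _); rewrite ?normc0.
pose a := harm_coef (fun h => Re (Gs h)) 1; pose c := harm_coef (fun h => Re (Gs h)) 2.
pose K := 4 * m / s ^+ 3; pose C := c / s%:C ^+ 2.
have K0 : 0 <= K by rewrite /K !mulr_ge0// invr_ge0 exprn_ge0// ltW.
have J t : normc t <= s / 2 ->
    `|Re (G t - G 0 - (a / s%:C) * t - C * t ^+ 2)| <= K * normc t ^+ 3.
  move=> ts; have := @harm_jet3 R (fun h => Re (Gs h)) m (t / s%:C) gA gm.
  have nt : normc (t / s%:C) = normc t / s.
    by rewrite -fmorphV /= normcM normcR gtr0_norm// invr_gt0.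
  rewrite nt ler_pdivrMr// [2^-1 * s]mulrC => /(_ ts).
  rewrite -/a -/c /Gs mulr0 [s%:C * _]mulrC divfK// -!cReB; congr (`|Re _| <= _); last first.
    by rewrite expr_div_n /K; ring.
  rewrite opprD addrA expr_div_n /C; congr (_ - _ - _).
    by rewrite mulrA mulrAC.
  by rewrite mulrA mulrAC.
have aD : a / s%:C - D = 0.
  apply: linear_form_eq0 => e e0; have [d d0 Hd] := GD _ (divr_gt0 e0 (ltr0n R 2)).
  have KC : 0 < K + normc C + 1 by rewrite ltr_wpDl// addr_ge0// normc_ge0.
  exists (Num.min d (Num.min (s / 2) (Num.min 1 (e / 2 / (K + normc C + 1))))).
    by rewrite !lt_min d0 ltr01 !divr_gt0.
  move=> h; rewrite !lt_min => /and4P[/Hd]; rewrite add0r => H1 /ltW/J H2 h1.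
  rewrite ltr_pdivlMr// => hK.
  have -> : (a / s%:C - D) * h = (G h - G 0 - D * h) -
      (G h - G 0 - (a / s%:C) * h - C * h ^+ 2) - C * h ^+ 2 by ring.
  rewrite !cReB; apply: le_trans (ler_normB _ _) _.
  apply: le_trans (lerD (ler_normB _ _) (lexx _)) _.
  rewrite -!cReB; have {H1}H1 := le_trans (normc_Re _) H1.
  have := normc_Re (C * h ^+ 2); rewrite normcM normcX => H3.
  apply: le_trans (lerD (lerD H1 H2) H3) _.
  have h0 := normc_ge0 h; have c0 := normc_ge0 C.
  have P1 : normc h ^+ 3 <= normc h ^+ 2.
    by rewrite exprSr ler_piMr// ?sqr_ge0// ltW.
  have P2 := ler_wpM2l K0 P1.
  have P3 : normc h * (K + normc C) <= e / 2.
    by apply: le_trans (ltW hK); rewrite ler_wpM2l// lerDl.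
  have := ler_wpM2r h0 P3.
  move: P2; move: (normc h) (normc C) (K * _) => x y z; clear; nra.
exists C, K, (s / 2); first by rewrite divr_gt0.
by move=> t /ltW/J; rewrite (subr0_eq aD).
Qed.

(** With q = G t - G 0 - D t and c = x - G 0, the left side is |c - q|^2 = |c|^2 - 2 Re(conj(c) q) +
    |q|^2. The cross term is Re(C t^2) up to a cubic error, by the jet of conj(c) G, and |q|^2 is of
    fourth order, so no multiple of |t|^2 appears. *)
Lemma cdiff_square_jet G D (r : R) : 0 < r -> (forall h, normc h < r -> cdiff_at G h) ->
  has_cderive G 0 D -> forall x : R[i], exists C, exists K : R, exists2 d : R, 0 <= K /\ 0 < d &
    forall t, normc t < d ->
      normc (x + D * t - G t) ^+ 2 <= normc (x - G 0) ^+ 2 + Re (C * t ^+ 2) + K * normc t ^+ 3.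
Proof.
move=> r0 Gd GD x; pose c := x - G 0.
have jet (a : R[i]) : exists C, exists K : R, exists2 d : R, 0 <= K /\ 0 < d &
    forall t, normc t < d -> `|Re (a * (G t - G 0 - D * t) - C * t ^+ 2)| <= K * normc t ^+ 3.
  have ad h : normc h < r -> cdiff_at (fun w => a * G w) h.
    by move=> /Gd; exact: cdiff_scale.
  have [C [K [d Kd H]]] := cdiff_jet r0 ad (has_cderive_scale a GD).
  by exists C, K, d => // t /H; rewrite 2!mulrBr [a * (D * t)]mulrA.
have small (a : R[i]) : exists L : R, exists2 d : R, 0 <= L /\ 0 < d &
    forall t, normc t < d -> Re (a * (G t - G 0 - D * t)) ^+ 2 <= L * normc t ^+ 3.
  have [C [K [d [K0 d0] H]]] := jet a.
  exists ((normc C + K) ^+ 2), (Num.min d 1); first by rewrite sqr_ge0 lt_min d0 ltr01.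
  move=> t; rewrite lt_min => /andP[/H{}H t1].
  have t0 := normc_ge0 t; have C0 := normc_ge0 C.
  have P : normc t ^+ 3 <= normc t ^+ 2 by rewrite exprSr ler_piMr ?sqr_ge0// ltW.
  have L : `|Re (a * (G t - G 0 - D * t))| <= (normc C + K) * normc t ^+ 2.
    rewrite -[a * _](subrK (C * t ^+ 2)) cReD; apply: le_trans (ler_normD _ _) _.
    have := normc_Re (C * t ^+ 2); rewrite normcM normcX.
    by have := ler_wpM2l K0 P; move: H; rewrite mulrDl; clear; lra.
  rewrite -real_normK ?num_real//.
  have : `|Re (a * (G t - G 0 - D * t))| ^+ 2 <= ((normc C + K) * normc t ^+ 2) ^+ 2.
    by rewrite lerXn2r// nnegrE// mulr_ge0 ?sqr_ge0// addr_ge0.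
  move=> /le_trans; apply; rewrite exprMn ler_wpM2l ?sqr_ge0//.
  by rewrite -exprM [leLHS]exprSr ler_piMr ?exprn_ge0// ltW.
have [C1 [K1 [d1 [K10 d10] H1]]] := jet (conjc c).
(* The multipliers 1 and -'i extract the real and imaginary parts of q, hence |q|^2. *)
have [L2 [d2 [L20 d20] H2]] := small 1.
have [L3 [d3 [L30 d30] H3]] := small (- 'i).
exists ((-2)%:C * C1), (2 * K1 + L2 + L3), (Num.min d1 (Num.min d2 d3)).
  by rewrite !addr_ge0// ?mulr_ge0// !lt_min d10 d20.
move=> t; rewrite !lt_min => /and3P[/H1 {}H1 /H2 {}H2 /H3 {}H3].
have -> : x + D * t - G t = c - (G t - G 0 - D * t) by rewrite /c; ring.
rewrite -/c; move: H1 H2 H3; move: (G t - G 0 - D * t) => q.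
rewrite mul1r mulNr cReN cReB -mulrA cReZ -/c.
rewrite !normc_sq cReB cImB; case: c q => [c1 c2] [q1 q2] /=.
rewrite mul0r mul1r add0r !opprK; move: (Re (C1 * t ^+ 2)) (normc t ^+ 3) => z T.
rewrite ler_norml => /andP[H1 _] H2 H3; rewrite !mulrDl; nra.
Qed.

End HolomorphicJets.

(** * The maximum norm on rows, and penalization on compact sets *)

Section RowNorm.
Context {R : realType} {n : nat}.
Implicit Types x y : 'rV[R[i]^o]_n.

Lemma nrm_rV_lt x (r : R) : 0 < r -> nrm x < r <-> forall j, normc (x 0 j) < r.
Proof.
move=> r0; have E : ball (0 : 'rV[R[i]^o]_n) r%:C x <-> nrm x < r.
  by rewrite -ball_normE /= sub0r normrN nrmE ltcR.
rewrite -E; split=> [[_ H] j|H].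
  by have := H 0 j; rewrite /ball /= mxE sub0r normrN normcE ltcR.
split=> [|i j]; first by rewrite ltcR.
by rewrite (ord1 i) /ball /= mxE sub0r normrN normcE ltcR.
Qed.

Lemma normc_coord x j : normc (x 0 j) <= nrm x.
Proof.
apply/ler_addgt0Pr => e e0.
have r0 : 0 < nrm x + e by rewrite ltr_wpDl// nrm_ge0.
by apply/ltW; apply: (nrm_rV_lt x r0).1; rewrite ltrDl.
Qed.

Lemma nrm_rV_le x (r : R) : 0 <= r -> (forall j, normc (x 0 j) <= r) -> nrm x <= r.
Proof.
move=> r0 H; apply/ler_addgt0Pr => e e0.
apply/ltW/nrm_rV_lt => [|j]; first by rewrite ltr_wpDl.
by apply: le_lt_trans (H j) _; rewrite ltrDl.
Qed.

Lemma compact_rV_ball x0 (r : R) : 0 <= r -> compact [set x | nrm (x - x0) <= r].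
Proof.
move=> r0; pose A j : set R[i]^o := [set z | normc (z - x0 0 j) <= r].
have -> : [set x | nrm (x - x0) <= r] = [set x | forall j, A j (x 0 j)].
  apply/seteqP; split=> x /= H.
    by move=> j; have := normc_coord (x - x0) j; rewrite !mxE => /le_trans; exact.
  by apply: nrm_rV_le => // j; have := H j; rewrite !mxE.
apply: rV_compact => j.
have -> : A j = (fun z : R[i]^o => x0 0 j + z) @` [set z | normc z <= r].
  apply/seteqP; split=> z /=; rewrite /A /=.
    by exists (z - x0 0 j) => //; rewrite addrC subrK.
  by move=> [w wr <-]; rewrite /A /= addrC addKr.
apply: (@continuous_compact R[i]^o R[i]^o); last exact: compact_disc.
apply/continuous_subspaceT => z.
apply/continuous_cnrmP => e e0; exists e => // y.
by rewrite opprD addrACA subrr add0r.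
Qed.

End RowNorm.

(** Each of the three alternatives persists near p for all large k: I by openness, F < s by
    semicontinuity, and N > 0 because F is bounded above near p while k N grows. Compactness makes
    one k serve all of K. *)
Lemma penalization {R : realType} {X : topologicalType} (K : set X) (F : X -> \bar R)
    (N : X -> R) (I : X -> Prop) (s : R) : compact K ->
  (forall p, K p -> (F p < +oo)%E) -> (forall p, K p -> usc_at F p) ->
  (forall p, 0 <= N p) -> (forall p, K p -> {for p, continuous N}) ->
  (forall p, K p -> (\forall q \near p, I q) \/ 0 < N p \/ (F p < s%:E)%E) ->
  exists k : R, 0 <= k /\ forall p, K p -> I p \/ (F p + (- (k * N p))%:E < s%:E)%E.
Proof.
move=> /compact_near_coveringP cK Foo Fusc N0 Nc cover.
pose P (k : nat) p := I p \/ (F p + (- (k%:R * N p))%:E < s%:E)%E.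
have : \forall k \near \oo, K `<=` P k.
  apply: cK => p Kp; have [Ip|[Np|Fp]] := cover p Kp.
  - by exists ([set q | I q], setT); [split=> //; exact: filterT|move=> [q k] [Iq _]; left].
  - have [a Fa] : exists a : R, (F p < a%:E)%E.
      by case: (F p) (Foo p Kp) => [x||]// _; [exists (x + 1); rewrite lte_fin ltrDl|exists 0; exact: ltNyr].
    have np0 : 0 < N p / 2 by exact: divr_gt0.
    have Nnear : \forall q \near p, N p / 2 < N q.
      have /cvgrPdist_lt/(_ _ np0) := Nc p Kp; apply: filterS => q.
      by rewrite ltr_norml => /andP[_]; clear; lra.
    exists ([set q | (F q < a%:E)%E /\ N p / 2 < N q], [set k | (a - s) / (N p / 2) < k%:R]).
      split; first by apply: filterI => //; exact: Fusc.
      exact: nbhs_infty_gtr.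
    move=> [q k] /= [[Fq Nq]]; rewrite ltr_pdivrMr// => kb; right.
    apply: (@lt_le_trans _ _ (a%:E + (- (k%:R * N q))%:E)%E).
      by rewrite lteD2rE.
    rewrite -EFinD lee_fin; have := ler_wpM2l (ler0n R k) (ltW Nq); move: kb; clear; lra.
  - exists ([set q | (F q < s%:E)%E], setT); first by split; [exact: Fusc|exact: filterT].
    move=> [q k] /= [Fq _]; right; apply: le_lt_trans Fq.
    by rewrite geeDl// lee_fin oppr_le0 mulr_ge0.
move=> [k _ /(_ k (leqnn k)) H]; exists k%:R; split; first exact: ler0n.
exact: H.
Qed.

Lemma continuous_jet {R : realType} (B C : R[i]) (a : R) (h : R[i]^o) :
  {for h, continuous (fun h : R[i]^o => - Re (B * h + C * h ^+ 2) + a * normc h ^+ 2)}.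
Proof.
have P : {for h, continuous (fun h : R[i]^o => B * h + C * h ^+ 2 : R[i]^o)}.
  apply: continuousD; apply: continuousM; try exact: cst_continuous; first exact: cvg_id.
  by apply: (@continuousM R[i]); exact: cvg_id.
apply: continuousD.
  by apply: continuousN; apply: (continuous_comp P); exact: continuous_Re.
apply: continuousM; first exact: cst_continuous.
by apply: continuousM; exact: continuous_normc.
Qed.

(** * Plurisubharmonic functions along holomorphic curves *)

Section PlurisubharmonicAlongCurves.
Context {R : realType} {n : nat}.
Local Notation C := R[i].
Local Notation V := 'rV[R[i]^o]_n.
Implicit Types (U : set V) (phi : V -> \bar R) (g : R[i] -> V).

(** The Euclidean square, although V carries the maximum norm: as a sum of squared moduli it
    inherits the second-order bound coordinate by coordinate. *)
Definition sqdist g (p : R[i]^o * V) : R := \sum_(j < n) normc (p.2 0 j - g p.1 0 j) ^+ 2.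

Lemma sqdist_continuous g (p : R[i]^o * V) :
  (forall j, cdiff_at (fun w => g w 0 j) p.1) -> {for p, continuous (sqdist g)}.
Proof.
move=> gd; apply: cvg_big => [|j _]; first exact: add_continuous.
have H : {for p, continuous (fun q : R[i]^o * V => normc (q.2 0 j - g q.1 0 j))}.
  apply: (@continuous_comp (R[i]^o * V)%type R[i]^o R
    (fun q => q.2 0 j - g q.1 0 j) (@Normc.normc R)); last exact: continuous_normc.
  apply: cvgB.
    apply: (@continuous_comp (R[i]^o * V)%type V R[i]^o snd (fun x => x 0 j)).
      exact: cvg_snd.
    exact: coord_continuous.
  apply: (@continuous_comp (R[i]^o * V)%type R[i]^o R[i]^o fst (fun w => g w 0 j)).
    exact: cvg_fst.
  by have [D HD] := gd j; exact: has_cderive_continuous HD.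
by rewrite expr2; exact: (cvgM H H).
Qed.

Lemma sqdist_eq0 g p : sqdist g p = 0 -> p.2 = g p.1.
Proof.
move=> H; apply/rowP => j; apply/subr0_eq/normc_eq0.
have : \sum_(j < n) normc (p.2 0 j - g p.1 0 j) ^+ 2 == 0 by rewrite -/(sqdist g p) H.
rewrite psumr_eq0 => [/allP/(_ j)|k _]; last exact: sqr_ge0.
by rewrite mem_index_enum => /(_ isT)/=; rewrite sqrf_eq0 => /eqP.
Qed.

Lemma sqdist_ge0 g p : 0 <= sqdist g p.
Proof. by apply: sumr_ge0 => j _; exact: sqr_ge0. Qed.

(* Doubling of variables: if q touches phi o g from above at 0, then for large k
   the maximum of phi(x) - q(h) - k |x - g(h)|^2 is attained near (0, g 0), and
   there phi is touched along the complex line in the direction of g'(h). *)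
Lemma plurisubharmonic_curve_visc U phi g (r : R) : open U -> plurisubharmonic_on U phi ->
  0 < r -> (forall h, normc h < r -> U (g h)) ->
  (forall h j, normc h < r -> cdiff_at (fun w => g w 0 j) h) ->
  visc_at (phi \o g) 0.
Proof.
move=> oU [phioo phiusc phisub] r0 gU gd B C0 e d e0 d0 phifin T.
pose x0 := g 0; have Ux0 : U x0 by apply: gU; rewrite normc0.
have [d1 d10 d1U] := open_nrmP oU Ux0.
have m0 : 0 < Num.min r d by rewrite lt_min r0.
pose r1 := Num.min r d / 2; have r10 : 0 < r1 by exact: divr_gt0.
have r1m : r1 < Num.min r d by rewrite /r1 ltr_pdivrMr// ltr_pMr// ltr1n.
have [r1r r1d] : r1 < r /\ r1 < d by move: r1m; rewrite lt_min => /andP.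
pose rho := d1 / 2; have rho0 : 0 < rho by exact: divr_gt0.
have rhod : rho < d1 by rewrite /rho ltr_pdivrMr// ltr_pMr// ltr1n.
clearbody r1 rho.
pose K : set (R[i]^o * V)%type :=
  [set h | normc h <= r1] `*` [set x | nrm (x - x0) <= rho].
(* Only half of e is kept: on the graph of g this makes F < s for every h other than 0, and the
   retained half produces the contradiction at the maximum. *)
pose q (h : C) := - Re (B * h + C0 * h ^+ 2) + e / 2 * normc h ^+ 2.
pose F (p : R[i]^o * V) : \bar R := (phi p.2 + (q p.1)%:E)%E.
pose I (p : R[i]^o * V) := normc p.1 < r1 /\ nrm (p.2 - x0) < rho.
have [s sE] : exists s : R, phi x0 = s%:E.
  by move: phifin; rewrite /= -/x0 => /fineK <-; exists (fine (phi x0)).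
have KU p : K p -> U p.2 by move=> [_ /= px]; apply: d1U; exact: le_lt_trans px rhod.
have Kr p : K p -> normc p.1 < r by move=> [/= ph _]; exact: le_lt_trans ph r1r.
have cK : compact K.
  by apply: compact_setX; [exact: compact_disc|apply: compact_rV_ball; exact: ltW].
have Foo p : K p -> (F p < +oo)%E.
  by move=> /KU/phioo; rewrite /F; case: (phi p.2) => // x _; exact: ltry.
have Fusc p : K p -> usc_at F p.
  move=> Kp; apply: usc_add.
    apply: (@usc_comp R (R[i]^o * V)%type V phi snd); last exact: cvg_snd.
    by move=> a; apply: phiusc; exact: KU.
  apply: (@continuous_comp (R[i]^o * V)%type R[i]^o R fst q); first exact: cvg_fst.
  exact: continuous_jet.
have q0 : q 0 = 0 by rewrite /q normc0 !expr0n /= !mulr0 !addr0 /= oppr0.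
have Nc p : K p -> {for p, continuous (sqdist g)}.
  by move=> /Kr pr; apply: sqdist_continuous => j; exact: gd.
have cover p : K p -> (\forall p' \near p, I p') \/ 0 < sqdist g p \/ (F p < s%:E)%E.
  move=> Kp; have := sqdist_ge0 g p; rewrite le_eqVlt => /orP[/eqP N0|]; last by right; left.
  have p2 := sqdist_eq0 (esym N0); have [p1|p1] := eqVneq (normc p.1) 0.
    left; exists ([set h | normc h < r1], [set x | nrm (x - x0) < rho]) => //=; split.
      by apply/nbhs_nrmP; exists r1 => // y; rewrite nrm_normc (normc_eq0 p1) subr0.
    apply/nbhs_nrmP; exists rho => // y.
    by rewrite p2 (normc_eq0 p1).
  right; right; have pd : normc p.1 < d by case: Kp => /= ph _; exact: le_lt_trans ph r1d.
  have := T p.1 pd; rewrite add0r /= -/x0 sE /F p2.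
  move: (phi _) => [w||]//; rewrite -?EFinD ?lee_fin ?lte_fin => H.
    have : 0 < e * normc p.1 ^+ 2 by rewrite mulr_gt0// exprn_gt0// lt_neqAle eq_sym p1 normc_ge0.
    by move: H; rewrite /q; clear; lra.
  exact: ltNyr.
have [k [k0 kP]] :=
  @penalization R (R[i]^o * V)%type K F (sqdist g) I s cK Foo Fusc (sqdist_ge0 g) Nc cover.
pose Psi (p : R[i]^o * V) : \bar R := (F p + (- (k * sqdist g p))%:E)%E.
have K0 : K (0 : R[i]^o, x0).
  split; first by rewrite /mkset normc0 ltW.
  by rewrite /mkset subrr nrm0 ltW.
have [[h1 x1] Kp1 pmax] : exists2 p, K p & forall p', K p' -> (Psi p' <= Psi p)%E.
  apply: (usc_maximum (v := Psi) cK); first by exists (0 : R[i]^o, x0).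
    by move=> p /Foo; rewrite /Psi; case: (F p) => // y _; exact: ltry.
  move=> p Kp; apply: usc_add; first exact: Fusc.
  by apply: continuousN; apply: continuousM; [exact: cst_continuous|exact: Nc].
have Psi0 : Psi (0 : R[i]^o, x0) = s%:E.
  rewrite /Psi /F /= q0 sE /sqdist big1 => [|j _]; first by rewrite mulr0 oppr0 !adde0.
  by rewrite /= subrr normc0 expr0n.
have [v vE] : exists v : R, phi x1 = v%:E.
  have := pmax _ K0; have := phioo _ (KU _ Kp1); rewrite Psi0 /Psi /F /=.
  by case: (phi x1) => [v||]// _ _; exists v.
(* The maximum is at least the value s at (0, x0), which excludes the penalized alternative; the
   maximum is therefore interior. *)
have [/= h1r x1r] : I (h1, x1).
  have [//|] := kP _ Kp1; rewrite ltNge -Psi0 -/(Psi _).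
  by rewrite pmax.
have h1R : normc h1 < r by exact: lt_trans h1r r1r.
have [b bP] := choice (fun j => gd h1 j h1R).
(* Both variables move together, x1 along the derivative of g at h1, so that the penalty has no
   |t|^2 term. *)
pose N t := sqdist g (h1 + t, x1 + t *: \row_j b j).
have [CC [KK [d2 [KK0 d20] NP]]] : exists CC, exists KK : R, exists2 d2 : R, 0 <= KK /\ 0 < d2 &
    forall t, normc t < d2 -> N t <= N 0 + Re (CC * t ^+ 2) + KK * normc t ^+ 3.
  have jet j : exists q : C * R, 0 <= q.2 /\ \forall t \near (0 : R[i]^o),
      normc (x1 0 j + b j * t - g (h1 + t) 0 j) ^+ 2 <=
      normc (x1 0 j - g (h1 + 0) 0 j) ^+ 2 + Re (q.1 * t ^+ 2) + q.2 * normc t ^+ 3.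
    have r' : 0 < r - normc h1 by rewrite subr_gt0.
    have [||C1 [K1 [d2 [K10 d20] H]]] :=
        @cdiff_square_jet R (fun t => g (h1 + t) 0 j) (b j) _ r' _ _ (x1 0 j).
    - move=> h hr; apply: (@cdiff_shift _ (fun w => g w 0 j)); apply: gd.
      by apply: le_lt_trans (normcD _ _) _; move: hr; clear; lra.
    - by move=> e' /(bP j)[d2 d20 H2]; exists d2 => // k'; rewrite add0r addr0; exact: H2.
    exists (C1, K1); split=> //; apply/nbhs_nrmP; exists d2 => // t.
    by rewrite nrm_normc subr0; exact: H.
  have [Q QP] := choice jet.
  have := @filter_forall R[i]^o 'I_n _ (nbhs (0 : R[i]^o)) _ (fun j => (QP j).2).
  move=> /(_ (nbhs_filter _))/nbhs_nrmP[d2 d20 H].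
  exists (\sum_j (Q j).1), (\sum_j (Q j).2), d2.
    by split=> //; apply: sumr_ge0 => j _; exact: (QP j).1.
  move=> t td; have {}H := H t; rewrite nrm_normc subr0 in H.
  rewrite !mulr_suml Re_sum -!big_split /= /N /sqdist /=; apply: ler_sum => j _.
  have E (a : C) : (x1 + a *: \row_j0 b j0) 0 j = x1 0 j + b j * a.
    by rewrite !mxE; congr (_ + _); exact: mulrC.
  by rewrite !E mulr0 addr0; exact: H.
pose bb : V := \row_j b j.
have Ux1 : U x1 by exact: (KU _ Kp1).
have V0 : visc_at (phi \o line x1 bb) 0.
  apply: (subharmonic_visc (U := line x1 bb @^-1` U)).
  - exact: open_line_preimage.
  - exact: phisub.
  - by rewrite /= /line scale0r addr0.
have e4 : 0 < e / 4 by exact: divr_gt0.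
have l0 : line x1 bb 0 = x1 by rewrite /line scale0r addr0.
pose d3 := Num.min (r1 - normc h1) (Num.min ((rho - nrm (x1 - x0)) / (nrm bb + 1))
  (Num.min d2 (e / 4 / (k * KK + 1)))).
have bb1 : 0 < nrm bb + 1 by rewrite ltr_wpDl// nrm_ge0.
have kK1 : 0 < k * KK + 1 by rewrite ltr_wpDl// mulr_ge0.
have d30 : 0 < d3.
  by rewrite /d3 !lt_min subr_gt0 h1r d20 !divr_gt0// subr_gt0.
(* Recentring the jet at h1 shifts B by 2 C0 h1, and the linear part of -(e/2) |h1 + t|^2 shifts it
   by -e conj(h1); the penalty contributes k CC to the quadratic coefficient. Of the e/2 kept in q,
   the cubic remainder uses at most e/4. *)
apply: (V0 (B + 2 * C0 * h1 - e%:C * conjc h1) (C0 + k%:C * CC) _ _ e4 d30).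
  by rewrite /= l0 vE.
move=> t; rewrite /d3 !lt_min => /and4P[t1]; rewrite !ltr_pdivlMr// => t2 t3 t4.
rewrite add0r /= l0.
have Kt : K (h1 + t : R[i]^o, line x1 bb t).
  split=> /=.
    by apply: le_trans (normcD _ _) _; move: t1; clear; lra.
  apply: le_trans (nrm_triangle _ x1 _) _.
  rewrite -{2}l0 nrm_line subr0; move: t2; rewrite mulrDr.
  by have := normc_ge0 t; move: (normc t * nrm bb) => y; clear; lra.
have := pmax _ Kt; rewrite /Psi /F /=; have := phioo _ (KU _ Kt); rewrite /= vE.
case: (phi _) => [w||] // _; last by move=> _; rewrite leNye.
rewrite -!EFinD !lee_fin.
have := ler_wpM2l k0 (NP t t3).
have -> : N t = sqdist g (h1 + t, line x1 bb t) by [].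
have -> : N 0 = sqdist g (h1, x1) by rewrite /N addr0 scale0r addr0.
have t4' : k * (KK * normc t ^+ 3) <= e / 4 * normc t ^+ 2.
  rewrite mulrA exprSr mulrCA mulrC ler_wpM2r ?sqr_ge0//.
  by have := normc_ge0 t; move: t4; clear; lra.
have E : normc (h1 + t) ^+ 2 = normc h1 ^+ 2 + 2 * Re (conjc h1 * t) + normc t ^+ 2.
  by rewrite !normc_sq cReD cImD cReM cReJ cImJ; ring.
have E2 : Re (B * (h1 + t) + C0 * (h1 + t) ^+ 2) = Re (B * h1 + C0 * h1 ^+ 2) +
    Re ((B + 2 * C0 * h1) * t + C0 * t ^+ 2).
  by rewrite -cReD; congr (Re _); ring.
have E3 : Re ((B + 2 * C0 * h1 - e%:C * conjc h1) * t + (C0 + k%:C * CC) * t ^+ 2) =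
    Re ((B + 2 * C0 * h1) * t + C0 * t ^+ 2) - e * Re (conjc h1 * t) + k * Re (CC * t ^+ 2).
  by rewrite -!cReZ -cReB -cReD; congr (Re _); ring.
rewrite E3 /q E E2; move: t4'; rewrite !mulrDr.
move: (Re _) (Re _) (Re _) (Re _) (normc _ ^+ 2) (normc _ ^+ 2) (sqdist _ _) (sqdist _ _).
move=> a1 a2 a3 a4 a5 a6 a7 a8.
move: (k * _) (k * _) (k * _) (k * _) => b1 b2 b3 b4; clear; lra.
Qed.

End PlurisubharmonicAlongCurves.

(** * Composition with holomorphic and antiholomorphic maps *)

Section HolomorphicComposition.
Context {R : realType} {n m : nat}.
Local Notation C := R[i].
Local Notation V := 'rV[R[i]^o]_n.
Local Notation W := 'rV[R[i]^o]_m.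
Implicit Types (U : set V) (phi : W -> \bar R) (f : V -> W) (a b z : V).

Lemma plurisubharmonic_visc U (v : V -> \bar R) :
  (forall z, U z -> (v z < +oo)%E) -> upper_semicontinuous_on U v ->
  (forall a b k, U (line a b k) -> visc_at (v \o line a b) k) ->
  plurisubharmonic_on U v.
Proof.
move=> voo vusc vvisc; split=> // a b; apply: visc_subharmonic.
- by move=> k Uk; exact: voo.
- move=> k Uk; apply: (@usc_comp R R[i]^o V v (line a b)); first exact: vusc.
  exact: continuous_line.
- by move=> k Uk; exact: vvisc.
Qed.

Lemma differentiable_nrm f z : differentiable f z -> forall e : R, 0 < e ->
  exists2 d : R, 0 < d & forall h, nrm h < d -> nrm (f (z + h) - f z - 'd f z h) <= e * nrm h.
Proof.
move=> /diff_locally /eqaddoP H e e0.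
have [|d d0 Hd] := (nbhs_nrmP _ _).1 (H e%:C _); first by rewrite ltcR.
exists d => // h hd; have := Hd h; rewrite subr0 => /(_ hd).
have -> : (f \o shift z - (cst (f z) + 'd f z)) h = f (z + h) - f z - 'd f z h.
  by rewrite [z + h]addrC -addrA -opprD.
by rewrite !nrmE -realcM lecR.
Qed.

Lemma differentiable_line_cderive f a b k j : differentiable f (line a b k) ->
  has_cderive (fun w => f (line a b w) 0 j) k ('d f (line a b k) b 0 j).
Proof.
move=> fz e e0; have b1 : 0 < nrm b + 1 by rewrite ltr_wpDl// nrm_ge0.
have [d d0 H] := differentiable_nrm fz (divr_gt0 e0 b1).
exists (d / (nrm b + 1)) => [|h]; first exact: divr_gt0.
rewrite ltr_pdivlMr// => hd.
have {H} := H (h *: b); rewrite nrmZ linearZ -line_shift => H.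
apply: (@le_trans _ _ (nrm (f (line a b (k + h)) - f (line a b k) - h *: 'd f (line a b k) b))).
  apply: le_trans (normc_coord _ j); rewrite !mxE [X in normc X <= _](_ : _ =
    f (line a b (k + h)) 0 j - f (line a b k) 0 j - h *: 'd f (line a b k) b 0 j)//.
  by congr (_ - _); exact: mulrC.
apply: le_trans (H _) _.
  by apply: le_lt_trans hd; rewrite ler_wpM2l ?normc_ge0// lerDl.
rewrite mulrCA mulrC ler_wpM2r ?normc_ge0// mulrAC ler_pdivrMr// ler_wpM2l ?lerDl//.
exact: ltW.
Qed.

Lemma visc_shift (v : C -> \bar R) k : visc_at (fun h => v (k + h)) 0 -> visc_at v k.
Proof.
move=> H B D e d e0 d0 vk T; apply: (H B D e d e0 d0); first by rewrite addr0.
by move=> h /T; rewrite add0r addr0.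
Qed.

(** Conjugating h together with both coefficients changes neither |h| nor the real part of the
    polynomial, so the touching condition is insensitive to the orientation of the line. *)
Lemma visc_conj (v : C -> \bar R) k : visc_at (fun h => v (k + conjc h)) 0 -> visc_at v k.
Proof.
move=> H B D e d e0 d0 vk T; apply: (H (conjc B) (conjc D) e d e0 d0).
  by rewrite conjc0 addr0.
move=> h hd; have := T (conjc h); rewrite normcJ add0r conjc0 addr0 => /(_ hd).
have -> : conjc B * h + conjc D * h ^+ 2 = conjc (B * conjc h + D * conjc h ^+ 2).
  by rewrite !expr2 conjcD !conjcM conjcK.
by rewrite cReJ.
Qed.

(** Conjugation before and after G, as in the reflection principle, keeps it complex differentiable,
    with conjugate derivative. *)
Lemma cdiff_conj (G : C -> C) k h : cdiff_at G (k + conjc h) ->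
  cdiff_at (fun w => conjc (G (k + conjc w))) h.
Proof.
move=> [D HD]; exists (conjc D) => e /HD[d d0 H]; exists d => // t td.
have := H (conjc t); rewrite normcJ => /(_ td); rewrite -normcJ.
by rewrite !rmorphB /= conjcM conjcK rmorphD /= addrA.
Qed.

Lemma conj_fun_continuous f z : {for z, continuous (conj_fun f)} -> {for z, continuous f}.
Proof.
move=> /continuous_cnrmP fz; apply/continuous_cnrmP => e e0.
have [d d0 H] := fz e e0; exists d => // y /H /(nrm_rV_lt _ e0) Hj.
apply/(nrm_rV_lt _ e0) => j; have := Hj j.
by rewrite !mxE -rmorphB /= normcJ.
Qed.

Lemma holomorphic_plurisubharmonic U (U' : set W) f phi : open U -> open U' ->
  (forall z, U z -> U' (f z)) -> holomorphic_on U f \/ holomorphic_on U (conj_fun f) ->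
  plurisubharmonic_on U' phi -> plurisubharmonic_on U (phi \o f).
Proof.
move=> oU oU' fU fhol phipsh; have [phioo phiusc _] := phipsh.
have fc z : U z -> {for z, continuous f}.
  move=> Uz; case: fhol => fhol; first by apply: differentiable_continuous; exact: fhol.
  by apply: conj_fun_continuous; apply: differentiable_continuous; exact: fhol.
apply: plurisubharmonic_visc.
- by move=> z /fU; exact: phioo.
- by move=> z Uz; apply: (@usc_comp R V W phi f); [exact/phiusc/fU|exact: fc].
move=> a b k Uk.
have [r r0 rU] := open_nrmP (@open_line_preimage _ _ _ a b oU) Uk.
have {}rU h : normc h < r -> U (line a b (k + h)).
  by move=> hr; apply: rU; rewrite nrm_normc addrC addKr.
case: fhol => fhol.
  apply: visc_shift.
  apply: (@plurisubharmonic_curve_visc R m U' phi (fun h => f (line a b (k + h))) r) => //.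
    by move=> h /rU/fU.
  move=> h j hr; apply: (@cdiff_shift _ (fun w => f (line a b w) 0 j)).
  by exists ('d f (line a b (k + h)) b 0 j); apply: differentiable_line_cderive; exact/fhol/rU.
(* When the conjugate of f is holomorphic, f along a line becomes a holomorphic curve after
   conjugating the parameter, so the curve lemma applies unchanged. *)
apply: visc_conj.
apply: (@plurisubharmonic_curve_visc R m U' phi (fun h => f (line a b (k + conjc h))) r) => //.
  by move=> h hr; apply/fU/rU; rewrite normcJ.
move=> h j hr.
have := @cdiff_conj (fun w => conj_fun f (line a b w) 0 j) k h.
have -> : (fun w => conjc (conj_fun f (line a b (k + conjc w)) 0 j)) =
    (fun w => f (line a b (k + conjc w)) 0 j).
  by apply/funext => w; rewrite mxE conjcK.
apply; exists ('d (conj_fun f) (line a b (k + conjc h)) b 0 j).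
by apply: differentiable_line_cderive; apply/fhol/rU; rewrite normcJ.
Qed.

End HolomorphicComposition.

(** * From plurisubharmonicity of u and -u to local harmonicity *)

Section PluriharmonicComposition.
Context {R : realType} {n : nat}.
Implicit Types (U : set 'rV[R[i]^o]_n) (u : 'rV[R[i]^o]_n -> R).

Lemma pluriharmonic_plurisubharmonic U u (sg : R) : open U -> pluriharmonic_on U u ->
  plurisubharmonic_on U (fun z => (sg * u z)%:E).
Proof.
move=> oU [[uc _] uH]; apply: plurisubharmonic_visc.
- by move=> z _; exact: ltry.
- move=> z Uz; apply: (@usc_continuous R _ (fun z => sg * u z)).
  by apply: continuousM; [exact: cst_continuous|apply: uc; exact/mem_set].
- move=> a b k Uk; apply: (@harmonic_visc R (line a b @^-1` U) (u \o line a b)) => //.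
    exact: open_line_preimage.
  exact: uH.
Qed.

(** Semicontinuity of u and -u gives continuity, hence a local bound; the submean inequality for
    both, read on lines as the touching condition, gives approximability on discs. All regularity of
    compositions with [f] enters here. *)
Lemma plurisubharmonic_locally_harmonic U u : open U ->
  (forall sg : R, `|sg| = 1 -> plurisubharmonic_on U (fun z => (sg * u z)%:E)) ->
  locally_harmonic U u.
Proof.
move=> oU upsh.
have [_ usc1 _] := upsh 1 (normr1 _); have [_ usc2 _] := upsh (-1) (normrN1 _).
have ucz z : U z -> {for z, continuous u}.
  move=> Uz; apply/continuous_nrmP => e e0; apply/nbhs_nrmP.
  have /(usc1 z Uz) H1 : ((1 * u z)%:E < (u z + e)%:E)%E by rewrite lte_fin mul1r ltrDl.
  have /(usc2 z Uz) H2 : ((-1 * u z)%:E < (e - u z)%:E)%E by rewrite lte_fin mulN1r ltrDr.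
  by apply: filterS2 H1 H2 => y; rewrite !lte_fin mulN1r mul1r ltr_norml; clear; lra.
move=> z Uz; have [d1 d10 d1U] := open_nrmP oU Uz.
have [d2 d20 d2P] := (continuous_nrmP _ _).1 (ucz z Uz) 1 ltr01.
exists (Num.min d1 d2), (`|u z| + 1); split.
- by rewrite lt_min d10.
- by move=> y; rewrite lt_min => /andP[/d1U].
split=> [y|y b yb].
  rewrite lt_min => /andP[_ /d2P]; have := ler_normD (u z) (u y - u z).
  by rewrite addrC subrK; lra.
have inU (h : R[i]) : normc h <= 1 -> U (line y b h).
  by move=> /yb; rewrite lt_min => /andP[/d1U].
have uv (sg : R) h : `|sg| = 1 -> normc h < 1 ->
    visc_at (fun w => (sg * u (line y b w))%:E) h.
  move=> sg1 h1; have [_ _ sub] := upsh sg sg1.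
  apply: (subharmonic_visc (U := line y b @^-1` U)); last exact/inU/ltW.
    exact: open_line_preimage.
  exact: sub.
apply: (@visc_approximable R (fun h => u (line y b h))).
- move=> h h1; apply: (@continuous_comp R[i]^o 'rV[R[i]^o]_n R (line y b) u).
    exact: continuous_line.
  exact/ucz/inU.
- move=> h h1; have := uv 1 h (normr1 _) h1.
  by congr (visc_at _ h); apply/funext => w; rewrite mul1r.
- move=> h h1; have := uv (-1) h (normrN1 _) h1.
  by congr (visc_at _ h); apply/funext => w; rewrite mulN1r.
Qed.

Lemma pluriharmonic_locally_harmonic U u : open U -> pluriharmonic_on U u ->
  locally_harmonic U u.
Proof.
move=> oU uH; apply: plurisubharmonic_locally_harmonic => // sg _.
exact: pluriharmonic_plurisubharmonic.
Qed.

End PluriharmonicComposition.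

(** * Unique continuation on a disc *)

Section Identity.
Context {R : realType}.

Lemma small_eq0 (a K d : R) : 0 < d -> (forall t, 0 < t -> t < d -> `|a| <= K * t) -> a = 0.
Proof.
move=> d0 H; apply/eqP; rewrite -normr_le0; apply/ler_addgt0Pr => e e0; rewrite add0r.
have K1 : 0 < `|K| + 1 by rewrite ltr_wpDl.
pose t := Num.min (d / 2) (e / (`|K| + 1)).
have t0 : 0 < t by rewrite lt_min !divr_gt0.
have td : t < d by rewrite gt_min ltr_pdivrMr// ltr_pMr// ltr1n.
apply: le_trans (H t t0 td) _.
have te : t * (`|K| + 1) <= e by rewrite -ler_pdivlMr// ge_min lexx orbT.
apply: le_trans te; rewrite mulrC ler_wpM2l ?ltW//.
by have := ler_norm K; clear; lra.
Qed.

(** All coefficients of positive index vanish by strong induction, and then the remainder of order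
    L, at most 4 m / 2^L for |h| <= 1/2, is all that is left of g. *)
Lemma approximable_identity (g : R[i] -> R) (m d : R) : approximable g ->
  (forall h, normc h <= 1 -> `|g h| <= m) -> 0 < d -> (forall h, normc h < d -> g h = 0) ->
  forall h, normc h <= 2^-1 -> g h = 0.
Proof.
move=> ga gm d0 g0.
have m0 : 0 <= m by apply: le_trans (gm 0 _); rewrite ?normc0.
have g00 : g 0 = 0 by apply: g0; rewrite normc0.
have c0 k : (0 < k)%N -> harm_coef g k = 0.
  elim/ltn_ind: k => k IH k0; set c := harm_coef g k.
  (* Along h = t w the k-th term c h^k is the real number t^k |c|^2, so taking real parts loses
     nothing; the remainder is of order t^(k+1). *)
  pose w : R[i] := k.-root (conjc c); have wk : w ^+ k = conjc c by exact: rootCK.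
  apply/normc_eq0/eqP; rewrite -sqrf_eq0; apply/eqP.
  have w1 : 0 < normc w + 1 by rewrite ltr_wpDl// normc_ge0.
  apply: (@small_eq0 _ (4 * m * normc w ^+ k.+1) (Num.min d 2^-1 / (normc w + 1))).
    by rewrite divr_gt0// lt_min d0 invr_gt0 ltr0n.
  move=> t t0; rewrite ltr_pdivlMr// mulrDr mulr1 => tw.
  have nh : normc (t%:C * w) = t * normc w by rewrite normcM normcR gtr0_norm.
  have : normc (t%:C * w) < Num.min d 2^-1.
    by rewrite nh; apply: le_lt_trans tw; rewrite lerDl ltW.
  rewrite lt_min => /andP[hd h2].
  have := @harm_jet R g m k.+1 (t%:C * w) ga isT gm (ltW h2).
  rewrite g0// g00 subrr sub0r normrN big_nat_recr//= big_nat big1 => [|i /andP[i0 ik]]; last first.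
    by rewrite IH// mul0r.
  have -> : 0 + harm_coef g k * (t%:C * w) ^+ k = (t ^+ k * normc c ^+ 2)%:C.
    rewrite add0r -/c exprMn wk mulrCA realcM rmorphXn /=; congr (_ * _); exact: mulcJ.
  rewrite [Re _]/= (_ : `| t ^+ k * _ | = t ^+ k * normc c ^+ 2); last first.
    by rewrite ger0_norm// mulr_ge0 ?sqr_ge0// exprn_ge0// ltW.
  rewrite nh ger0_norm ?sqr_ge0// exprMn [t ^+ k.+1]exprSr => H.
  have tk : 0 < t ^+ k by rewrite exprn_gt0.
  by rewrite -(ler_pM2l tk); apply: le_trans H _; rewrite le_eqVlt; apply/orP; left; apply/eqP; ring.
move=> h h2; apply/eqP; rewrite -normr_le0; apply/ler_addgt0Pr => e e0; rewrite add0r.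
have [L HL] : exists L, (0 < L)%N /\ 4 * m * 2^-1 ^+ L <= e.
  have m1 : 0 < 4 * m + 1 by rewrite ltr_wpDl// mulr_ge0.
  have [k Hk] := invn_small (divr_gt0 e0 m1); exists k.+1; split=> //.
  have Lk : (2^-1 : R) ^+ k.+1 <= k.+1%:R^-1.
    by rewrite exprVn lef_pV2 ?posrE ?exprn_gt0 ?ltr0n// -natrX ler_nat ltnW// ltn_expl.
  have Hm : (4 * m + 1) * k.+1%:R^-1 <= e by rewrite mulrC -ler_pdivlMr// ltW.
  apply: le_trans Hm; apply: ler_pM => //; rewrite ?mulr_ge0 ?exprn_ge0 ?invr_ge0//.
  by rewrite lerDl.
have := @harm_jet R g m L h ga HL.1 gm h2.
rewrite g00 subr0 big_nat big1 => [|i /andP[i0 _]]; last by rewrite c0// mul0r.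
rewrite subr0 => /le_trans; apply; apply: le_trans HL.2.
by rewrite ler_wpM2l ?mulr_ge0// lerXn2r ?nnegrE ?normc_ge0 ?invr_ge0.
Qed.

End Identity.

(** * Unique continuation on connected open sets *)

Section LocallyHarmonic.
Context {R : realType} {V : normedModType R[i]}.
Implicit Types (U : set V) (u v : V -> R) (y z b : V).

Lemma locally_harmonic_lin U u v (a c : R) : locally_harmonic U u -> locally_harmonic U v ->
  locally_harmonic U (fun z => a * u z + c * v z).
Proof.
move=> uH vH z Uz; have [r1 [m1 [r10 r1U [um ua]]]] := uH z Uz.
have [r2 [m2 [r20 _ [vm va]]]] := vH z Uz.
exists (Num.min r1 r2), (`|a| * m1 + `|c| * m2); split; first by rewrite lt_min r10.
  by move=> y; rewrite lt_min => /andP[/r1U].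
split=> [y|y b yb].
  rewrite lt_min => /andP[/um H1 /vm H2]; apply: le_trans (ler_normD _ _) _.
  by rewrite !normrM; apply: lerD; apply: ler_wpM2l.
apply: (@approximable_lin R (fun h => u (y + h *: b)) (fun h => v (y + h *: b)));
  [apply: ua|apply: va] => h /yb; by rewrite lt_min => /andP[].
Qed.

(** The interior of the zero set is relatively closed in U: a limit point y has a zero neighbourhood
    of some nearby w, and every x close to y lies on a disc centred at w to which the one-variable
    statement applies. *)
Lemma locally_harmonic_identity U u z : open U -> connected U -> locally_harmonic U u ->
  U z -> (\forall y \near z, u y = 0) -> forall y, U y -> u y = 0.
Proof.
move=> oU cU uH Uz uz; pose W := U `&` interior [set y | u y = 0].
suff WU : W = U by move=> y; rewrite -WU => -[_ /interior_subset].
have oW : open W by apply: openI => //; exact: open_interior.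
apply: cU; first by exists z.
  by exists (interior [set y | u y = 0]) => //; exact: open_interior.
exists (closure W); first exact: closed_closure.
apply/seteqP; split=> y [Uy yW]; first by split=> //; exact: subset_closure.
split=> //; have [r [m [r0 rU [um ua]]]] := uH y Uy.
have r8 : 0 < r / 8 by rewrite divr_gt0.
have [w [[Uw wint] wy]] : W `&` [set x | nrm (x - y) < r / 8] !=set0.
  by apply: yW; apply/nbhs_nrmP; exists (r / 8).
apply/nbhs_nrmP; exists (r / 8) => // x xy.
have [d d0 dP] := (nbhs_nrmP _ _).1 (wint : nbhs w [set y | u y = 0]).
(* Places x at the parameter 1/2, the limit of the one-variable statement. As |x - w| < r/4, the
   whole unit disc in the direction b stays within 5 r / 8 of y. *)
pose b := (2 : R[i]) *: (x - w).
have nb : nrm b <= r / 2.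
  rewrite nrmZ (_ : normc 2 = 2); last by rewrite -(rmorph_nat (real_complex R)) normcR ger0_norm.
  by have := nrm_triangle x y w; rewrite /= in wy; rewrite [nrm (y - w)]nrmB; move: wy xy; clear; lra.
have inb (h : R[i]) : normc h <= 1 -> nrm (w + h *: b - y) < r.
  move=> h1; apply: lt_trans (disc_in_ball (r1 := r / 8) wy nb h1) _; move: r0; clear; lra.
have xE : x = w + (2^-1 : R[i]) *: b by rewrite /b scalerA mulVf ?pnatr_eq0// scale1r addrC subrK.
rewrite /= xE; have b1 : 0 < nrm b + 1 by rewrite ltr_wpDl// nrm_ge0.
apply: (@approximable_identity R (fun h => u (w + h *: b)) m (d / (nrm b + 1))).
- exact: ua.
- by move=> h /inb/um.
- exact: divr_gt0.
- move=> h; rewrite ltr_pdivlMr// => hd; apply: dP.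
  rewrite addrC addKr nrmZ; apply: le_lt_trans hd.
  by rewrite ler_wpM2l ?normc_ge0// lerDl.
- have -> : (2^-1 : R[i]) = (2^-1 : R)%:C by rewrite fmorphV rmorph_nat.
  by rewrite normcR ger0_norm ?invr_ge0.
Qed.

End LocallyHarmonic.

(** * Real linearity of the derivative in the direction *)

Section DirectionalDerivatives.
Context {R : realType} {V : normedModType R[i]}.
Implicit Types (U : set V) (u : V -> R) (y z b : V).

Lemma real_derive_eq u z b (D K d : R) : 0 < d ->
  (forall t, `|t| <= d -> `|u (z + t%:C *: b) - u z - t * D| <= K * t ^+ 2) ->
  real_derive b u z = D.
Proof.
move=> d0 H; have E : is_derive (0 : R) 1 (along u z b) D.
  apply: (is_derive_quadratic d0 (K := K)) => t td.
  by rewrite /along scale0r addr0; exact: H.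
by rewrite /real_derive derive1E; exact: derive_val.
Qed.

Lemma real_derive_quadratic U u z b : locally_harmonic U u -> U z ->
  exists K : R, exists2 d : R, 0 < d & forall t, `|t| <= d ->
    `|u (z + t%:C *: b) - u z - t * real_derive b u z| <= K * t ^+ 2.
Proof.
move=> uH Uz; have [r [m [r0 _ uB]]] := uH z Uz.
have [|_ _ H] := harmonic_ball_derive (y := z) b r0 uB.
  by rewrite subrr nrm0 divr_gt0.
have [s0 _] := half_radius b r0.
exists (4 * m / (r / 2 / (nrm b + 1)) ^+ 2), (r / 2 / (nrm b + 1) / 2).
  exact: divr_gt0.
exact: H.
Qed.

Lemma real_deriveZ U u z b (s : R) : locally_harmonic U u -> U z ->
  real_derive (s%:C *: b) u z = s * real_derive b u z.
Proof.
move=> uH Uz; have [K [d d0 H]] := real_derive_quadratic b uH Uz.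
have s1 : 0 < `|s| + 1 by rewrite ltr_wpDl.
apply: (@real_derive_eq _ _ _ _ (K * s ^+ 2) (d / (`|s| + 1))) => [|t].
  exact: divr_gt0.
rewrite ler_pdivlMr// => td; rewrite scalerA -realcM mulrA.
have := H (t * s); rewrite normrM => /(_ (le_trans _ td)).
by rewrite exprMn [t ^+ 2 * _]mulrC [K * (_ * _)]mulrA; apply; rewrite ler_wpM2l// lerDl.
Qed.

Lemma real_deriveN U u z b : locally_harmonic U u -> U z ->
  real_derive b (fun y => - u y) z = - real_derive b u z.
Proof.
move=> uH Uz; have [K [d d0 H]] := real_derive_quadratic b uH Uz.
apply: (@real_derive_eq (fun y => - u y) z b _ K d d0) => t /H.
by rewrite mulrN -!opprD normrN.
Qed.

(** Normalizing b makes the radius of the disc, and so the constant, independent of the direction: a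
    first-order expansion uniform in nearby base points and in all directions. *)
Lemma real_derive_uniform U u z : locally_harmonic U u -> U z ->
  exists K : R, exists2 r : R, 0 <= K /\ 0 < r & forall y b, nrm (y - z) < r -> nrm b <= r ->
    `|u (y + b) - u y - real_derive b u y| <= K * nrm b ^+ 2.
Proof.
move=> uH Uz; have [r [m [r0 rU uB]]] := uH z Uz.
have m0 : 0 <= m by apply: le_trans (uB.1 z _); rewrite ?subrr ?nrm0.
exists (4 * m / (r / 4) ^+ 2), (r / 8).
  by rewrite divr_gt0// mulr_ge0 ?invr_ge0 ?sqr_ge0// mulr_ge0.
move=> y b yz br; have Uy : U y by apply: rU; move: yz r0; clear; lra.
have [b0|b0] := eqVneq (nrm b) 0.
  have bE : b = (0 : R)%:C *: b by rewrite (nrm_eq0 b0) scaler0.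
  by rewrite {2}bE (real_deriveZ _ _ uH Uy) (nrm_eq0 b0) addr0 subrr mul0r subr0 normr0 nrm0 expr0n mulr0.
have nb0 : 0 < nrm b by rewrite lt_neqAle eq_sym b0 nrm_ge0.
pose b' := (nrm b)^-1%:C *: b.
have nb' : nrm b' = 1 by rewrite nrmZ normcR gtr0_norm ?invr_gt0// mulVf.
have bE : b = (nrm b)%:C *: b' by rewrite scalerA -realcM mulfV// scale1r.
have [|_ _ H] := harmonic_ball_derive (y := y) b' r0 uB.
  by move: yz r0; clear; lra.
have := H (nrm b); rewrite nb' -bE.
have -> : r / 2 / (1 + 1) = r / 4 by field.
rewrite ger0_norm ?nrm_ge0// -(real_deriveZ _ _ uH Uy) -bE; apply.
by move: br; clear; lra.
Qed.

(** The increment along t (b + b') is taken in two steps. The second starts at z + t b, where the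
    derivative along b' differs from that at z by O(t), since [real_derive b' u] is itself locally
    harmonic and hence Lipschitz. *)
Lemma real_deriveD U u z b b' : locally_harmonic U u -> U z ->
  real_derive (b + b') u z = real_derive b u z + real_derive b' u z.
Proof.
move=> uH Uz; have [K1 [r1 [K10 r10] H1]] := real_derive_uniform uH Uz.
have [r2 [m [r20 rU2 vB]]] := locally_harmonic_real_derive b' uH Uz.
have N : 0 < nrm b + nrm b' + 1 by rewrite ltr_wpDl// addr_ge0// nrm_ge0.
pose d := Num.min r1 (r2 / 4) / 2.
have m0 : 0 < Num.min r1 (r2 / 4) by rewrite lt_min r10 divr_gt0.
have d0 : 0 < d by exact: divr_gt0.
have [dr1 dr2] : d < r1 /\ d < r2 / 4.
  by apply/andP; rewrite -lt_min /d ltr_pdivrMr// ltr_pMr// ltr1n.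
apply: (@real_derive_eq _ _ _ _ (K1 * nrm b ^+ 2 + K1 * nrm b' ^+ 2 + 8 * m / r2 * nrm b)
  (d / (nrm b + nrm b' + 1))) => [|t].
  exact: divr_gt0.
rewrite ler_pdivlMr// => td.
have nt (c : V) : nrm (t%:C *: c) = `|t| * nrm c by rewrite nrmZ normcR.
have tb : `|t| * nrm b <= d.
  by apply: le_trans td; rewrite ler_wpM2l// -addrA lerDl addr_ge0// nrm_ge0.
have tb' : `|t| * nrm b' <= d.
  by apply: le_trans td; rewrite ler_wpM2l// addrAC lerDr addr_ge0// nrm_ge0.
have zb : nrm (z + t%:C *: b - z) < r1 by rewrite addrC addKr nt; exact: le_lt_trans tb dr1.
have Uzb : U (z + t%:C *: b).
  by apply: rU2; rewrite addrC addKr nt; move: tb dr2 r20; clear; lra.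
have zz : nrm (z - z) < r1 by rewrite subrr nrm0.
have E1 := H1 z (t%:C *: b) zz; rewrite nt (real_deriveZ _ _ uH Uz) in E1.
have E2 := H1 _ (t%:C *: b') zb; rewrite nt (real_deriveZ _ _ uH Uzb) in E2.
have zz2 : nrm (z - z) < r2 / 2 by rewrite subrr nrm0 divr_gt0.
have := harmonic_ball_lipschitz (b := t%:C *: b) r20 vB zz2; rewrite nt.
move=> /(_ (le_trans tb (ltW dr2))) E3.
have {}E1 := E1 (le_trans tb (ltW dr1)); have {}E2 := E2 (le_trans tb' (ltW dr1)).
rewrite scalerDr addrA.
have -> : u (z + t%:C *: b + t%:C *: b') - u z - t * (real_derive b u z + real_derive b' u z) =
  (u (z + t%:C *: b) - u z - t * real_derive b u z) +
  (u (z + t%:C *: b + t%:C *: b') - u (z + t%:C *: b) - t * real_derive b' u (z + t%:C *: b)) +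
  t * (real_derive b' u (z + t%:C *: b) - real_derive b' u z) by ring.
apply: le_trans (ler_normD _ _) _; apply: le_trans (lerD (ler_normD _ _) (lexx _)) _.
apply: le_trans (lerD (lerD E1 E2) _) _.
  by rewrite normrM; apply: ler_wpM2l E3.
have tt : `|t| * (8 * m / r2 * (`|t| * nrm b)) = 8 * m / r2 * nrm b * t ^+ 2.
  by rewrite -[t ^+ 2]real_normK ?num_real//; ring.
rewrite tt !exprMn real_normK ?num_real// [leRHS]mulrDl [X in _ <= X + _]mulrDl.
by rewrite lerD2r lerD// -mulrA [nrm _ ^+ 2 * _]mulrC.
Qed.

(** Linear terms cancel between opposite points and quadratic ones between t and it, which leaves
    the cubic remainder. *)
Lemma four_point_mean U u z b : locally_harmonic U u -> U z ->
  exists K : R, exists2 d : R, 0 < d & forall t, 0 < t -> t < d ->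
    `|u (z + t%:C *: b) + u (z + (- t)%:C *: b) + u (z + t%:C *: ('i *: b)) +
      u (z + (- t)%:C *: ('i *: b)) - 4 * u z| <= K * t ^+ 3.
Proof.
move=> uH Uz; have [r [m [r0 _ uB]]] := uH z Uz.
have [|A [C [_ H]]] := harmonic_ball_jet (y := z) b r0 uB.
  by rewrite subrr nrm0 divr_gt0.
have [s0 _] := half_radius b r0; move: s0 H; set s := r / 2 / _ => s0 H.
exists (4 * (4 * m / s ^+ 3)), (s / 2); first exact: divr_gt0.
move=> t t0 ts; rewrite !scalerA.
have J (h : R[i]) : normc h = t ->
    `|u (z + h *: b) - u z - Re (A * h + C * h ^+ 2)| <= 4 * m / s ^+ 3 * t ^+ 3.
  by move=> ht; have [] := H h; rewrite ht// ltW.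
have n1 : normc (t%:C : R[i]) = t by rewrite normcR gtr0_norm.
have n2 : normc ((- t)%:C : R[i]) = t by rewrite normcR normrN gtr0_norm.
have n3 : normc (t%:C * 'i : R[i]) = t by rewrite normcM n1 normci mulr1.
have n4 : normc ((- t)%:C * 'i : R[i]) = t by rewrite normcM n2 normci mulr1.
have E : Re (A * t%:C + C * t%:C ^+ 2) + Re (A * (- t)%:C + C * (- t)%:C ^+ 2) +
    Re (A * (t%:C * 'i) + C * (t%:C * 'i) ^+ 2) +
    Re (A * ((- t)%:C * 'i) + C * ((- t)%:C * 'i) ^+ 2) = 0.
  rewrite -!cReD -[RHS]/(Re 0); congr (Re _).
  by rewrite rmorphN /= !exprMn sqr_i; ring.
have := J _ n1; have := J _ n2; have := J _ n3; have := J _ n4; move: E.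
have -> : 4 * (4 * m / s ^+ 3) * t ^+ 3 = 4 * (4 * m / s ^+ 3 * t ^+ 3) by ring.
move=> E; rewrite !ler_norml => /andP[a1 a2] /andP[a3 a4] /andP[a5 a6] /andP[a7 a8].
move: a1 a2 a3 a4 a5 a6 a7 a8 E.
move: (4 * m / s ^+ 3 * t ^+ 3) (Re _) (Re _) (Re _) (Re _) => q c1 c2 c3 c4.
move: (u _) (u _) (u _) (u _) (u _) => u1 u2 u3 u4 u5; clear.
by move=> *; apply/andP; split; lra.
Qed.

End DirectionalDerivatives.

(** * Complex-valued harmonic functions and their products *)

Section ComplexHarmonic.
Context {R : realType} {V : normedModType R[i]}.
Local Notation C := R[i].
Implicit Types (U : set V) (F G : V -> C) (y z b : V).

Definition charmonic U G := locally_harmonic U (fun z => Re (G z)) /\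
  locally_harmonic U (fun z => Im (G z)).

(** The real differential of G, only R-linear in b. Twice its d-part and twice its dbar-part are
    [cderive b G z] minus, respectively plus, 'i times the derivative along 'i b. *)
Definition cderive b G z : C :=
  real_derive b (fun y => Re (G y)) z +i* real_derive b (fun y => Im (G y)) z.

Lemma locally_harmonic_ext U (u v : V -> R) : (forall z, u z = v z) ->
  locally_harmonic U u -> locally_harmonic U v.
Proof. by move=> /funext ->. Qed.

Lemma charmonicD U F G : charmonic U F -> charmonic U G -> charmonic U (fun z => F z + G z).
Proof.
move=> [F1 F2] [G1 G2]; split.
  by apply: locally_harmonic_ext (locally_harmonic_lin 1 1 F1 G1) => z; rewrite !mul1r cReD.
by apply: locally_harmonic_ext (locally_harmonic_lin 1 1 F2 G2) => z; rewrite !mul1r cImD.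
Qed.

Lemma charmonicZ U (a : C) G : charmonic U G -> charmonic U (fun z => a * G z).
Proof.
move=> [G1 G2]; split.
  apply: locally_harmonic_ext (locally_harmonic_lin (Re a) (- Im a) G1 G2) => z.
  by rewrite cReM mulNr.
by apply: locally_harmonic_ext (locally_harmonic_lin (Re a) (Im a) G2 G1) => z; rewrite cImM.
Qed.

Lemma charmonicJ U G : charmonic U G -> charmonic U (fun z => conjc (G z)).
Proof.
move=> [G1 G2]; split; first by apply: locally_harmonic_ext G1 => z; rewrite cReJ.
apply: locally_harmonic_ext (locally_harmonic_lin (-1) 0 G2 G2) => z.
by rewrite mulN1r mul0r addr0 cImJ.
Qed.

Lemma charmonic_cderive U b G : charmonic U G -> charmonic U (cderive b G).
Proof. by move=> [G1 G2]; split; exact: locally_harmonic_real_derive. Qed.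

Lemma charmonic_near U G z (e : R) : charmonic U G -> U z -> 0 < e ->
  \forall y \near z, normc (G y - G z) < e.
Proof.
move=> [G1 G2] Uz e0; have e20 : 0 < e / 2 by rewrite divr_gt0.
have [d1 d10 H1] := (continuous_nrmP _ _).1 (locally_harmonic_continuous G1 Uz) _ e20.
have [d2 d20 H2] := (continuous_nrmP _ _).1 (locally_harmonic_continuous G2 Uz) _ e20.
apply/nbhs_nrmP; exists (Num.min d1 d2); first by rewrite lt_min d10.
move=> y; rewrite lt_min => /andP[/H1 h1 /H2 h2].
apply: le_lt_trans (normc_le_ReIm _) _; rewrite cReB cImB.
by move: h1 h2; clear; lra.
Qed.

Lemma charmonic_neq0 U G z : charmonic U G -> U z -> G z != 0 -> \forall y \near z, G y != 0.
Proof.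
move=> Gh Uz Gz.
have e0 : 0 < normc (G z).
  by rewrite lt_neqAle normc_ge0 andbT eq_sym; apply: contra Gz => /eqP/normc_eq0 ->.
apply: filterS (charmonic_near Gh Uz e0) => y; apply: contraTneq => ->.
by rewrite sub0r normcN ltxx.
Qed.

Lemma charmonic_identity U G z : open U -> connected U -> charmonic U G -> U z ->
  (\forall y \near z, G y = 0) -> forall y, U y -> G y = 0.
Proof.
move=> oU cU [G1 G2] Uz Gz y Uy; apply: complex_ext.
  apply: (locally_harmonic_identity oU cU G1 Uz) => //.
  by apply: filterS Gz => x ->.
apply: (locally_harmonic_identity oU cU G2 Uz) => //.
by apply: filterS Gz => x ->.
Qed.

Lemma cderiveD U G z b b' : charmonic U G -> U z ->
  cderive (b + b') G z = cderive b G z + cderive b' G z.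
Proof.
move=> [G1 G2] Uz; apply: complex_ext; first by rewrite cReD; exact: real_deriveD G1 Uz.
by rewrite cImD; exact: real_deriveD G2 Uz.
Qed.

Lemma cderiveZ U G z b (s : R) : charmonic U G -> U z ->
  cderive (s%:C *: b) G z = s%:C * cderive b G z.
Proof.
move=> [G1 G2] Uz; apply: complex_ext; first by rewrite cReZ; exact: real_deriveZ G1 Uz.
by rewrite cImZ; exact: real_deriveZ G2 Uz.
Qed.

Lemma cderiveJ U G z b : charmonic U G -> U z ->
  cderive b (fun y => conjc (G y)) z = conjc (cderive b G z).
Proof.
move=> [_ G2] Uz; have E1 : (fun y => Re (conjc (G y))) = (fun y => Re (G y)).
  by apply/funext => y; exact: cReJ.
have E2 : (fun y => Im (conjc (G y))) = (fun y => - Im (G y)).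
  by apply/funext => y; exact: cImJ.
by rewrite /cderive E1 E2 (real_deriveN _ G2 Uz).
Qed.

Lemma cderive_uniform U G z : charmonic U G -> U z ->
  exists K : R, exists2 r : R, 0 <= K /\ 0 < r & forall b, nrm b <= r ->
    normc (G (z + b) - G z - cderive b G z) <= K * nrm b ^+ 2.
Proof.
move=> [G1 G2] Uz; have [K1 [r1 [K10 r10] H1]] := real_derive_uniform G1 Uz.
have [K2 [r2 [K20 r20] H2]] := real_derive_uniform G2 Uz.
exists (K1 + K2), (Num.min r1 r2); first by rewrite addr_ge0// lt_min r10.
move=> b; rewrite le_min => /andP[br1 br2].
apply: le_trans (normc_le_ReIm _) _; rewrite mulrDl !(cReB, cImB) /=.
by apply: lerD; [apply: H1|apply: H2] => //; rewrite subrr nrm0.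
Qed.

Lemma cderive_quadratic U G z b : charmonic U G -> U z ->
  exists K : R, exists2 d : R, 0 <= K /\ 0 < d & forall t : R, `|t| <= d ->
    normc (G (z + t%:C *: b) - G z - t%:C * cderive b G z) <= K * t ^+ 2.
Proof.
move=> Gh Uz; have [K [r [K0 r0] H]] := cderive_uniform Gh Uz.
have b1 : 0 < nrm b + 1 by rewrite ltr_wpDl// nrm_ge0.
exists (K * nrm b ^+ 2), (r / (nrm b + 1)).
  by rewrite divr_gt0// mulr_ge0// sqr_ge0.
move=> t; rewrite ler_pdivlMr// => tr; have nt : nrm (t%:C *: b) = `|t| * nrm b.
  by rewrite nrmZ normcR.
have := H (t%:C *: b); rewrite nt (cderiveZ _ _ Gh Uz) exprMn real_normK ?num_real//.
rewrite [t ^+ 2 * _]mulrC mulrA; apply; apply: le_trans tr.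
by rewrite ler_wpM2l// lerDl.
Qed.

Lemma four_point_cmean U G z b : charmonic U G -> U z ->
  exists K : R, exists2 d : R, 0 < d & forall t, 0 < t -> t < d ->
    normc (G (z + t%:C *: b) + G (z + (- t)%:C *: b) + G (z + t%:C *: ('i *: b)) +
      G (z + (- t)%:C *: ('i *: b)) - 4 * G z) <= K * t ^+ 3.
Proof.
move=> [G1 G2] Uz; have [K1 [d1 d10 H1]] := four_point_mean b G1 Uz.
have [K2 [d2 d20 H2]] := four_point_mean b G2 Uz.
exists (K1 + K2), (Num.min d1 d2); first by rewrite lt_min d10.
move=> t t0; rewrite lt_min => /andP[/(H1 t t0) h1 /(H2 t t0) h2].
apply: le_trans (normc_le_ReIm _) _; rewrite [leRHS]mulrDl.
have E : (4 : C) = (4 : R)%:C by rewrite rmorph_nat.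
by rewrite E !(cReB, cImB, cReD, cImD) cReZ cImZ; apply: lerD.
Qed.

(** x and y are increments with linear parts t p and t q; |t| <= 1 merges the product of the two
    remainders, of fourth order, into the cubic bound. *)
Lemma product_remainder (x y p q : C) (t K L : R) : 0 <= K -> 0 <= L -> `|t| <= 1 ->
  normc (x - t%:C * p) <= K * t ^+ 2 -> normc (y - t%:C * q) <= L * t ^+ 2 ->
  normc (x * y - (t ^+ 2)%:C * (p * q)) <= (normc p * L + normc q * K + K * L) * `|t| ^+ 3.
Proof.
move=> K0 L0 t1 xK yL; rewrite -(real_normK (num_real t)) in xK yL.
have aux (a c : C) (J : R) : normc c <= J * `|t| ^+ 2 ->
    normc (t%:C * (a * c)) <= normc a * J * `|t| ^+ 3.
  move=> cJ; rewrite normcM normcR (normcM a).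
  have -> : normc a * J * `|t| ^+ 3 = `|t| * (normc a * (J * `|t| ^+ 2)) by ring.
  by rewrite ler_wpM2l// ler_wpM2l ?normc_ge0.
have -> : x * y - (t ^+ 2)%:C * (p * q) = t%:C * (p * (y - t%:C * q)) +
    t%:C * (q * (x - t%:C * p)) + (x - t%:C * p) * (y - t%:C * q).
  by rewrite rmorphXn /=; ring.
apply: le_trans (normcD _ _) _; rewrite [leRHS]mulrDl; apply: lerD.
  by apply: le_trans (normcD _ _) _; rewrite [leRHS]mulrDl; apply: lerD; exact: aux.
rewrite normcM; apply: (@le_trans _ _ ((K * `|t| ^+ 2) * (L * `|t| ^+ 2))).
  by apply: ler_pM; rewrite ?normc_ge0.
have -> : (K * `|t| ^+ 2) * (L * `|t| ^+ 2) = K * L * (`|t| ^+ 3 * `|t|) by ring.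
by rewrite ler_wpM2l ?mulr_ge0// ler_piMr// exprn_ge0.
Qed.

(* Sum the second order expansions of F G over the points z + h b with
   h = t, -t, i t, - i t: the mean of a harmonic function is its value at z. *)
Lemma charmonic_product U F G z b : charmonic U F -> charmonic U G ->
  charmonic U (fun y => F y * G y) -> U z ->
  cderive b F z * cderive b G z + cderive ('i *: b) F z * cderive ('i *: b) G z = 0.
Proof.
move=> Fh Gh FGh Uz.
set p := cderive b F z; set p' := cderive b G z.
set q := cderive ('i *: b) F z; set q' := cderive ('i *: b) G z.
have [KF [dF dF0 SF]] := four_point_cmean b Fh Uz.
have [KG [dG dG0 SG]] := four_point_cmean b Gh Uz.
have [KP [dP dP0 SP]] := four_point_cmean b FGh Uz.
have [K1 [d1 [K10 d10] H1]] := cderive_quadratic b Fh Uz.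
have [K2 [d2 [K20 d20] H2]] := cderive_quadratic b Gh Uz.
have [K3 [d3 [K30 d30] H3]] := cderive_quadratic ('i *: b) Fh Uz.
have [K4 [d4 [K40 d40] H4]] := cderive_quadratic ('i *: b) Gh Uz.
rewrite -/p in H1; rewrite -/p' in H2; rewrite -/q in H3; rewrite -/q' in H4.
pose L := normc p * K2 + normc p' * K1 + K1 * K2.
pose M := normc q * K4 + normc q' * K3 + K3 * K4.
apply/normc_eq0/(@small_eq0 _ _ ((KP + normc (F z) * KG + normc (G z) * KF + 2 * L + 2 * M) / 2)
  (Num.min dF (Num.min dG (Num.min dP (Num.min d1 (Num.min d2 (Num.min d3 (Num.min d4 1)))))))).
  by rewrite !lt_min dF0 dG0 dP0 d10 d20 d30 d40 ltr01.
move=> t t0; rewrite !lt_min => /andP[/(SF t t0) {}SF] /andP[/(SG t t0) {}SG].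
move=> /andP[/(SP t t0) {}SP] /and5P[td1 td2 td3 td4 t1].
have ta : `|t| = t by rewrite gtr0_norm.
have tna : `| - t| = t by rewrite normrN.
have A1 := H1 t; have A2 := H1 (- t); have B1 := H2 t; have B2 := H2 (- t).
have A3 := H3 t; have A4 := H3 (- t); have B3 := H4 t; have B4 := H4 (- t).
rewrite ?ta ?tna in A1 A2 A3 A4 B1 B2 B3 B4.
have {H1 H2 H3 H4}T1 := product_remainder K10 K20 _ (A1 (ltW td1)) (B1 (ltW td2)).
have T2 := product_remainder K10 K20 _ (A2 (ltW td1)) (B2 (ltW td2)).
have T3 := product_remainder K30 K40 _ (A3 (ltW td3)) (B3 (ltW td4)).
have T4 := product_remainder K30 K40 _ (A4 (ltW td3)) (B4 (ltW td4)).
rewrite ?ta ?tna in T1 T2 T3 T4.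
have {}T1 := T1 (ltW t1); have {}T2 := T2 (ltW t1); have {}T3 := T3 (ltW t1).
have {}T4 := T4 (ltW t1).
rewrite -/L in T1 T2; rewrite -/M in T3 T4; rewrite sqrrN in T2 T4.
clear A1 A2 A3 A4 B1 B2 B3 B4.
move: SF SG SP T1 T2 T3 T4.
move: (F (z + t%:C *: b)) (F (z + (- t)%:C *: b)) (F (z + t%:C *: ('i *: b)))
  (F (z + (- t)%:C *: ('i *: b))) (F z) (G (z + t%:C *: b)) (G (z + (- t)%:C *: b))
  (G (z + t%:C *: ('i *: b))) (G (z + (- t)%:C *: ('i *: b))) (G z).
move=> f1 f2 f3 f4 f0 g1 g2 g3 g4 g0 SF SG SP T1 T2 T3 T4.
(* The left side is of order t^2, while all seven terms on the right are O(t^3): the four-point sums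
   of the product, of G and of F, then one product remainder for each point. *)
have E : (2 * t ^+ 2)%:C * (p * p' + q * q') =
    (f1 * g1 + f2 * g2 + f3 * g3 + f4 * g4 - 4 * (f0 * g0)) - f0 * (g1 + g2 + g3 + g4 - 4 * g0)
    - g0 * (f1 + f2 + f3 + f4 - 4 * f0)
    - ((f1 - f0) * (g1 - g0) - (t ^+ 2)%:C * (p * p'))
    - ((f2 - f0) * (g2 - g0) - (t ^+ 2)%:C * (p * p'))
    - ((f3 - f0) * (g3 - g0) - (t ^+ 2)%:C * (q * q'))
    - ((f4 - f0) * (g4 - g0) - (t ^+ 2)%:C * (q * q')).
  by rewrite realcM rmorph_nat; ring.
have B : normc ((2 * t ^+ 2)%:C * (p * p' + q * q')) <=
    KP * t ^+ 3 + normc f0 * (KG * t ^+ 3) + normc g0 * (KF * t ^+ 3) +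
    L * t ^+ 3 + L * t ^+ 3 + M * t ^+ 3 + M * t ^+ 3.
  rewrite E; do 4! (apply: le_trans (normcBD _ _) _; apply: lerD => //).
  apply: le_trans (normcBD _ _) _; apply: lerD; last by rewrite normcM ler_wpM2l ?normc_ge0.
  apply: le_trans (normcBD _ _) _; apply: lerD => //.
  by rewrite normcM ler_wpM2l ?normc_ge0.
have t20 : 0 < 2 * t ^+ 2 by rewrite mulr_gt0// exprn_gt0.
rewrite ger0_norm ?normc_ge0// -(ler_pM2l t20).
move: B; rewrite normcM normcR (gtr0_norm t20) => /le_trans; apply.
by rewrite le_eqVlt; apply/orP; left; apply/eqP; field.
Qed.

End ComplexHarmonic.

(** * The dichotomy and its translation into complex differentiability *)

Section HolomorphicOrAntiholomorphic.
Context {R : realType}.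
Local Notation C := R[i].

Lemma charmonic_dichotomy {V : normedModType C} {m : nat} (U : set V) (F : 'I_m -> V -> C) :
  open U -> connected U -> (forall j, charmonic U (F j)) ->
  (forall j k, charmonic U (fun z => F j z * F k z)) ->
  (forall j b z, U z -> cderive b (F j) z + 'i * cderive ('i *: b) (F j) z = 0) \/
  (forall j b z, U z -> cderive b (F j) z - 'i * cderive ('i *: b) (F j) z = 0).
Proof.
move=> oU cU Fh FFh.
pose A j b z := cderive b (F j) z - 'i * cderive ('i *: b) (F j) z.
pose B j b z := cderive b (F j) z + 'i * cderive ('i *: b) (F j) z.
have Bh j b : charmonic U (B j b).
  by apply: charmonicD; [|apply: charmonicZ]; exact: charmonic_cderive.
have Ah j b : charmonic U (A j b).
  have := charmonicD (charmonic_cderive b (Fh j))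
    (charmonicZ (- 'i) (charmonic_cderive ('i *: b) (Fh j))).
  by congr (charmonic U _); apply/funext => z; rewrite mulNr.
(* Expanding, the cross terms cancel and twice the relation of [charmonic_product] remains. *)
have AB j k b z : U z -> A j b z * B k b z + A k b z * B j b z = 0.
  move=> Uz; have := charmonic_product b (Fh j) (Fh k) (FFh j k) Uz; rewrite /A /B.
  move: (cderive b (F j) z) (cderive b (F k) z) => p p'.
  move: (cderive _ (F j) z) (cderive _ (F k) z) => q q' H.
  transitivity (2 * (p * p' - 'i ^+ 2 * (q * q'))); first by ring.
  by rewrite sqr_i mulN1r opprK H mulr0.
have AD j b b' z : U z -> A j (b + b') z = A j b z + A j b' z.
  by move=> Uz; rewrite /A scalerDr !(cderiveD _ _ (Fh j) Uz); ring.
have BD j b b' z : U z -> B j (b + b') z = B j b z + B j b' z.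
  by move=> Uz; rewrite /B scalerDr !(cderiveD _ _ (Fh j) Uz); ring.
have B0 j b z : U z -> A j b z != 0 -> forall k, B k b z = 0.
  move=> Uz Aj k; have Bj : B j b z = 0.
    have /eqP := AB j j b z Uz; rewrite -mulr2n mulrn_eq0 /= mulf_eq0 (negPf Aj) /=.
    by move=> /eqP.
  by have /eqP := AB j k b z Uz; rewrite Bj mulr0 addr0 mulf_eq0 (negPf Aj) => /eqP.
have A0 k b z : U z -> B k b z != 0 -> forall j, A j b z = 0.
  by move=> Uz Bk j; apply: contra_neq_eq Bk => Aj; exact: B0 Aj k.
(* Passage from one direction to all: if B k b' were nonzero, A j b' would vanish, so A j would be
   nonzero at b + b'. Then B k would vanish there, although its value is that at b', because B k b =
   0. *)
have Ball j b z : U z -> A j b z != 0 -> forall k b', B k b' z = 0.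
  move=> Uz Aj k b'; apply: contrapT => /eqP Bk.
  have := B0 j (b + b') z Uz; rewrite AD// (A0 k b' z Uz Bk j) addr0 => /(_ Aj k).
  by rewrite BD// (B0 j b z Uz Aj k) add0r => /eqP; rewrite (negPf Bk).
have [H|H] := pselect (exists j b z, U z /\ A j b z != 0); last first.
  right=> j b z Uz; apply: contrapT => /eqP Aj; apply: H; by exists j, b, z.
have [j [b [z [Uz Aj]]]] := H; left=> k b' y Uy.
apply: (charmonic_identity oU cU (Bh k b') Uz) => //.
have nU : \forall x \near z, U x by exact: open_nbhs_nbhs.
by apply: filterS2 nU (charmonic_neq0 (Ah j b) Uz Aj) => x Ux Ax; exact: Ball Ax k b'.
Qed.

Context {n m : nat}.
Local Notation V := 'rV[R[i]^o]_n.
Local Notation W := 'rV[R[i]^o]_m.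

Lemma differentiable_of_nrm (f : V -> W) z (df : {linear V -> W}) : continuous df ->
  (forall e : R, 0 < e -> \forall h \near (0 : V), nrm (f (z + h) - f z - df h) <= e * nrm h) ->
  differentiable f z.
Proof.
move=> dfc H; have E : f \o shift z = cst (f z) + df +o_ (0 : V) id.
  apply/eqaddoP => e e0; have er : e = (Re e)%:C.
    by move: e0; case: e => a b; rewrite ltcE /= => /andP[/eqP -> _].
  have r0 : 0 < Re e by move: e0; rewrite er ltcR.
  apply: filterS (H _ r0) => h.
  have -> : (f \o shift z - (cst (f z) + df)) h = f (z + h) - f z - df h.
    by rewrite [z + h]addrC -addrA -opprD.
  by rewrite er !nrmE -realcM lecR /=.
by have dE := diff_unique dfc E; apply/diff_locallyP; rewrite dE.
Qed.

(** The vanishing dbar-part makes the R-linear differential commute with 'i, hence C-linear; the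
    uniform first-order expansion of each coordinate then makes it the complex differential. *)
Lemma charmonic_holomorphic (U : set V) (f : V -> W) :
  (forall j, charmonic U (fun z => f z 0 j)) ->
  (forall j b z, U z -> cderive b (fun z => f z 0 j) z +
    'i * cderive ('i *: b) (fun z => f z 0 j) z = 0) ->
  holomorphic_on U f.
Proof.
move=> fh CR z Uz; pose F j (y : V) : C := f y 0 j.
have [df dfE] : exists df : V -> W, forall b j, df b 0 j = cderive b (F j) z.
  by exists (fun b => \row_j cderive b (F j) z) => b j; rewrite mxE.
have cZ (a : C) b j : cderive (a *: b) (F j) z = a * cderive b (F j) z.
  have ci : cderive ('i *: b) (F j) z = 'i * cderive b (F j) z.
    have /(congr1 (fun x => 'i * x)) := CR j b z Uz.
    rewrite mulr0 mulrDr mulrA -expr2 sqr_i mulN1r => /eqP.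
    by rewrite subr_eq0 => /eqP.
  have aE : a = (Re a)%:C + (Im a)%:C * 'i.
    by apply: complex_ext; rewrite !(cReD, cImD, cReZ, cImZ) /= ?mulr0 ?mulr1 ?addr0 ?add0r.
  rewrite {1}aE scalerDl -scalerA (cderiveD _ _ (fh j) Uz) !(cderiveZ _ _ (fh j) Uz).
  by rewrite -/(F j) ci [in RHS]aE; ring.
have cD b b' j : cderive (b + b') (F j) z = cderive b (F j) z + cderive b' (F j) z.
  exact: cderiveD (fh j) Uz.
have dfP (a : C) (x y : V) : df (a *: x + y) = a *: df x + df y.
  apply/rowP => j; rewrite [RHS]mxE [X in _ = X + _]mxE.
  apply: etrans (dfE _ _) _.
  rewrite (dfE x) (dfE y).
  apply: etrans (cD _ _ _) _; congr (_ + _).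
  exact: cZ.
pose L : {linear V -> W} := HB.pack df (GRing.isLinear.Build _ _ _ _ df dfP).
have approx j (e : R) : 0 < e -> \forall h \near (0 : V),
    normc (F j (z + h) - F j z - cderive h (F j) z) <= e * nrm h.
  move=> e0; have [K [r [K0 r0] H]] := cderive_uniform (fh j) Uz.
  have K1 : 0 < K + 1 by rewrite ltr_wpDl.
  apply/nbhs_nrmP; exists (Num.min r (e / (K + 1))); first by rewrite lt_min r0 divr_gt0.
  move=> h; rewrite subr0 lt_min ltr_pdivlMr// => /andP[/ltW hr hK].
  apply: le_trans (H h hr) _; rewrite expr2 mulrA ler_wpM2r ?nrm_ge0//.
  by rewrite mulrC; apply: le_trans (ltW hK); rewrite ler_wpM2l ?nrm_ge0// lerDl.
(* Continuity of the differential is reduced to 0 by linearity. There its value at h is the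
   increment of [F j] minus the first-order remainder, and both are small. *)
apply: (@differentiable_of_nrm f z L) => [|e e0].
  move=> x; apply/continuous_cnrmP => e e0; apply/nbhs_nrmP.
  suff : \forall h \near (0 : V), forall j, normc (cderive h (F j) z) < e.
    move=> /nbhs_nrmP[d d0 H]; apply/nbhs_nrmP; exists d => // y yx.
    rewrite -linearB; apply/(nrm_rV_lt _ e0) => j.
    by apply: le_lt_trans (H (y - x) _ j); rewrite ?subr0// -dfE.
  suff H j : \forall h \near (0 : V), normc (cderive h (F j) z) < e.
    have := @filter_forall V 'I_m _ (nbhs (0 : V)) _ H.
    by move=> /(_ (nbhs_filter _)).
  have e20 : 0 < e / 2 by rewrite divr_gt0.
  have /nbhs_nrmP[d1 d10 H1] := charmonic_near (fh j) Uz e20.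
  have /nbhs_nrmP[d2 d20 H2] := approx j 1 ltr01.
  apply/nbhs_nrmP; exists (Num.min d1 (Num.min d2 (e / 2))).
    by rewrite !lt_min d10 d20.
  move=> h; rewrite subr0 !lt_min => /and3P[h1 h2 he].
  have -> : cderive h (F j) z = (F j (z + h) - F j z) -
    (F j (z + h) - F j z - cderive h (F j) z) by ring.
  apply: le_lt_trans (normcBD _ _) _.
  have := H1 (z + h); rewrite addrC addKr => /(_ h1); have := H2 h; rewrite subr0 => /(_ h2).
  by rewrite mul1r addrC; move: he; rewrite /F; clear; lra.
have := @filter_forall V 'I_m _ (nbhs (0 : V)) _ (fun j => approx j e e0).
move=> /(_ (nbhs_filter _)); apply: filterS => h H.
apply: nrm_rV_le => [|j]; first by rewrite mulr_ge0 ?nrm_ge0// ltW.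
by have := H j; rewrite -dfE !mxE.
Qed.

End HolomorphicOrAntiholomorphic.

(** * Coordinates and their products as test functions *)

Section CoordinatePolynomials.
Context {R : realType}.
Local Notation C := R[i].

(** A polynomial on a line is its own approximation on every disc, so only a local bound has to be
    supplied. Multiplying G by -'i turns the imaginary part into a real part. *)
Lemma charmonic_linewise {V : normedModType C} (U : set V) (G : V -> C) : open U ->
  (forall y b, exists p : {poly C}, forall h, G (y + h *: b) = p.[h]) ->
  (forall z, exists m : R, forall y, nrm (y - z) < 1 -> normc (G y) <= m) ->
  charmonic U G.
Proof.
move=> oU Gp Gm; have H (a : C) : locally_harmonic U (fun z => Re (a * G z)).
  move=> z Uz; have [d d0 dU] := open_nrmP oU Uz; have [m mG] := Gm z.
  exists (Num.min d 1), (normc a * m); split; first by rewrite lt_min d0 ltr01.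
    by move=> y; rewrite lt_min => /andP[/dU].
  split=> [y|y b _].
    rewrite lt_min => /andP[_ /mG ym]; apply: le_trans (normc_Re _) _.
    by rewrite normcM ler_wpM2l ?normc_ge0.
  have [p pE] := Gp y b; apply: approximable_ext (approximable_poly (a *: p)) => h _.
  by rewrite hornerZ pE.
split; first by apply: locally_harmonic_ext (H 1) => z; rewrite mul1r.
apply: locally_harmonic_ext (H (- 'i)) => z.
by rewrite cReM /= oppr0 mul0r sub0r mulN1r opprK.
Qed.

Context {n : nat}.
Local Notation V := 'rV[R[i]^o]_n.

Lemma coord_line (j : 'I_n) (y b : V) :
  exists p : {poly C}, forall h, (y + h *: b) 0 j = p.[h].
Proof.
exists ((y 0 j)%:P + (b 0 j)%:P * 'X) => h.
by rewrite !hornerE !mxE; congr (_ + _); exact: mulrC.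
Qed.

Lemma coord_bound (j : 'I_n) (z y : V) : nrm (y - z) < 1 -> normc (y 0 j) <= nrm z + 1.
Proof.
move=> yz; apply: le_trans (normc_coord y j) _.
have := nrmD (y - z) z; rewrite subrK; move: yz; clear; lra.
Qed.

Lemma charmonic_coord (U : set V) j : open U -> charmonic U (fun z => z 0 j).
Proof.
move=> oU; apply: charmonic_linewise => // [y b|z]; first exact: coord_line.
by exists (nrm z + 1) => y; exact: coord_bound.
Qed.

Lemma charmonic_coord_product (U : set V) j k : open U ->
  charmonic U (fun z => z 0 j * z 0 k).
Proof.
move=> oU; apply: charmonic_linewise => // [y b|z].
  have [p pE] := coord_line j y b; have [q qE] := coord_line k y b.
  by exists (p * q) => h; rewrite hornerM pE qE.
exists ((nrm z + 1) * (nrm z + 1)) => y yz; rewrite normcM.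
by apply: ler_pM; rewrite ?normc_ge0//; exact: coord_bound.
Qed.

End CoordinatePolynomials.

(** * From pluriharmonic pullbacks to the equivalence *)

Lemma pluriharmonic_holomorphic (R : realType) (N M : nat)
    (OmegaN : set 'rV[R[i]^o]_N) (OmegaM : set 'rV[R[i]^o]_M)
    (f : 'rV[R[i]^o]_N -> 'rV[R[i]^o]_M) :
  open OmegaN -> connected OmegaN -> open OmegaM ->
  (forall h, pluriharmonic_on OmegaM h -> pluriharmonic_on OmegaN (h \o f)) ->
  holomorphic_on OmegaN f \/ holomorphic_on OmegaN (conj_fun f).
Proof.
move=> oN cN oM fharm.
have pull (G : 'rV[R[i]^o]_M -> R[i]) : charmonic OmegaM G ->
    charmonic OmegaN (fun z => G (f z)).
  move=> [G1 G2]; split; apply: pluriharmonic_locally_harmonic => //.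
    apply: (fharm (fun z => Re (G z))); exact: locally_harmonic_pluriharmonic.
  apply: (fharm (fun z => Im (G z))); exact: locally_harmonic_pluriharmonic.
have fj j := pull _ (charmonic_coord j oM).
have fjk j k := pull _ (charmonic_coord_product j k oM).
have [CR|CR] := charmonic_dichotomy oN cN fj fjk.
  by left; exact: charmonic_holomorphic.
(* Conjugation exchanges the d- and dbar-parts, so the vanishing d-part of f is the Cauchy-Riemann
   equation of [conj_fun f]. *)
right; apply: charmonic_holomorphic => [j|j b z Nz].
  have := charmonicJ (fj j); congr (charmonic _ _).
  by apply/funext => z; rewrite mxE.
have cJ c : cderive c (fun y => conj_fun f y 0 j) z = conjc (cderive c (fun y => f y 0 j) z).
  have -> : (fun y => conj_fun f y 0 j) = (fun y => conjc (f y 0 j)).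
    by apply/funext => y; rewrite mxE.
  exact: cderiveJ (fj j) Nz.
rewrite !cJ; have := CR j b z Nz.
move: (cderive _ _ _) (cderive _ _ _) => p q /eqP; rewrite subr_eq0 => /eqP ->.
by apply: complex_ext; rewrite !(cReD, cImD, cReM, cImM, cReJ, cImJ) /=; ring.
Qed.

Theorem theoremA (R : realType) (N M : nat) (hN : (1 <= N)%N) (hM : (1 <= M)%N)
    (OmegaN : set 'rV[R[i]^o]_N) (OmegaM : set 'rV[R[i]^o]_M)
    (oN : open OmegaN) (cN : connected OmegaN)
    (oM : open OmegaM) (cM : connected OmegaM)
    (f : 'rV[R[i]^o]_N -> 'rV[R[i]^o]_M)
    (fNM : forall z, OmegaN z -> OmegaM (f z)) :
  let assertion1 := forall phi : 'rV[R[i]^o]_M -> \bar R,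
    plurisubharmonic_on OmegaM phi -> plurisubharmonic_on OmegaN (phi \o f) in
  let assertion2 := forall h : 'rV[R[i]^o]_M -> R,
    pluriharmonic_on OmegaM h -> pluriharmonic_on OmegaN (h \o f) in
  let assertion3 := holomorphic_on OmegaN f \/
                    holomorphic_on OmegaN (conj_fun f) in
  (assertion1 <-> assertion2) /\ (assertion2 <-> assertion3).
Proof.
move=> a1 a2 a3.
have h12 : a1 -> a2.
  move=> H h hh; apply: locally_harmonic_pluriharmonic => //.
  apply: plurisubharmonic_locally_harmonic => // sg _.
  by apply: (H (fun z => (sg * h z)%:E)); exact: pluriharmonic_plurisubharmonic.
have h23 : a2 -> a3 by exact: pluriharmonic_holomorphic.
have h31 : a3 -> a1 by move=> H phi; exact: holomorphic_plurisubharmonic.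
by split; split=> //; [move=> /h23/h31|move=> /h31/h12].
Qed.
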